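(* Let $(X_n)_{n\ge1}$ be independent random vectors uniformly distributed in the discrete cube $\{-1,1\}^d$, let $X$ be a random vector in $\mathbb{R}^d$ independent of $(X_n)_{n\ge1}$ with characteristic function $f(t)=\mathbb{E}\,e^{i\langle t,X\rangle}$, $t\in\mathbb{R}^d$, and let $Z_n=\frac{1}{\sqrt n}(X+X_1+\dots+X_n)$. (i) If $Z_n$ have densities $p_n$ such that $\|p_n-\varphi\|_2\to0$ as $n\to\infty$, then $f(\pi k)=0$ for all $k\in\mathbb{Z}^d$, $k\neq0$. (ii) Conversely, suppose that $\mathbb{E}|X|<\infty$ and $$\int_{\mathbb{R}^d}\frac{|f(t)|\,|f'(t)|}{\|t\|^{d-1}}\,dt<\infty,$$ where $\|t\|$ denotes the distance from the point $t\in\mathbb{R}^d$ to the lattice $\pi\mathbb{Z}^d$. Then $Z_n$ have densities $p_n$, and the $L^2$-convergence $\|p_n-\varphi\|_2\to0$ as $n\to\infty$ holds true under the condition that $f(\pi k)=0$ for all $k\in\mathbb{Z}^d$, $k\ne0$.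
   Context: $\langle\cdot,\cdot\rangle$ and $|\cdot|$ are the canonical inner product and Euclidean norm; distances are Euclidean. $\varphi(x)=(2\pi)^{-d/2}e^{-|x|^2/2}$ is the standard normal density on $\mathbb{R}^d$. $\|u\|_2=\big(\int_{\mathbb{R}^d}|u(x)|^2dx\big)^{1/2}$. $f'=\nabla f$ is the gradient of $f$ (continuous when $\mathbb{E}|X|<\infty$) and $|f'|$ is its Euclidean norm. *)

(* Defs.v *)
From HB Require Import structures.
From mathcomp Require Import all_boot all_order all_algebra.
From mathcomp Require Import finmap.
From mathcomp Require Import complex.
From mathcomp Require Import all_classical all_reals all_analysis.

Set Implicit Arguments.
Unset Strict Implicit.
Unset Printing Implicit Defensive.

Import Order.TTheory GRing.Theory Num.Theory.
Import numFieldNormedType.Exports.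

Local Open Scope classical_set_scope.
Local Open Scope ring_scope.

(* The Borel sigma-algebra of R^n. The normed topology of 'rV[R]_n is that of
   the sup norm, so its open sets are the usual ones. *)
HB.instance Definition _ (R : realType) (n : nat) :=
  @isMeasurable.Build (sigma_display (@open 'rV[R]_n)) 'rV[R]_n
    <<s @open 'rV[R]_n >> (@sigma_algebra0 _ setT (@open 'rV[R]_n))
    (@sigma_algebraC _ (@open 'rV[R]_n))
    (@sigma_algebra_bigcup _ setT (@open 'rV[R]_n)).

Section Borel_measurability.
Context d (T : measurableType d) (R : realType) (n : nat).

Definition box (a b : 'rV[R]_n) : set 'rV[R]_n :=
  [set x | forall i, a 0 i < x 0 i < b 0 i].

Lemma open_rV_bigcup_box (U : set 'rV[R]_n) : open U ->
  U = \bigcup_(q in [set q : 'rV[rat]_n * 'rV[rat]_n |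
        box (map_mx ratr q.1) (map_mx ratr q.2) `<=` U])
      box (map_mx ratr q.1) (map_mx ratr q.2).
Proof.
move=> oU; apply/seteqP; split => [x Ux|x [q /= qU]]; last exact: qU.
have /nbhs_ballP[e /= e0 eU] : nbhs x U by exact: open_nbhs_nbhs.
have lo i : {q : rat | x 0 i - e < ratr q < x 0 i}.
  apply: cid; have [|q] := @rat_in_itvoo _ (x 0 i - e) (x 0 i).
    by rewrite ltrBlDr ltrDl.
  by rewrite in_itv /=; exists q.
have hi i : {q : rat | x 0 i < ratr q < x 0 i + e}.
  apply: cid; have [|q] := @rat_in_itvoo _ (x 0 i) (x 0 i + e).
    by rewrite ltrDl.
  by rewrite in_itv /=; exists q.
exists (\row_i sval (lo i), \row_i sval (hi i)) => /=.
  move=> y yb; apply: eU; split => // i j; rewrite (ord1 i).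
  have := yb j; rewrite !mxE.
  case: (lo j) (hi j) => [p /= /andP[p1 p2]] [q /= /andP[q1 q2]] /andP[y1 y2].
  rewrite /ball /= distrC ltr_distl (lt_trans p1 y1) /=.
  exact: lt_trans y2 q2.
move=> j; rewrite !mxE.
by case: (lo j) (hi j) => [p /= /andP[_ ->]] [q /= /andP[->]].
Qed.

Lemma measurable_fun_rV (f : T -> 'rV[R]_n) :
  (forall i, measurable_fun setT (fun x => f x 0 i)) -> measurable_fun setT f.
Proof.
move=> mf; apply: (@measurability _ _ _ _ setT f (@open 'rV[R]_n)) => //.
move=> _ [U oU <-]; rewrite setTI (open_rV_bigcup_box oU) preimage_bigcup.
rewrite bigcup_mkcond; apply: countable_bigcupT_measurable => // q.
case: ifP => // _.
rewrite (_ : _ @^-1` _ = \big[setI/setT]_(i < n)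
  (fun x => f x 0 i) @^-1` `](map_mx ratr q.1) 0 i, (map_mx ratr q.2) 0 i[).
  apply: bigsetI_measurable => i _.
  by rewrite -[X in measurable X]setTI; apply: mf => //; exact: measurable_itv.
rewrite -bigcap_seq; apply/seteqP; split => [x /= bx i _|x /= bx i].
  by rewrite /= in_itv /=; exact: bx.
by have := bx i (mem_index_enum i); rewrite /= in_itv.
Qed.

End Borel_measurability.

Lemma measurable_coord (R : realType) (n : nat) (i : 'I_n) :
  measurable_fun setT (fun x : 'rV[R]_n => x 0 i).
Proof.
apply: (measurability _ (measurable_realfun.RGenOpens.measurableE R)) => _ [_ [a [b ->]] <-].
rewrite setTI; apply: sub_sigma_algebra.
apply: open_comp; last exact: interval_open.
by move=> x _; exact: coord_continuous.
Qed.

Section Lebesgue_measure_rV.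
Variable R : realType.

Definition cons_rV (n : nat) (p : 'rV[R]_n * R) : 'rV[R]_n.+1 :=
  row_mx (p.2)%:M p.1 : 'rV[R]_(1 + n).

Lemma measurable_cons_rV n : measurable_fun setT (@cons_rV n).
Proof.
apply: measurable_fun_rV => i.
case: (splitP (i : 'I_(1 + n))) => j ij.
- rewrite [X in measurable_fun _ X](_ : _ = snd); first exact: measurable_snd.
  apply/funext => p; rewrite /cons_rV (_ : i = lshift n j); last exact/val_inj.
  by rewrite (@row_mxEl R 1 1 n) mxE ord1 eqxx mulr1n.
- rewrite [X in measurable_fun _ X](_ : _ = (fun x : 'rV[R]_n => x 0 j) \o fst).
    apply: measurableT_comp; last exact: measurable_fst.
    exact: measurable_coord.
  apply/funext => p; rewrite /cons_rV (_ : i = rshift 1 j); last exact/val_inj.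
  by rewrite (@row_mxEr R 1 1 n).
Qed.

Definition lebesgue_cons (n : nat) (mu : {measure set 'rV[R]_n -> \bar R}) :
    set 'rV[R]_n.+1 -> \bar R :=
  pushforward (mu \x @lebesgue_measure R)%E (@cons_rV n).

HB.instance Definition _ n (mu : {measure set 'rV[R]_n -> \bar R}) :=
  Measure.copy (lebesgue_cons mu)
    (measure_function_pushforward__canonical__measure_function_Measure
      (mu \x @lebesgue_measure R)%E (@measurable_cons_rV n)).

Fixpoint lebesgue_rV (n : nat) : {measure set 'rV[R]_n -> \bar R} :=
  match n with
  | 0 => dirac (0 : 'rV[R]_0)
  | m.+1 => lebesgue_cons (lebesgue_rV m)
  end.

End Lebesgue_measure_rV.

Lemma measurable_box (R : realType) n (a b : 'rV[R]_n) : measurable (box a b).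
Proof.
rewrite (_ : box a b = \big[setI/setT]_(i < n)
  (fun x : 'rV[R]_n => x 0 i) @^-1` `]a 0 i, b 0 i[).
  apply: bigsetI_measurable => i _.
  by rewrite -[X in measurable X]setTI; apply: measurable_coord => //; exact: measurable_itv.
rewrite -bigcap_seq; apply/seteqP; split => [x /= bx i _|x /= bx i].
  by rewrite /= in_itv /=; exact: bx.
by have := bx i (mem_index_enum i); rewrite /= in_itv.
Qed.

Lemma lebesgue_rV_box (R : realType) n (a b : 'rV[R]_n) : (forall i, a 0 i <= b 0 i) ->
  lebesgue_rV R n (box a b) = (\prod_(i < n) (b 0 i - a 0 i))%:E.
Proof.
elim: n a b => [|n IH] a b ab.
  by rewrite big_ord0 /= diracE mem_set // => -[].
rewrite big_ord_recl /= /lebesgue_cons /pushforward.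
pose a' := (\row_i a 0 (lift ord0 i)); pose b' := (\row_i b 0 (lift ord0 i)).
rewrite (_ : _ @^-1` _ = box a' b' `*` `]a 0 ord0, b 0 ord0[).
  rewrite product_measure1E; [|exact: measurable_box|exact: measurable_itv].
  rewrite IH; last by move=> i; rewrite !mxE.
  have /= -> := lebesgue_measure_itv `]a 0 ord0, b 0 ord0[; rewrite lte_fin.
  under eq_bigr do rewrite !mxE.
  case: ltP => [_|]; first by rewrite -EFinB -EFinM mulrC.
  by move=> h; rewrite (@le_anti _ _ (a 0 ord0) (b 0 ord0)) ?ab ?h// subrr mul0r mule0.
have c0 p : @cons_rV R n p 0 ord0 = p.2.
  rewrite /cons_rV (_ : ord0 = lshift n (ord0 : 'I_1)); last exact/val_inj.
  by rewrite (@row_mxEl R 1 1 n) mxE ord1 eqxx mulr1n.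
have c1 p j : @cons_rV R n p 0 (lift ord0 j) = p.1 0 j.
  rewrite /cons_rV (_ : lift ord0 j = rshift 1 j); last exact/val_inj.
  by rewrite (@row_mxEr R 1 1 n).
apply/seteqP; split => -[v x] /=.
  move=> h; split; last by have := h ord0; rewrite c0 in_itv.
  by move=> i; rewrite !mxE; have := h (lift ord0 i); rewrite c1.
move=> [h]; rewrite in_itv /= => h0 i.
have [j ->|->] := unliftP ord0 i; last by rewrite c0.
by rewrite c1; have := h j; rewrite !mxE.
Qed.

Section Euclidean_space.
Variables (R : realType) (d : nat).
Implicit Types x t : 'rV[R]_d.

Definition dotp x t : R := \sum_(j < d) x 0 j * t 0 j.

(* The library norm `|x| on 'rV[R]_d is the sup norm. *)
Definition enorm x : R := Num.sqrt (dotp x x).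

Definition enormC (z : 'rV[R[i]]_d) : R :=
  Num.sqrt (\sum_(j < d) Normc.normc (z 0 j) ^+ 2).

(* The gradient of a complex-valued function of d real variables; partial
   derivatives are taken on the real and imaginary parts. *)
Definition grad (f : 'rV[R]_d -> R[i]) t : 'rV[R[i]]_d :=
  \row_(j < d) Complex
    ('D_(delta_mx 0 j) (fun s => complex.Re (f s)) t)
    ('D_(delta_mx 0 j) (fun s => complex.Im (f s)) t).

Definition pi_lattice (k : 'rV[int]_d) : 'rV[R]_d :=
  pi *: map_mx intr k.

Definition dist_pi_lattice t : R :=
  inf (range (fun k : 'rV[int]_d => enorm (t - pi_lattice k))).

Definition std_normal_density x : R :=
  (2 * pi) `^ (- (d%:R / 2)) * expR (- (enorm x ^+ 2 / 2)).

End Euclidean_space.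

Section probability.
Context dd (T : measurableType dd) (R : realType) (P : probability T R).

Definition independent_seq d' (U : measurableType d') (X : nat -> T -> U) :=
  forall (J : {fset nat}) (A : nat -> set U), (forall i, measurable (A i)) ->
    P (\bigcap_(i in [set` J]) (X i @^-1` A i)) =
    (\prod_(i <- J) P (X i @^-1` A i))%E.

(* Y is independent of sigma(X 0, X 1, ...). *)
Definition independent_of_seq d' (U : measurableType d')
    (Y : T -> U) (X : nat -> T -> U) :=
  forall (A : set U) (B : set T), measurable A ->
    <<s \bigcup_n preimage_set_system setT (X n) measurable >> B ->
    P (Y @^-1` A `&` B) = (P (Y @^-1` A) * P B)%E.

Variable d : nat.

Definition uniform_on_cube (X : T -> 'rV[R]_d) :=
  forall e : 'rV[R]_d, (forall j, e 0 j = -1 \/ e 0 j = 1) ->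
    P (X @^-1` [set e]) = ((2 ^+ d)^-1)%:E.

(* E e^{i<t,X>}, with e^{i a} = cos a + i sin a. *)
Definition charfun (X : T -> 'rV[R]_d) (t : 'rV[R]_d) : R[i] :=
  Complex (\int[P]_w cos (dotp t (X w))) (\int[P]_w sin (dotp t (X w))).

Definition is_density (Z : T -> 'rV[R]_d) (p : 'rV[R]_d -> R) :=
  [/\ measurable_fun setT p, (forall x, 0 <= p x) &
      forall A : set 'rV[R]_d, measurable A ->
        P (Z @^-1` A) = (\int[lebesgue_rV R d]_(x in A) (p x)%:E)%E].

(* The sequence X_1, X_2, ... is indexed from 0: Xs k is X_{k+1}. *)
Definition normalized_sum (X : T -> 'rV[R]_d) (Xs : nat -> T -> 'rV[R]_d)
    (n : nat) (w : T) : 'rV[R]_d :=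
  (Num.sqrt n%:R)^-1 *: (X w + \sum_(k < n) Xs k w).

End probability.

(* Main.v *)
Require Import Defs.
From HB Require Import structures.
From mathcomp Require Import all_boot all_order all_algebra.
From mathcomp Require Import complex finmap.
From mathcomp Require Import all_classical all_reals all_analysis.
From mathcomp Require Import measurable_realfun.
From mathcomp Require Import ring lra.

Set Implicit Arguments.
Unset Strict Implicit.
Unset Printing Implicit Defensive.

Import Order.TTheory GRing.Theory Num.Theory.
Import numFieldNormedType.Exports.

Local Open Scope classical_set_scope.
Local Open Scope ring_scope.

(** Write f for the characteristic function of X and S_n for X_1 + ... + X_n. The characteristic
    function of Z_n is f_n(t) = f(t / sqrt n) (prod_j cos(t_j / sqrt n))^n, and the product of
    cosines has modulus 1 exactly on the lattice pi Z^d. Away from the origin, f itself has to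
    compensate for this.

    Necessity. Let v = pi k with k nonzero. The number <v, S_n> is pi times an integer whose parity
    is the same for all choices of signs, so cos(c + <sqrt n v, Z_n>) equals cos(c + <v, X>) up to a
    deterministic sign. Test the L^2 convergence against the wave cos(c + <sqrt n v, x>)
    exp(-|x|^2/2). By Cauchy-Schwarz its mean under Z_n is close to its mean under the normal law,
    which vanishes in the limit of high frequency ([test_cvg]). On the other hand Z_n is close to
    S_n / sqrt n, which is independent of X, so up to sign the same mean is close to E cos(c + <v,
    X>) times a factor with limit 2^(-d/2). Hence E cos(c + <v, X>) = 0 ([Rintegral_wave_eq0]), and
    two choices of c give f(pi k) = 0.

    Sufficiency. By Plancherel it is enough that f_n lies in L^2 and tends there to exp(-|t|^2/2).
    In the cell of the rescaled lattice around the origin this is dominated convergence, based on 0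
    <= cos x <= exp(-x^2/2) for |x| <= pi/2. The other cells contribute n^(d/2) times the integral
    of |f|^2 (prod cos)^(2n) over the cells around the points a = pi k with k nonzero. There f(a) =
    0, so |f(a+s)|^2 is at most the integral over u in [0,1] of 2 |s| (|f| |f'|)(a + u s), while the
    cosines give a weight at most exp(-n |s|^2). Exchanging the integrals and substituting x = a + u
    s leaves |f| |f'| against a radial weight ([cell_estimate]). Multiplied by n^(d/2), this weight
    is bounded by a constant times |x - a|^(1-d) and tends to 0 pointwise. The integrability
    hypothesis is thus the majorant for a second dominated convergence ([far_cvg]), and [fd_int_cvg]
    combines the two regions.

    Plancherel is reached by Gaussian smoothing: for smoothed laws it is an application of Tonelli
    ([parseval]), and letting the variance tend to 0 yields both the density and the L^2 bound
    ([exists_density]). *)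

(** * Lebesgue measure on row vectors: uniqueness on boxes, Tonelli by coordinates, scaling *)

Section leb.
Context {R : realType}.

Lemma box_set0 n (a b : 'rV[R]_n) i : b 0 i <= a 0 i -> box a b = set0.
Proof.
move=> ba; rewrite -subset0 => x /(_ i) /andP[ax xb].
by have := lt_trans ax xb; rewrite ltNge ba.
Qed.

Lemma boxI n (a b a' b' : 'rV[R]_n) : box a b `&` box a' b' =
  box (\row_i Num.max (a 0 i) (a' 0 i)) (\row_i Num.min (b 0 i) (b' 0 i)).
Proof.
apply/seteqP; split => [x [h h'] i|x h].
  by rewrite !mxE gt_max lt_min; move: (h i) (h' i) => /andP[-> ->] /andP[-> ->].
by split=> i; have := h i; rewrite !mxE gt_max lt_min => /andP[/andP[? ?] /andP[? ?]];
  apply/andP; split.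
Qed.

Definition boxes n : set (set 'rV[R]_n) := [set B | exists a b, B = box a b].

Lemma measurable_boxes n : @measurable _ 'rV[R]_n = <<s @boxes n >>.
Proof.
apply/seteqP; split.
  apply: smallest_sub; first exact: smallest_sigma_algebra.
  move=> U /open_rV_bigcup_box ->; rewrite bigcup_mkcond.
  apply: (@countable_bigcupT_measurable _ (g_sigma_algebraType (@boxes n))) => // q.
  case: ifPn => _; last exact: measurable0.
  by apply: sub_sigma_algebra; exists (map_mx ratr q.1), (map_mx ratr q.2).
apply: smallest_sub; first exact: sigma_algebra_measurable.
by move=> _ [a [b ->]]; exact: measurable_box.
Qed.

Lemma setI_closed_boxes n : setI_closed (@boxes n).
Proof. by move=> _ _ [a [b ->]] [a' [b' ->]]; rewrite boxI; do 2 eexists. Qed.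

Definition cube n (k : nat) : set 'rV[R]_n :=
  box (\row_i - k%:R) (\row_i k%:R).

Lemma bigcup_cube n : \bigcup_k @cube n k = setT.
Proof.
apply/seteqP; split => // x _; exists (Num.truncn (\sum_i `|x 0 i|)).+1 => // i.
rewrite !mxE -ltr_norml; apply: le_lt_trans (truncnS_gt _).
by rewrite (bigD1 i)//= lerDl sumr_ge0.
Qed.

(** Boxes form a pi-system that generates the Borel sets, and the cubes exhaust the space with
    finite mass. Degenerate boxes are empty, so only strict inequalities between the corners need be
    tested. *)
Lemma measure_unique_boxes n (m1 m2 : {measure set 'rV[R]_n -> \bar R}) :
  (forall a b : 'rV[R]_n, (forall i, a 0 i < b 0 i) -> (m1 (box a b) < +oo)%E) ->
  (forall a b : 'rV[R]_n, (forall i, a 0 i < b 0 i) -> m1 (box a b) = m2 (box a b)) ->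
  forall A, measurable A -> m1 A = m2 A.
Proof.
move=> fin12 eq12 A mA.
have box12 a b : m1 (box a b) = m2 (box a b) /\ (m1 (box a b) < +oo)%E.
  have [ab|/existsNP[i /negP]] := pselect (forall i, a 0 i < b 0 i).
    by split; [exact: eq12|exact: fin12].
  by rewrite -leNgt => /box_set0 ->; rewrite !measure0.
apply: (measure_unique (@boxes n) (@cube n)) => //.
- exact: measurable_boxes.
- exact: setI_closed_boxes.
- by move=> k; do 2 eexists.
- exact: bigcup_cube.
- by move=> _ [a [b ->]]; have [] := box12 a b.
- by move=> k; have [] := box12 (\row_i - k%:R) (\row_i k%:R).
Qed.

(** A constant name for the fixpoint [lebesgue_rV], to which the sigma-finite structure required by
    Tonelli can be attached. *)
Definition leb n : set 'rV[R]_n -> \bar R := lebesgue_rV R n.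

HB.instance Definition _ n := Measure.copy (@leb n) (lebesgue_rV R n).

Lemma leb_sigma_finite n : sigma_finite setT (@leb n).
Proof.
exists (@cube n); first by rewrite bigcup_cube.
move=> k; split; first exact: measurable_box.
by rewrite /leb lebesgue_rV_box ?ltry// => i; rewrite !mxE (@le_trans _ _ 0)// oppr_le0.
Qed.

HB.instance Definition _ n := Measure_isSigmaFinite.Build _ _ _ (@leb n)
  (@leb_sigma_finite n).

Lemma lebE n : lebesgue_rV R n = @leb n.
Proof. exact: eq_measure. Qed.

Lemma leb_box n (a b : 'rV[R]_n) : (forall i, a 0 i <= b 0 i) ->
  leb (box a b) = (\prod_(i < n) (b 0 i - a 0 i))%:E.
Proof. exact: lebesgue_rV_box. Qed.

Lemma ge0_integral_leb0 (F : 'rV[R]_0 -> \bar R) : measurable_fun [set: 'rV[R]_0] F ->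
  (\int[@leb 0]_(x in [set: 'rV[R]_0]) F x)%E = F 0.
Proof.
move=> mF; rewrite (eq_measure_integral (dirac (0 : 'rV[R]_0))) //.
by rewrite integral_dirac// diracT mul1e.
Qed.

Lemma ge0_integral_cons_rV n (m1 : {sigma_finite_measure set 'rV[R]_n -> \bar R})
    (m2 : {sigma_finite_measure set (measurableTypeR R) -> \bar R})
    (m : {measure set 'rV[R]_n.+1 -> \bar R}) (F : 'rV[R]_n.+1 -> \bar R) :
  (forall A, measurable A -> m A = (m1 \x m2)%E (@cons_rV R n @^-1` A)) ->
  measurable_fun setT F -> (forall x, 0 <= F x)%E ->
  (\int[m]_x F x = \int[m1]_v \int[m2]_x F (cons_rV (v, x)))%E.
Proof.
move=> mE mF F0.
have mc : measurable_fun setT (@cons_rV R n : 'rV[R]_n * measurableTypeR R -> _).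
  exact: measurable_cons_rV.
have := @ge0_integral_pushforward _ _ _ _ _ _ mc (m1 \x m2)%E setT F measurableT mF
   (fun x _ => F0 x).
rewrite preimage_setT fubini_tonelli1//=; last exact: measurableT_comp.
by move=> <-; apply: eq_measure_integral => A mA _; rewrite mE.
Qed.

Lemma ge0_integral_lebS n (F : 'rV[R]_n.+1 -> \bar R) : measurable_fun setT F ->
  (forall x, 0 <= F x)%E ->
  (\int[@leb n.+1]_x F x = \int[@leb n]_v \int[@lebesgue_measure R]_x F (cons_rV (v, x)))%E.
Proof.
move=> mF F0; apply: ge0_integral_cons_rV => // A mA.
Qed.

Lemma cons_rV_ord0 n (p : 'rV[R]_n * R) : cons_rV p 0 ord0 = p.2.
Proof.
rewrite /cons_rV (_ : ord0 = lshift n (ord0 : 'I_1)); last exact/val_inj.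
by rewrite (@row_mxEl R 1 1 n) mxE ord1 eqxx mulr1n.
Qed.

Lemma cons_rV_lift n (p : 'rV[R]_n * R) j : cons_rV p 0 (lift ord0 j) = p.1 0 j.
Proof.
rewrite /cons_rV (_ : lift ord0 j = rshift 1 j); last exact/val_inj.
by rewrite (@row_mxEr R 1 1 n).
Qed.

Lemma measurable_affine n (a : R) (b : 'rV[R]_n) :
  measurable_fun setT (fun x : 'rV[R]_n => a *: x + b).
Proof.
apply: measurable_fun_rV => i.
rewrite [X in measurable_fun _ X](_ : _ = fun x : 'rV[R]_n => a * x 0 i + b 0 i).
  apply: measurable_funD => //; apply: measurable_funM => //; exact: measurable_coord.
by apply/funext => x; rewrite !mxE.
Qed.

(** The image of Lebesgue measure under x -> a x + b and its multiple by a^-n agree on boxes, hence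
    everywhere. *)
Lemma ge0_integral_leb_affine n (a : R) (b : 'rV[R]_n) (F : 'rV[R]_n -> \bar R) :
  0 < a -> measurable_fun setT F -> (forall x, 0 <= F x)%E ->
  (\int[@leb n]_x F (a *: x + b)%R = (a ^- n)%:E * \int[@leb n]_x F x)%E.
Proof.
move=> a0 mF F0.
have mT := @measurable_affine n a b.
have c0 : 0 <= a ^- n by rewrite invr_ge0 exprn_ge0// ltW.
have -> : (a ^- n)%:E = ((NngNum c0)%:num)%:E by [].
rewrite -(@ge0_integral_mscale _ _ _ (@leb n) _ measurableT (NngNum c0) _ mF)//.
have := @ge0_integral_pushforward _ _ _ _ _ _ mT (@leb n) setT F measurableT mF
   (fun x _ => F0 x).
rewrite preimage_setT => <-; apply: eq_measure_integral => A mA _.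
have boxE c d : (fun x : 'rV[R]_n => a *: x + b) @^-1` box c d =
    box (a^-1 *: (c - b)) (a^-1 *: (d - b)).
  apply/seteqP; split => x /= h i; have := h i; rewrite !mxE ![a^-1 * _]mulrC;
    by rewrite ltr_pdivrMr// ltr_pdivlMr// ![_ * a]mulrC ltrBlDr ltrBrDr.
have m1E (c d : 'rV[R]_n) : (forall i, c 0 i < d 0 i) ->
    pushforward (@leb n) (fun x : 'rV[R]_n => a *: x + b) (box c d) =
    (a ^- n * \prod_(i < n) (d 0 i - c 0 i))%:E.
  move=> cd; rewrite /pushforward boxE leb_box; last first.
    by move=> i; rewrite !mxE ler_pM2l ?invr_gt0// lerD2r ltW.
  congr (_%:E); rewrite -exprVn -[X in _ ^+ X](card_ord n) -prodr_const -big_split/=.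
  by apply: eq_bigr => i _; rewrite !mxE -mulrBr; congr (_ * _); ring.
apply: (@measure_unique_boxes n (measure_function_pushforward__canonical__measure_function_Measure (@leb n) mT) (mscale (NngNum c0) (@leb n))) mA => // c d cd.
  by have := m1E c d cd; rewrite /= => ->; rewrite ltry.
rewrite [LHS](m1E c d cd) EFinM -leb_box//.
by move=> i; exact: ltW.
Qed.

Lemma integral_leb_prod n (g : 'I_n -> R -> R) (I : 'I_n -> R) :
  (forall i, measurable_fun setT (g i)) -> (forall i x, 0 <= g i x) ->
  (forall i, (\int[@lebesgue_measure R]_x (g i x)%:E = (I i)%:E)%E) ->
  (\int[@leb n]_x (\prod_(i < n) g i (x 0%R i))%:E = (\prod_(i < n) I i)%:E)%E.
Proof.
elim: n g I => [|n IH] g I mg g0 gI.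
  rewrite ge0_integral_leb0 ?big_ord0//.
  by under eq_fun do rewrite big_ord0; exact: measurable_cst.
rewrite ge0_integral_lebS; last 2 first.
- apply/measurable_EFinP; apply: measurable_prod => i _.
  by apply: measurableT_comp => //; exact: measurable_coord.
- by move=> x; rewrite lee_fin prodr_ge0.
under eq_integral => v _.
  under eq_integral => x _.
    rewrite big_ord_recl cons_rV_ord0 mulrC EFinM.
    under eq_bigr do rewrite cons_rV_lift.
    over.
  rewrite /= ge0_integralZl//; last 3 first.
  - by apply/measurable_EFinP; exact: mg.
  - by move=> x _; rewrite lee_fin.
  - by rewrite lee_fin prodr_ge0.
  rewrite gI muleC.
  over.
rewrite /= ge0_integralZl//; last 3 first.
- apply/measurable_EFinP; apply: measurable_prod => i _.
  by apply: measurableT_comp => //; exact: measurable_coord.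
- by move=> x _; rewrite lee_fin prodr_ge0.
- by rewrite -gI integral_ge0// => x _; rewrite lee_fin.
rewrite (IH (fun i => g (lift ord0 i)) (fun i => I (lift ord0 i)))//.
by rewrite -EFinM big_ord_recl.
Qed.

End leb.

(** * Differentiation and continuity under the integral sign for trigonometric integrands *)

Section under.
Context d (Y : measurableType d) {R : realType} (mu : {measure set Y -> \bar R}).

Lemma RintegralN (f : Y -> R) : mu.-integrable setT (EFin \o f) ->
  \int[mu]_y (- f y) = - \int[mu]_y f y.
Proof.
by move=> h; rewrite -mulN1r -RintegralZl//; apply: eq_Rintegral => y _; rewrite mulN1r.
Qed.

Lemma measurable_cos : measurable_fun setT (@cos R).
Proof. by apply: continuous_measurable_fun; exact: continuous_cos. Qed.

Lemma measurable_sin : measurable_fun setT (@sin R).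
Proof. by apply: continuous_measurable_fun; exact: continuous_sin. Qed.

Lemma measurable_cos_affine (A B : Y -> R) u : measurable_fun setT A ->
  measurable_fun setT B -> measurable_fun setT (fun y => cos (A y + u * B y)).
Proof.
move=> mA mB; apply: measurableT_comp; first exact: measurable_cos.
by apply: measurable_funD => //; apply: measurable_funM.
Qed.

Lemma integrable_bounded_mul (W g : Y -> R) : mu.-integrable setT (EFin \o W) ->
  measurable_fun setT g -> (forall y, `|g y| <= 1) ->
  mu.-integrable setT (EFin \o (fun y => W y * g y)).
Proof.
move=> iW mg g1; apply: (le_integrable _ _ _ iW) => //.
  apply/measurable_EFinP; apply: measurable_funM => //.
  by have /integrableP[/measurable_EFinP] := iW.
by move=> y _ /=; rewrite lee_fin normrM ler_piMr.
Qed.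

Lemma integrable_cos (W A B : Y -> R) u : mu.-integrable setT (EFin \o W) ->
  measurable_fun setT A -> measurable_fun setT B ->
  mu.-integrable setT (EFin \o (fun y => W y * cos (A y + u * B y))).
Proof.
move=> iW mA mB; apply: integrable_bounded_mul => //.
  exact: measurable_cos_affine.
by move=> y; rewrite ler_norml cos_geN1 cos_le1.
Qed.

(** The derivative in u of the integrand is bounded by |W B| uniformly in u, which is the domination
    required. *)
Lemma is_derive_integral_cos (W A B : Y -> R) (u : R) :
  measurable_fun setT A -> measurable_fun setT B ->
  mu.-integrable setT (EFin \o W) ->
  mu.-integrable setT (EFin \o (fun y => W y * B y)) ->
  is_derive u 1 (fun u => \int[mu]_y (W y * cos (A y + u * B y)))
    (- \int[mu]_y (W y * B y * sin (A y + u * B y))).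
Proof.
move=> mA mB iW iWB.
pose f u y := W y * cos (A y + u * B y).
have df (v : R) y : is_derive v 1 (f ^~ y) (- (W y * B y * sin (A y + v * B y))).
  rewrite /f; apply: is_derive_eq.
  by rewrite /GRing.scale/= !add0r ?mulr0 ?addr0 ?mul0r ?add0r; ring.
have uI : `]u - 1, u + 1[%classic u by rewrite /= in_itv/= ltrBlDr !ltrDl ltr01.
have fI x : `]u - 1, u + 1[%classic x -> mu.-integrable setT (EFin \o f x).
  by move=> _; exact: integrable_cos.
have fD x y : `]u - 1, u + 1[%classic x -> setT y -> derivable (f ^~ y) x 1.
  by move=> _ _; have [] := df x y.
have G0 y : 0 <= `|W y * B y| by [].
have iG : mu.-integrable setT (EFin \o (fun y => `|W y * B y|)).
  exact: integrable_norm iWB.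
have fG x y : `]u - 1, u + 1[%classic x -> setT y ->
    `|partial1of2 f x y| <= `|W y * B y|.
  move=> _ _; rewrite partial1of2E; have [_ ->] := df x y.
  by rewrite normrN normrM ler_piMr// ler_norml sin_geN1 sin_le1.
have D1 := derivable_under_integral measurableT uI fI fD G0 iG fG.
have D2 := differentiation_under_integral measurableT uI fI fD G0 iG fG.
apply: DeriveDef => //.
rewrite -derive1E D2 -RintegralN; last first.
  apply: integrable_bounded_mul => //; last by move=> y; rewrite ler_norml sin_geN1 sin_le1.
  apply: measurableT_comp; first exact: measurable_sin.
  by apply: measurable_funD => //; apply: measurable_funM.
by apply: eq_Rintegral => y _; rewrite /= partial1of2E; have [_ ->] := df u y.
Qed.

Lemma sinE_cos (x : R) : sin x = cos (- (pi / 2) + x).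
Proof. by rewrite cosD cosN sinN cos_pihalf sin_pihalf mul0r add0r mulN1r opprK. Qed.

Lemma cosE_sin (x : R) : cos x = - sin (- (pi / 2) + x).
Proof. by rewrite sinD cosN sinN cos_pihalf sin_pihalf mul0r addr0 mulN1r opprK. Qed.

(** Replacing the phase A by A - pi/2 turns the sine into a cosine. *)
Lemma is_derive_integral_sin (W A B : Y -> R) (u : R) :
  measurable_fun setT A -> measurable_fun setT B ->
  mu.-integrable setT (EFin \o W) ->
  mu.-integrable setT (EFin \o (fun y => W y * B y)) ->
  is_derive u 1 (fun u => \int[mu]_y (W y * sin (A y + u * B y)))
    (\int[mu]_y (W y * B y * cos (A y + u * B y))).
Proof.
move=> mA mB iW iWB.
have mA' : measurable_fun setT (fun y => - (pi / 2) + A y) by apply: measurable_funD.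
have := is_derive_integral_cos u mA' mB iW iWB.
rewrite (_ : (fun u : R => _) = (fun u => \int[mu]_y (W y * sin (A y + u * B y)))); last first.
  by apply/funext => v; apply: eq_Rintegral => y _; rewrite sinE_cos addrA.
move=> h; apply: is_derive_eq h _.
rewrite -RintegralN//; last first.
  apply: integrable_bounded_mul => //; last by move=> y; rewrite ler_norml sin_geN1 sin_le1.
  apply: measurableT_comp; first exact: measurable_sin.
  by apply: measurable_funD => //; apply: measurable_funM.
by apply: eq_Rintegral => y _; rewrite (cosE_sin (_ + _)) addrA mulrN.
Qed.

Lemma continuous_integral_cos (W A B : Y -> R) :
  measurable_fun setT A -> measurable_fun setT B ->
  mu.-integrable setT (EFin \o W) ->
  continuous (fun u : R => \int[mu]_y (W y * cos (A y + u * B y))).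
Proof.
move=> mA mB iW u.
have uI : u \in `]u - 1, u + 1[%classic by rewrite inE/= in_itv/= ltrBlDr !ltrDl ltr01.
have iWn : mu.-integrable setT (EFin \o (fun y => `|W y|)) by exact: integrable_norm iW.
apply: (@continuity_under_integral _ _ _ _ (fun (u : R) y => W y * cos (A y + u * B y))
  _ measurableT _ _ _ _ _ iWn _ u uI) => //.
- by move=> x _; exact: integrable_cos.
- apply/aeW => y _ x _; apply: (@cvgM R R); first exact: cvg_cst.
  apply: (cvg_comp (fun x => A y + x * B y) (@cos R)); last exact: continuous_cos.
  apply: cvgD; first exact: cvg_cst.
  by apply: (@cvgM R R); [exact: cvg_id|exact: cvg_cst].
- by move=> x _; apply/aeW => y _; rewrite normrM ler_piMr// ler_norml cos_geN1 cos_le1.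
Qed.

Lemma continuous_integral_sin (W A B : Y -> R) :
  measurable_fun setT A -> measurable_fun setT B ->
  mu.-integrable setT (EFin \o W) ->
  continuous (fun u : R => \int[mu]_y (W y * sin (A y + u * B y))).
Proof.
move=> mA mB iW.
rewrite (_ : (fun u : R => _) = (fun u => \int[mu]_y (W y * cos (- (pi / 2) + A y + u * B y)))).
  by apply: continuous_integral_cos => //; apply: measurable_funD.
by apply/funext => v; apply: eq_Rintegral => y _; rewrite sinE_cos addrA.
Qed.

End under.

(** * Dominated convergence for real-valued functions *)

Section dct.
Context d (T : measurableType d) {R : realType} (mu : {measure set T -> \bar R}).

Lemma EFin_dominated_cvg (f_ : nat -> T -> R) (f g : T -> R) :
  (forall n, measurable_fun setT (f_ n)) ->
  (forall x, f_ n x @[n --> \oo] --> f x) ->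
  mu.-integrable setT (EFin \o g) -> (forall n x, `|f_ n x| <= g x) ->
  mu.-integrable setT (EFin \o f) /\
  (\int[mu]_x (f_ n x)%:E)%E @[n --> \oo] --> (\int[mu]_x (f x)%:E)%E.
Proof.
move=> mf ff ig fg.
have mf' : measurable_fun setT f by apply: measurable_fun_cvg => // x _; exact: ff.
have mf1 n : measurable_fun setT (fun x => (f_ n x)%:E) by exact/measurable_EFinP.
have mf2 : measurable_fun setT (fun x => (f x)%:E) by exact/measurable_EFinP.
have aef : {ae mu, forall x, setT x -> (f_ n x)%:E @[n --> \oo] --> (f x)%:E}.
  by apply/aeW => x _; apply: cvg_EFin; [exact: nearW|exact: ff].
have aeg : {ae mu, forall x n, setT x -> (`|(f_ n x)%:E| <= (g x)%:E)%E}.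
  by apply/aeW => x n _; rewrite lee_fin.
by have [? _ ?] := dominated_convergence measurableT mf1 mf2 aef ig aeg.
Qed.

Lemma Rintegral_dominated_cvg (f_ : nat -> T -> R) (f g : T -> R) :
  (forall n, measurable_fun setT (f_ n)) ->
  (forall x, f_ n x @[n --> \oo] --> f x) ->
  mu.-integrable setT (EFin \o g) -> (forall n x, `|f_ n x| <= g x) ->
  (\int[mu]_x f_ n x) @[n --> \oo] --> \int[mu]_x f x.
Proof.
move=> mf ff ig fg; have [iF cF] := EFin_dominated_cvg mf ff ig fg.
rewrite /Rintegral; apply: fine_cvg; rewrite fineK//; exact: integrable_fin_num.
Qed.

End dct.

(** * The fundamental theorem of calculus on the whole line *)

Section calculus.
Context {R : realType}.
Notation mu := (@lebesgue_measure R).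

Lemma FTC2 (k k' : R -> R) (a b : R) : a < b ->
  (forall x : R, is_derive x 1 k (k' x)) -> continuous k' ->
  (\int[mu]_(x in `[a, b]) (k' x)%:E = (k b - k a)%:E)%E.
Proof.
move=> ab dk ck'.
have ck : continuous k.
  by move=> x; apply/differentiable_continuous/derivable1_diffP; have [] := dk x.
rewrite EFinB; apply: continuous_FTC2 => //.
- exact: continuous_subspaceT.
- split; first by move=> x _; have [] := dk x.
  + exact/cvg_at_right_filter/ck.
  + exact/cvg_at_left_filter/ck.
- by move=> x _; rewrite derive1E; have [_ ->] := dk x.
Qed.

(** The integral over [-n, n] is k(n) - k(-n), which tends to 0; by domination it also tends to the
    full integral. This is integration by parts with vanishing boundary terms. *)
Lemma integral_derive_eq0 (k k' : R -> R) :
  (forall x : R, is_derive x 1 k (k' x)) -> continuous k' ->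
  mu.-integrable setT (EFin \o k') ->
  k n%:R @[n --> \oo] --> (0:R) -> k (- n%:R) @[n --> \oo] --> (0:R) ->
  \int[mu]_x k' x = 0.
Proof.
move=> dk ck' ik' kp kn.
have mk' : measurable_fun setT k' by exact: continuous_measurable_fun.
pose f_ (n : nat) x := k' x * \1_`[- n%:R, n%:R] x.
have mf n : measurable_fun setT (f_ n).
  by apply: measurable_funM => //; exact: measurable_indic.
have ff x : f_ n x @[n --> \oo] --> k' x.
  apply: cvg_near_cst; near=> n.
  rewrite /f_ indicE mem_set ?mulr1//= in_itv/= -ler_norml.
  by near: n; exact: nbhs_infty_ger.
have fg n x : `|f_ n x| <= `|k' x|.
  by rewrite normrM ler_piMr// indicE; case: (_ \in _); rewrite ?normr0 ?normr1.
have ig : mu.-integrable setT (EFin \o (fun x => `|k' x|)) by exact: integrable_norm ik'.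
have lim1 := @Rintegral_dominated_cvg _ (measurableTypeR R) R mu f_ k' _ mf ff ig fg.
have lim2 : k n%:R - k (- n%:R) @[n --> \oo] --> 0.
  by rewrite -[X in _ --> X](subr0 0); apply: cvgB.
apply: (@cvg_unique _ (@Rhausdorff R) _ _ _ _ lim1); apply: cvg_trans lim2.
apply: near_eq_cvg; near=> n.
rewrite /Rintegral (_ : (\int[mu]_x (f_ n x)%:E)%E =
    (\int[mu]_(x in `[(- n%:R)%R, n%:R%R]) (k' x)%:E)%E); last first.
  rewrite [RHS]integral_mkcond; apply: eq_integral => x _.
  by rewrite /f_ patchE indicE; case: ifPn; rewrite ?mulr1 ?mulr0.
rewrite FTC2//.
by rewrite gtrN// ltr0n; near: n; exact: nbhs_infty_gt.
Unshelve. all: by end_near. Qed.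

End calculus.

(** * The Gaussian on the line: mass, moments and Fourier transform *)

Section gauss.
Context {R : realType}.
Notation mu := (@lebesgue_measure R).

(** The unnormalised Gaussian of precision [s]. Negative values of [s] occur too: [gam (- s^-1)] is
    an integrating factor in [Rintegral_gam_cos]. *)
Definition gam (s t : R) := expR (- (s * t ^+ 2 / 2)).

Lemma gam_ge0 s t : 0 <= gam s t. Proof. exact: expR_ge0. Qed.

Lemma gam_gt0 s t : 0 < gam s t. Proof. exact: expR_gt0. Qed.

Lemma gam_le1 s t : 0 <= s -> gam s t <= 1.
Proof. by move=> s0; rewrite -[leRHS]expR0 ler_expR oppr_le0 divr_ge0// mulr_ge0// sqr_ge0. Qed.

Lemma is_derive_gam (s t : R) : is_derive t 1 (gam s) (- (s * t) * gam s t).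
Proof.
rewrite /gam; apply: is_derive_eq; rewrite /GRing.scale/=.
by rewrite -/(gam s t); field.
Qed.

Lemma continuous_gam s : continuous (gam s).
Proof.
move=> x; apply/differentiable_continuous/derivable1_diffP.
by have [] := is_derive_gam s x.
Qed.

Lemma measurable_gam s : measurable_fun setT (gam s).
Proof. by apply: continuous_measurable_fun; exact: continuous_gam. Qed.

Lemma integral_gam_shift (s m : R) : 0 < s ->
  (\int[mu]_t (gam s (t - m))%:E = (Num.sqrt (2 * pi / s))%:E)%E.
Proof.
move=> s0.
have s1 : (Num.sqrt s)^-1 != 0 by rewrite invr_neq0// sqrtr_eq0 -ltNge.
have sE : (Num.sqrt s)^-1 ^+ 2 = s^-1 by rewrite exprVn sqr_sqrtr// ltW.
have peak0 := normal_peak_gt0 s1.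
have := integral_normal_pdf m (Num.sqrt s)^-1; rewrite normal_pdfE//.
rewrite (_ : (fun t => _) = (fun t => (normal_peak (Num.sqrt s)^-1)%:E * (gam s (t - m))%:E)%E); last first.
  apply/funext => t; rewrite -EFinM /normal_fun sE; congr (_ * expR _)%:E.
  by field; rewrite gt_eqF.
rewrite ge0_integralZl//; last 3 first.
- apply/measurable_EFinP; apply: measurableT_comp; first exact: measurable_gam.
  exact: measurable_funB.
- by move=> x _; rewrite lee_fin gam_ge0.
- by rewrite lee_fin ltW.
move=> h; have pV : (normal_peak (Num.sqrt s)^-1)^-1 * normal_peak (Num.sqrt s)^-1 = 1.
  by rewrite mulVf// gt_eqF.
rewrite -[LHS]mul1e -[in LHS]pV EFinM -muleA h mule1 /normal_peak invrK sE.
by congr (Num.sqrt _)%:E; rewrite mulr2n; field; rewrite gt_eqF.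
Qed.

Lemma integral_gam (s : R) : 0 < s -> (\int[mu]_t (gam s t)%:E = (Num.sqrt (2 * pi / s))%:E)%E.
Proof.
by move=> /(integral_gam_shift 0) <-; apply: eq_integral => x _; rewrite subr0.
Qed.

Lemma integrable_gam (s : R) : 0 < s -> mu.-integrable setT (EFin \o gam s).
Proof.
move=> s0; apply/integrableP; split; first by apply/measurable_EFinP; exact: measurable_gam.
under eq_integral => x _ do rewrite /= ger0_norm ?gam_ge0//.
by rewrite /= integral_gam// ltry.
Qed.

(** Half of the exponent absorbs the factor t, through |t| <= 1/s + s t^2/4 and 1 + x <= exp x. *)
Lemma integrable_gam_id (s : R) : 0 < s -> mu.-integrable setT (EFin \o (fun t => gam s t * t)).
Proof.
move=> s0.
have := integrableZl measurableT (s^-1 + 1) (integrable_gam (divr_gt0 s0 (ltr0Sn R 1))).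
apply: le_integrable => //.
  by apply/measurable_EFinP; apply: measurable_funM => //; exact: measurable_gam.
move=> t _; rewrite /= lee_fin.
have sV : 0 < s^-1 by rewrite invr_gt0.
rewrite [leRHS]ger0_norm; last by rewrite mulr_ge0 ?gam_ge0// addr_ge0// ltW.
have -> : gam s t = gam (s / 2) t * gam (s / 2) t.
  by rewrite /gam -expRD; congr expR; field.
rewrite normrM ger0_norm ?mulr_ge0 ?gam_ge0// mulrC mulrA ler_pM2r ?gam_gt0//.
have -> : gam (s / 2) t = (expR (s * t ^+ 2 / 4))^-1.
  by rewrite -expRN /gam; congr expR; field.
rewrite ler_pdivrMr ?expR_gt0//.
have h1 : `|t| <= s^-1 + s * t ^+ 2 / 4.
  rewrite -(ler_pM2l s0) mulrDr divff ?gt_eqF// -[t ^+ 2]real_normK ?num_real//.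
  by have := sqr_ge0 (1 - s * `|t| / 2); lra.
have h2 : s^-1 + s * t ^+ 2 / 4 <= (s^-1 + 1) * (1 + s * t ^+ 2 / 4).
  have : 0 <= s * t ^+ 2 / 4 by rewrite divr_ge0// mulr_ge0 ?sqr_ge0// ltW.
  nra.
apply: (le_trans h1); apply: (le_trans h2).
by rewrite ler_pM2l ?addr_gt0//; exact: expR_ge1Dx.
Qed.

Lemma cvg_gam (s : R) : 0 < s -> gam s (n%:R) @[n --> \oo] --> (0:R).
Proof.
move=> s0.
have e1 : `|expR (- (s / 2))| < 1.
  by rewrite ger0_norm ?expR_ge0// -[ltRHS]expR0 ltr_expR oppr_lt0 divr_gt0.
have h := cvg_expr e1.
apply: (squeeze_cvgr _ (cvg_cst 0) h); apply: nearW => n.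
rewrite gam_ge0/= -expRM_natl ler_expR mulrN lerN2.
have : n%:R <= n%:R ^+ 2 :> R.
  by rewrite -natrX ler_nat; case: n => // n; rewrite expnS leq_pmulr// expn_gt0.
by move=> n2; have := ler_wpM2l (ltW s0) n2; lra.
Qed.

(** Let F(a) be the integral and S(a) its analogue with t sin in place of cos. Then F' = -S by
    differentiation under the integral and s S = a F by parts, so F solves F' = -(a/s) F. The phase
    [b] treats cosine and sine together. *)
Lemma Rintegral_gam_cos (s a b : R) : 0 < s ->
  \int[mu]_t (gam s t * cos (b + a * t)) =
  cos b * (Num.sqrt (2 * pi / s) * gam s^-1 a).
Proof.
move=> s0.
have ig := integrable_gam s0; have igt := integrable_gam_id s0.
have mc (c : R) : measurable_fun setT (fun _ : R => c) by exact: measurable_cst.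
have mi : measurable_fun setT (fun t : R => t) by exact: measurable_id.
pose F a := \int[mu]_t (gam s t * cos (b + a * t)).
pose S a := \int[mu]_t (gam s t * t * sin (b + a * t)).
have dF (u : R) : is_derive u 1 F (- S u).
  exact: (@is_derive_integral_cos _ (measurableTypeR R) _ mu _ _ _ u (mc b) mi ig igt).
have SE u : s * S u = u * F u.
  (* [k'] is the derivative of gam s t sin(b + u t), so its integral vanishes. *)
  pose k' (t : R) := - s * (gam s t * t * sin (b + u * t)) + u * (gam s t * cos (b + u * t)).
  have msin : measurable_fun setT (fun t => sin (b + u * t)).
    by apply: measurableT_comp; [exact: measurable_sin|apply: measurable_funD => //; apply: measurable_funM].
  have igs : mu.-integrable setT (EFin \o (fun t => gam s t * t * sin (b + u * t))).
    by apply: integrable_bounded_mul => // t; rewrite ler_norml sin_geN1 sin_le1.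
  have igc : mu.-integrable setT (EFin \o (fun t => gam s t * cos (b + u * t))).
    exact: integrable_cos.
  have ik1 : mu.-integrable setT (EFin \o (fun t => - s * (gam s t * t * sin (b + u * t)))).
    exact: (integrableZl _ (- s) igs).
  have ik2 : mu.-integrable setT (EFin \o (fun t => u * (gam s t * cos (b + u * t)))).
    exact: (integrableZl _ u igc).
  have ck g (h : R -> R) : (forall x : R, is_derive x 1 g (h x)) -> continuous g.
    by move=> dg x; apply/differentiable_continuous/derivable1_diffP; have [] := dg x.
  have dsin (t : R) : is_derive t 1 (fun t => sin (b + u * t)) (u * cos (b + u * t)).
    by apply: is_derive_eq; rewrite /GRing.scale/= add0r mulr1 ?add0r; ring.
  have dcos (t : R) : is_derive t 1 (fun t => cos (b + u * t)) (- (u * sin (b + u * t))).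
    by apply: is_derive_eq; rewrite /GRing.scale/= add0r mulr1 ?add0r; ring.
  have sq (v : nat -> R) : (forall n, `|v n| <= gam s n%:R) -> v n @[n --> \oo] --> (0:R).
    move=> hv; apply: norm_cvg0; apply: (squeeze_cvgr _ (cvg_cst 0) (cvg_gam s0)).
    by apply: nearW => n; rewrite normr_ge0 hv.
  have : \int[mu]_t k' t = 0.
    apply: (@integral_derive_eq0 R (fun t => gam s t * sin (b + u * t))).
    - move=> t; have dg := is_derive_gam s t; have ds := dsin t.
      by apply: is_derive_eq; rewrite /GRing.scale/= /k'; ring.
    - move=> t; apply: cvgD; apply: (@cvgM R R); try exact: cvg_cst; apply: (@cvgM R R).
      + by apply: (@cvgM R R); [exact: continuous_gam|exact: cvg_id].
      + exact: (ck _ _ dsin).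
      + exact: continuous_gam.
      + exact: (ck _ _ dcos).
    - exact: (integrableD measurableT ik1 ik2).
    - apply: sq => n; rewrite normrM ger0_norm ?gam_ge0// ler_piMr ?gam_ge0//.
      by rewrite ler_norml sin_geN1 sin_le1.
    - apply: sq => n; rewrite normrM ger0_norm ?gam_ge0// {1}/gam sqrrN -/(gam _ _).
      by rewrite ler_piMr ?gam_ge0// ler_norml sin_geN1 sin_le1.
  rewrite RintegralD// !RintegralZl// -/(S u) -/(F u) mulNr => /eqP.
  by rewrite addrC subr_eq0 => /eqP.
(* The integrating factor makes [K] constant, so it may be evaluated at 0. *)
pose K u := F u * gam (- s^-1) u.
have dK (u : R) : is_derive u 1 K 0.
  rewrite /K; have dg := is_derive_gam (- s^-1) u.
  apply: is_derive_eq; rewrite /GRing.scale/=.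
  have -> : S u = u * F u / s by rewrite -SE; field; rewrite gt_eqF.
  by field; rewrite gt_eqF.
have : K a = K 0 by apply: is_derive_0_is_cst.
rewrite /K [gam _ 0]/gam expr0n/= mulr0 mul0r oppr0 expR0 mulr1 => KE.
have gV : gam (- s^-1) a * gam s^-1 a = 1.
  by rewrite /gam -expRD -[RHS]expR0; congr expR; ring.
rewrite -/(F a) -[LHS]mulr1 -[in LHS]gV mulrA KE mulrA; congr (_ * _).
rewrite /F.
transitivity (\int[mu]_t (cos b * gam s t)).
  by apply: eq_Rintegral => t _; rewrite mul0r addr0 mulrC.
rewrite RintegralZl//; congr (_ * _).
by rewrite /Rintegral integral_gam.
Qed.


End gauss.

(** * The Gaussian in n dimensions: Fourier transform and convolution semigroup *)

Section heat.
Context {R : realType}.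
Notation mu := (@lebesgue_measure R).

Lemma dotpC n (x t : 'rV[R]_n) : dotp x t = dotp t x.
Proof. by apply: eq_bigr => j _; rewrite mulrC. Qed.

Lemma dotp_recl n (x t : 'rV[R]_n.+1) :
  dotp x t = x 0 ord0 * t 0 ord0 + \sum_j x 0 (lift ord0 j) * t 0 (lift ord0 j).
Proof. exact: big_ord_recl. Qed.

Lemma measurable_dotp d (T : measurableType d) n (f g : T -> 'rV[R]_n) :
  measurable_fun setT f -> measurable_fun setT g ->
  measurable_fun setT (fun x => dotp (f x) (g x)).
Proof.
move=> mf mg; apply: measurable_sum => j; apply: measurable_funM.
- by apply: (measurableT_comp (measurable_coord j)).
- by apply: (measurableT_comp (measurable_coord j)).
Qed.

Lemma measurable_rVD d (T : measurableType d) n (f g : T -> 'rV[R]_n) :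
  measurable_fun setT f -> measurable_fun setT g ->
  measurable_fun setT (fun x => f x + g x).
Proof.
move=> mf mg; apply: measurable_fun_rV => i.
rewrite [X in measurable_fun _ X](_ : _ = fun x => f x 0 i + g x 0 i); last first.
  by apply/funext => x; rewrite mxE.
by apply: measurable_funD; apply: (measurableT_comp (measurable_coord i)).
Qed.

Lemma measurable_rVZ d (T : measurableType d) n (f : T -> R) (g : T -> 'rV[R]_n) :
  measurable_fun setT f -> measurable_fun setT g ->
  measurable_fun setT (fun x => f x *: g x).
Proof.
move=> mf mg; apply: measurable_fun_rV => i.
rewrite [X in measurable_fun _ X](_ : _ = fun x => f x * g x 0 i); last first.
  by apply/funext => x; rewrite mxE.
by apply: measurable_funM => //; apply: (measurableT_comp (measurable_coord i)).
Qed.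

Lemma measurable_rVB d (T : measurableType d) n (f g : T -> 'rV[R]_n) :
  measurable_fun setT f -> measurable_fun setT g ->
  measurable_fun setT (fun x => f x - g x).
Proof.
move=> mf mg; apply: measurable_rVD => //.
under eq_fun do rewrite -scaleN1r.
by apply: measurable_rVZ.
Qed.

Definition Gam n (s : R) (t : 'rV[R]_n) := expR (- (s * dotp t t / 2)).

Lemma Gam_prod n s (t : 'rV[R]_n) : Gam s t = \prod_(j < n) gam s (t 0 j).
Proof.
rewrite /Gam /dotp /gam -expR_sum; congr expR.
by rewrite mulr_sumr mulr_suml -sumrN; apply: eq_bigr => j _; rewrite expr2.
Qed.

Lemma Gam_ge0 n s (t : 'rV[R]_n) : 0 <= Gam s t. Proof. exact: expR_ge0. Qed.

Lemma dotp_ge0 n (t : 'rV[R]_n) : 0 <= dotp t t.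
Proof. by apply: sumr_ge0 => j _; rewrite -expr2 sqr_ge0. Qed.

Lemma Gam_le1 n (s : R) (t : 'rV[R]_n) : 0 <= s -> Gam s t <= 1.
Proof.
by move=> s0; rewrite -[leRHS]expR0 ler_expR oppr_le0 divr_ge0// mulr_ge0// dotp_ge0.
Qed.

Lemma measurable_Gam n s : measurable_fun setT (@Gam n s).
Proof.
apply: (measurableT_comp (@measurable_expR R)).
apply: measurableT_comp => //; apply: measurable_funM => //; apply: measurable_funM => //.
by apply: measurable_dotp; exact: measurable_id.
Qed.

Lemma Gam_cons n s (p : 'rV[R]_n * R) : Gam s (cons_rV p) = gam s p.2 * Gam s p.1.
Proof.
rewrite !Gam_prod big_ord_recl cons_rV_ord0; congr (_ * _).
by apply: eq_bigr => j _; rewrite cons_rV_lift.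
Qed.

Lemma integral_gam_cos (s A B a b : R) : 0 < s ->
  (\int[mu]_t ((A + B * cos (b + a * t)) * gam s t)%:E =
  (Num.sqrt (2 * pi / s) * (A + B * gam s^-1 a * cos b))%:E)%E.
Proof.
move=> s0.
have ig := integrable_gam s0.
have i1 : mu.-integrable setT (EFin \o (fun t => A * gam s t)) by exact: (integrableZl _ A ig).
have mi : measurable_fun setT (fun t : R => t) by exact: measurable_id.
have mb : measurable_fun setT (fun t : R => b) by exact: measurable_cst.
have i2 : mu.-integrable setT (EFin \o (fun t => gam s t * cos (b + a * t))).
  exact: (@integrable_cos _ (measurableTypeR R)).
have i3 : mu.-integrable setT (EFin \o (fun t => B * (gam s t * cos (b + a * t)))).
  exact: (integrableZl _ B i2).
transitivity (\int[mu]_t (A * gam s t + B * (gam s t * cos (b + a * t)))%:E)%E.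
  by apply: eq_integral => t _; congr (_%:E); ring.
rewrite -[LHS]fineK; last exact: (integrable_fin_num _ (integrableD measurableT i1 i3)).
congr (_%:E); rewrite -/(Rintegral _ _ _) RintegralD// !RintegralZl// Rintegral_gam_cos//.
rewrite /Rintegral integral_gam//=; ring.
Qed.

(** The condition |B| <= A keeps the integrand nonnegative, so Tonelli can remove one coordinate at
    a time. Each removal scales A and B alike except for a further factor at most 1 on B, so the
    condition persists. *)
Lemma integral_Gam_cos n (s A B b : R) (a : 'rV[R]_n) : 0 < s -> `|B| <= A ->
  (\int[@leb R n]_t ((A + B * cos (b + dotp a t)) * Gam s t)%:E =
  (Num.sqrt (2 * pi / s) ^+ n * (A + B * Gam s^-1 a * cos b))%:E)%E.
Proof.
move=> s0; elim: n A B b a => [|n IH] A B b a BA.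
  rewrite ge0_integral_leb0.
    rewrite Gam_prod big_ord0 /dotp big_ord0 expr0.
    by rewrite Gam_prod big_ord0 addr0 !mulr1 mul1r.
  under eq_fun do rewrite Gam_prod big_ord0 /dotp big_ord0; exact: measurable_cst.
have mcos m (a' : 'rV[R]_m) A' B' b' : measurable_fun setT
    (fun t : 'rV[R]_m => ((A' + B' * cos (b' + dotp a' t)) * Gam s t)%:E).
  apply/measurable_EFinP; apply: measurable_funM; last exact: measurable_Gam.
  apply: measurable_funD => //; apply: measurable_funM => //.
  apply: measurableT_comp; first exact: measurable_cos.
  by apply: measurable_funD => //; apply: measurable_dotp.
have ge0 m (a' : 'rV[R]_m) A' B' b' (t : 'rV[R]_m) : `|B'| <= A' ->
    (0 <= ((A' + B' * cos (b' + dotp a' t)) * Gam s t)%:E)%E.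
  move=> h; rewrite lee_fin mulr_ge0 ?Gam_ge0// -lerBlDr sub0r.
  rewrite (le_trans _ h)// (le_trans (ler_norm _))// normrN normrM.
  by rewrite ler_piMr// ler_norml cos_geN1 cos_le1.
rewrite ge0_integral_lebS//; last by move=> x; exact: ge0.
pose a' := \row_j a 0 (lift ord0 j) : 'rV[R]_n.
set c := Num.sqrt (2 * pi / s).
have c0 : 0 <= c by rewrite sqrtr_ge0.
transitivity (\int[@leb R n]_v ((c * A + c * B * gam s^-1 (a 0 ord0) *
     cos (b + dotp a' v)) * Gam s v)%:E)%E.
  apply: eq_integral => v _.
  transitivity (\int[mu]_x ((Gam s v * A + Gam s v * B * cos (b + dotp a' v + a 0 ord0 * x)) * gam s x)%:E)%E.
    apply: eq_integral => x _; congr (_%:E).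
    rewrite Gam_cons /= dotp_recl cons_rV_ord0/=.
    rewrite (_ : \sum_j _ = dotp a' v); last first.
      by apply: eq_bigr => j _; rewrite cons_rV_lift mxE.
    by rewrite (addrC _ (dotp a' v)) addrA; ring.
  by rewrite integral_gam_cos// -/c; congr (_%:E); ring.
rewrite IH; last first.
  rewrite normrM normrM (ger0_norm c0) [X in _ * X]ger0_norm ?gam_ge0//.
  rewrite -mulrA ler_wpM2l// (le_trans _ BA)// ler_piMr// gam_le1// invr_ge0 ltW//.
congr (_%:E); rewrite -/c exprSr.
have -> : Gam s^-1 a = gam s^-1 (a 0 ord0) * Gam s^-1 a'.
  by rewrite !Gam_prod big_ord_recl; congr (_ * _); apply: eq_bigr => j _; rewrite mxE.
ring.
Qed.

Lemma dotp0l n (t : 'rV[R]_n) : dotp 0 t = 0.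
Proof. by rewrite /dotp big1// => j _; rewrite mxE mul0r. Qed.

Lemma Gam0 n s : Gam s (0 : 'rV[R]_n) = 1.
Proof. by rewrite /Gam dotp0l mulr0 mul0r oppr0 expR0. Qed.

(** The density of the centred normal law whose covariance is [v] times the identity. *)
Definition hk n (v : R) (y : 'rV[R]_n) := (Num.sqrt (2 * pi * v))^-1 ^+ n * Gam v^-1 y.

Lemma hk_ge0 n v (y : 'rV[R]_n) : 0 <= hk v y.
Proof. by rewrite mulr_ge0 ?Gam_ge0// exprn_ge0// invr_ge0 sqrtr_ge0. Qed.

Lemma hk_le n (v : R) (y : 'rV[R]_n) : 0 <= v -> hk v y <= hk v (0 : 'rV[R]_n).
Proof.
move=> v0; rewrite /hk ler_wpM2l ?exprn_ge0 ?invr_ge0 ?sqrtr_ge0//.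
by rewrite Gam0 Gam_le1// invr_ge0.
Qed.

Lemma measurable_hk n v : measurable_fun setT (@hk n v).
Proof. by apply: measurable_funM => //; exact: measurable_Gam. Qed.

Lemma hk_prod n v (y : 'rV[R]_n) :
  hk v y = \prod_(j < n) ((Num.sqrt (2 * pi * v))^-1 * gam v^-1 (y 0 j)).
Proof. by rewrite /hk Gam_prod big_split/= prodr_const card_ord. Qed.

Lemma integral_hk_cos n (s : R) (a : 'rV[R]_n) : 0 < s ->
  (\int[@leb R n]_t ((1 + cos (dotp a t)) * Gam s t)%:E =
  ((2 * pi) ^+ n * (hk s (0 : 'rV[R]_n) + hk s a))%:E)%E.
Proof.
move=> s0.
transitivity (\int[@leb R n]_t ((1 + 1 * cos (0 + dotp a t)) * Gam s t)%:E)%E.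
  by apply: eq_integral => t _; rewrite mul1r add0r.
rewrite integral_Gam_cos//; last by rewrite normr1.
have pi20 : 0 < 2 * pi :> R by rewrite mulr_gt0// pi_gt0.
have -> : Num.sqrt (2 * pi / s) = 2 * pi * (Num.sqrt (2 * pi * s))^-1.
  rewrite -[LHS]mulr1 -[X in _ * X](@divff _ (Num.sqrt (2 * pi * s))); last first.
    by rewrite sqrtr_eq0 -ltNge mulr_gt0.
  rewrite mulrA -sqrtrM ?divr_ge0 ?ltW// (_ : 2 * pi / s * (2 * pi * s) = (2 * pi) ^+ 2); last first.
    by field; rewrite gt_eqF.
  by rewrite sqrtr_sqr gtr0_norm.
by congr (_%:E); rewrite /hk Gam0 cos0 exprMn; ring.
Qed.

Lemma integral_Gam n (s : R) : 0 < s ->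
  (\int[@leb R n]_t (Gam s t)%:E = ((2 * pi) ^+ n * hk s (0 : 'rV[R]_n))%:E)%E.
Proof.
move=> s0; have := integral_hk_cos (0 : 'rV[R]_n) s0.
under eq_integral => t _.
  rewrite dotp0l cos0 EFinM; over.
rewrite /= ge0_integralZl//; last 2 first.
- by apply/measurable_EFinP; exact: measurable_Gam.
- by move=> t _; rewrite lee_fin Gam_ge0.
move=> h; have E2 : (1 + 1 : R) != 0 by rewrite -(natrD R 1 1) pnatr_eq0.
have half (I : \bar R) : I = ((1 + 1)^-1%:E * ((1 + 1)%:E * I))%E.
  by rewrite muleA -EFinM mulVf// mul1e.
rewrite [LHS]half h -EFinM; congr (_%:E); by field.
Qed.

(** Completing the square: the product of the two Gaussians is a Gaussian in x of precision [s]
    about the weighted mean [m], times the constant [c], which carries the dependence on y - z. *)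
Lemma integral_gam_conv (v w y z : R) : 0 < v -> 0 < w ->
  (\int[mu]_x ((Num.sqrt (2 * pi * v))^-1 * gam v^-1 (x - y) *
    ((Num.sqrt (2 * pi * w))^-1 * gam w^-1 (x - z)))%:E =
  ((Num.sqrt (2 * pi * (v + w)))^-1 * gam (v + w)^-1 (y - z))%:E)%E.
Proof.
move=> v0 w0.
have vw0 : 0 < v + w by rewrite addr_gt0.
pose s := v^-1 + w^-1; have s0 : 0 < s by rewrite addr_gt0// invr_gt0.
pose m := (y / v + z / w) / s.
pose c := (Num.sqrt (2 * pi * v))^-1 * (Num.sqrt (2 * pi * w))^-1 * gam (v + w)^-1 (y - z).
transitivity (\int[mu]_x (c%:E * (gam s (x - m))%:E))%E.
  apply: eq_integral => x _; rewrite -EFinM; congr (_%:E).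
  rewrite /c mulrACA -!mulrA; congr (_ * (_ * _)).
  rewrite /gam -!expRD; congr expR; rewrite /m /s.
  by field; rewrite !gt_eqF//= addr_gt0.
rewrite ge0_integralZl//; last 3 first.
- apply/measurable_EFinP; apply: measurableT_comp; first exact: measurable_gam.
  exact: measurable_funB.
- by move=> x _; rewrite lee_fin gam_ge0.
- by rewrite lee_fin /c mulr_ge0 ?gam_ge0// mulr_ge0// invr_ge0 sqrtr_ge0.
rewrite integral_gam_shift// -EFinM; congr (_%:E).
rewrite /c mulrAC; congr (_ * _).
have p2 : 0 < 2 * pi :> R by rewrite mulr_gt0// pi_gt0.
have sV (x : R) : 0 < x -> (Num.sqrt x)^-1 = Num.sqrt x^-1.
  by move=> x0; rewrite sqrtrV// ltW.
have [pv pw] : 0 < 2 * pi * v /\ 0 < 2 * pi * w by split; rewrite mulr_gt0.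
have pvw : 0 < 2 * pi * (v + w) by rewrite mulr_gt0.
rewrite !sV// -sqrtrM ?invr_ge0 ?(ltW pv)// -sqrtrM; last first.
  by rewrite mulr_ge0 ?invr_ge0 ?(ltW pv) ?(ltW pw).
congr Num.sqrt; rewrite /s.
have := @pi_gt0 R; move: (@pi R) => p p0; field.
by rewrite !gt_eqF.
Qed.

Lemma integral_hk_conv n (v w : R) (y z : 'rV[R]_n) : 0 < v -> 0 < w ->
  (\int[@leb R n]_x (hk v (x - y) * hk w (x - z))%:E = (hk (v + w) (y - z))%:E)%E.
Proof.
move=> v0 w0.
pose g (i : 'I_n) (x : R) := (Num.sqrt (2 * pi * v))^-1 * gam v^-1 (x - y 0 i) *
    ((Num.sqrt (2 * pi * w))^-1 * gam w^-1 (x - z 0 i)).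
pose I (i : 'I_n) := (Num.sqrt (2 * pi * (v + w)))^-1 * gam (v + w)^-1 (y 0 i - z 0 i).
transitivity (\int[@leb R n]_x (\prod_(i < n) g i (x 0 i))%:E)%E.
  apply: eq_integral => x _; congr (_%:E); rewrite !hk_prod -big_split/=.
  by apply: eq_bigr => i _; rewrite !mxE.
have mg (u c : R) : measurable_fun setT (fun x : R => gam u (x - c)).
  apply: measurableT_comp; first exact: measurable_gam.
  exact: measurable_funB.
rewrite (@integral_leb_prod R n g I).
- by congr (_%:E); rewrite hk_prod; apply: eq_bigr => i _; rewrite !mxE.
- by move=> i; apply: measurable_funM; apply: measurable_funM => //; exact: mg.
- by move=> i x; rewrite !mulr_ge0 ?gam_ge0 ?invr_ge0 ?sqrtr_ge0.
- by move=> i; exact: integral_gam_conv.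
Qed.

Lemma integral_hk n (v : R) (y : 'rV[R]_n) : 0 < v ->
  (\int[@leb R n]_x (hk v (x - y))%:E = 1)%E.
Proof.
move=> v0.
pose g (i : 'I_n) (x : R) := (Num.sqrt (2 * pi * v))^-1 * gam v^-1 (x - y 0 i).
have p0 : 0 < 2 * pi * v by rewrite !mulr_gt0// pi_gt0.
have mg (u c : R) : measurable_fun setT (fun x : R => gam u (x - c)).
  apply: measurableT_comp; first exact: measurable_gam.
  exact: measurable_funB.
transitivity (\int[@leb R n]_x (\prod_(i < n) g i (x 0 i))%:E)%E.
  apply: eq_integral => x _; congr (_%:E); rewrite hk_prod.
  by apply: eq_bigr => i _; rewrite !mxE.
rewrite (@integral_leb_prod R n g (fun=> 1)) ?big1//.
- by move=> i; apply: measurable_funM => //; exact: mg.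
- by move=> i x; rewrite !mulr_ge0 ?gam_ge0 ?invr_ge0 ?sqrtr_ge0.
- move=> i; rewrite /g; under eq_integral do rewrite EFinM.
  rewrite ge0_integralZl//; last 2 first.
  + by apply/measurable_EFinP; exact: mg.
  + by move=> x _; rewrite lee_fin gam_ge0.
  rewrite integral_gam_shift ?invr_gt0// invrK -EFinM mulVf// sqrtr_eq0 -ltNge//.
Qed.

End heat.

(** * Algebra of the inner product; the standard normal density as a heat kernel *)

Section dotp.
Context {R : realType} {n : nat}.
Implicit Types x y t : 'rV[R]_n.

Lemma dotpDr t x y : dotp t (x + y) = dotp t x + dotp t y.
Proof. by rewrite -big_split; apply: eq_bigr => j _; rewrite mxE mulrDr. Qed.

Lemma dotpZr (a : R) t x : dotp t (a *: x) = a * dotp t x.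
Proof. by rewrite mulr_sumr; apply: eq_bigr => j _; rewrite mxE mulrCA. Qed.

Lemma dotpNr t x : dotp t (- x) = - dotp t x.
Proof. by rewrite -scaleN1r dotpZr mulN1r. Qed.

Lemma dotpBr t x y : dotp t (x - y) = dotp t x - dotp t y.
Proof. by rewrite dotpDr dotpNr. Qed.

Lemma dotpZl (a : R) t x : dotp (a *: t) x = a * dotp t x.
Proof. by rewrite dotpC dotpZr dotpC. Qed.

Lemma dotpDl t x y : dotp (x + y) t = dotp x t + dotp y t.
Proof. by rewrite dotpC dotpDr !(dotpC t). Qed.

Lemma GamZ s (a : R) t : Gam s (a *: t) = Gam (a ^+ 2 * s) t.
Proof. by rewrite /Gam dotpZl dotpZr; congr expR; ring. Qed.

Lemma GamD s s' t : Gam (s + s') t = Gam s t * Gam s' t.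
Proof. by rewrite /Gam -expRD; congr expR; ring. Qed.

Lemma enormE t : enorm t ^+ 2 = dotp t t.
Proof. by rewrite sqr_sqrtr ?dotp_ge0. Qed.

Lemma std_normal_densityE x : std_normal_density x = hk 1 x.
Proof.
rewrite /std_normal_density /hk /Gam enormE invr1 mul1r mulr1; congr (_ * _).
have p2 : 0 < 2 * pi :> R by rewrite mulr_gt0// pi_gt0.
rewrite exprVn -powR_mulrn ?sqrtr_ge0// -powR12_sqrt ?ltW// -powRrM -powRN.
by congr powR; rewrite mulrC.
Qed.

End dotp.

(** * Gaussian smoothing of a law and Parseval's identity for smoothed laws *)

Section smoothing.
Context d (T : measurableType d) {R : realType} (P : probability T R).

Lemma integrable_bounded (f : T -> R) (c : R) : measurable_fun setT f ->
  (forall x, `|f x| <= c) -> P.-integrable setT (EFin \o f).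
Proof.
move=> mf fc.
have ic : P.-integrable setT (EFin \o cst c) by exact: finite_measure_integrable_cst.
apply: (le_integrable _ _ _ ic) => //; first exact/measurable_EFinP.
by move=> x _ /=; rewrite lee_fin (le_trans (fc x)) ?ler_norm.
Qed.

Lemma EFin_Rintegral d' (T' : measurableType d') (m : {measure set T' -> \bar R}) (f : T' -> R) :
  m.-integrable setT (EFin \o f) ->
  (\int[m]_x (f x)%:E)%E = (\int[m]_x f x)%:E.
Proof. by move=> h; rewrite /Rintegral fineK//; exact: integrable_fin_num. Qed.

Lemma integral_trig (U : T -> R) (k0 k1 k2 : R) : measurable_fun setT U ->
  (\int[P]_w (k0 + k1 * cos (U w) + k2 * sin (U w))%:E =
  (k0 + k1 * (\int[P]_w cos (U w))%R + k2 * (\int[P]_w sin (U w))%R)%:E)%E.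
Proof.
move=> mU.
have ic : P.-integrable setT (EFin \o (fun w => cos (U w))).
  apply: (@integrable_bounded _ 1) => [|w]; last by rewrite ler_norml cos_geN1 cos_le1.
  by apply: measurableT_comp => //; exact: measurable_cos.
have isn : P.-integrable setT (EFin \o (fun w => sin (U w))).
  apply: (@integrable_bounded _ 1) => [|w]; last by rewrite ler_norml sin_geN1 sin_le1.
  by apply: measurableT_comp => //; exact: measurable_sin.
have ik : P.-integrable setT (EFin \o (fun=> k0)) by exact: finite_measure_integrable_cst.
have i1 : P.-integrable setT (EFin \o (fun w => k1 * cos (U w))) by exact: (integrableZl _ k1 ic).
have i2 : P.-integrable setT (EFin \o (fun w => k2 * sin (U w))) by exact: (integrableZl _ k2 isn).
have i3 : P.-integrable setT (EFin \o (fun w => k0 + k1 * cos (U w))) by exact: (integrableD _ ik i1).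
rewrite EFin_Rintegral; last exact: (integrableD _ i3 i2).
rewrite !RintegralD// !RintegralZl// /Rintegral integral_cst//.
by rewrite [X in (_ * X)%E]probability_setT mule1.
Qed.

Variable n : nat.
Implicit Types Y Z : T -> 'rV[R]_n.

(** The density of [Y] plus an independent centred normal vector of covariance [v] times the
    identity. For v > 0 it exists whatever the law of [Y]. *)
Definition sm (v : R) Y (x : 'rV[R]_n) := \int[P]_w hk v (x - Y w).

(** [Ecos] and [Esin] are the real and imaginary parts of the characteristic function, kept apart so
    that all integrals remain real. *)
Definition Ecos Y (t : 'rV[R]_n) := \int[P]_w cos (dotp t (Y w)).
Definition Esin Y (t : 'rV[R]_n) := \int[P]_w sin (dotp t (Y w)).

Lemma measurable_hkB (v : R) Y : measurable_fun setT Y ->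
  measurable_fun setT (fun z : 'rV[R]_n * T => hk v (z.1 - Y z.2)).
Proof.
move=> mY; apply: measurableT_comp; first exact: measurable_hk.
by apply: measurable_rVB => //; apply: measurableT_comp.
Qed.

Lemma hk_norm (v : R) (x : 'rV[R]_n) : 0 <= v -> `|hk v x| <= hk v (0 : 'rV[R]_n).
Proof. by move=> v0; rewrite ger0_norm ?hk_ge0// hk_le. Qed.

Lemma integrable_hk (v : R) Y x : 0 <= v -> measurable_fun setT Y ->
  P.-integrable setT (EFin \o (fun w => hk v (x - Y w))).
Proof.
move=> v0 mY; apply: (@integrable_bounded _ (hk v (0 : 'rV[R]_n))) => [|w]; last exact: hk_norm.
apply: measurableT_comp; first exact: measurable_hk.
exact: measurable_rVB.
Qed.

Lemma smE (v : R) Y x : 0 <= v -> measurable_fun setT Y ->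
  (sm v Y x)%:E = (\int[P]_w (hk v (x - Y w))%:E)%E.
Proof. by move=> v0 mY; rewrite EFin_Rintegral//; exact: integrable_hk. Qed.

Lemma sm_ge0 (v : R) Y x : 0 <= sm v Y x.
Proof. by apply: Rintegral_ge0 => w _; exact: hk_ge0. Qed.

Lemma measurable_sm (v : R) Y : 0 <= v -> measurable_fun setT Y ->
  measurable_fun setT (sm v Y).
Proof.
move=> v0 mY; apply/measurable_EFinP.
rewrite (_ : _ \o _ = fun x => \int[P]_w (hk v (x - Y w))%:E)%E; last first.
  by apply/funext => x; rewrite /= smE.
apply: (measurable_fun_fubini_tonelli_F (fun z : 'rV[R]_n * T => (hk v (z.1 - Y z.2))%:E)).
- by apply/measurable_EFinP; exact: measurable_hkB.
- by move=> x; rewrite lee_fin hk_ge0.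
Qed.

(** Measurability of a partial integral comes from Tonelli, which needs a nonnegative integrand:
    hence the 1 that is added and subtracted. *)
Lemma measurable_trigE (h : R -> R) Y : measurable_fun setT h ->
  (forall x, `|h x| <= 1) -> measurable_fun setT Y ->
  measurable_fun setT (fun t : 'rV[R]_n => \int[P]_w h (dotp t (Y w))).
Proof.
move=> mh h1 mY.
have mhY t : measurable_fun setT (fun w => h (dotp t (Y w))).
  by apply: measurableT_comp => //; exact: measurable_dotp.
have ih t : P.-integrable setT (EFin \o (fun w => h (dotp t (Y w)))).
  by apply: (@integrable_bounded _ 1).
have i1 : P.-integrable setT (EFin \o (fun=> 1)) by exact: finite_measure_integrable_cst.
rewrite (_ : (fun t => _) = (fun t => \int[P]_w (1 + h (dotp t (Y w))) - \int[P]_w 1)); last first.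
  by apply/funext => t; rewrite RintegralD// addrC addKr.
apply: measurable_funB => //; apply/measurable_EFinP.
rewrite (_ : _ \o _ = fun t => \int[P]_w (1 + h (dotp t (Y w)))%:E)%E; last first.
  by apply/funext => t; rewrite /= EFin_Rintegral//; exact: (integrableD _ i1 (ih t)).
apply: (measurable_fun_fubini_tonelli_F (fun z : 'rV[R]_n * T => (1 + h (dotp z.1 (Y z.2)))%:E)).
- apply/measurable_EFinP; apply: measurable_funD => //; apply: measurableT_comp => //.
  by apply: measurable_dotp => //; apply: measurableT_comp.
- by move=> z; rewrite lee_fin -lerBlDl sub0r; have := h1 (dotp z.1 (Y z.2)); rewrite ler_norml => /andP[].
Qed.

Lemma measurable_Ecos Y : measurable_fun setT Y -> measurable_fun setT (Ecos Y).
Proof.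
move=> mY; apply: measurable_trigE => //; first exact: measurable_cos.
by move=> x; rewrite ler_norml cos_geN1 cos_le1.
Qed.

Lemma measurable_Esin Y : measurable_fun setT Y -> measurable_fun setT (Esin Y).
Proof.
move=> mY; apply: measurable_trigE => //; first exact: measurable_sin.
by move=> x; rewrite ler_norml sin_geN1 sin_le1.
Qed.

Lemma integral_prob_cst (c : R) : (\int[P]_w c%:E = c%:E)%E.
Proof. by rewrite integral_cst// [X in (_ * X)%E]probability_setT mule1. Qed.

Let PP : probability (T * T)%type R := (P \x P)%E.

(** Both sides equal (2 pi)^n times the mean over [P \x P] of hk (v+w) 0 + hk (v+w) (Y - Z'), where
    Z' is an independent copy of Z on the second factor. On the left this is the semigroup property
    of the heat kernel; on the right it is the Fourier transform of the Gaussian together with the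
    expansion of cos(<t,Y> - <t,Z'>). The added constant makes every integrand nonnegative, so
    Tonelli suffices. *)
Lemma parseval (v w : R) Y Z : 0 < v -> 0 < w ->
  measurable_fun setT Y -> measurable_fun setT Z ->
  (((2 * pi) ^+ n)%:E * (\int[@leb R n]_x (sm v Y x * sm w Z x)%:E + (hk (v + w) (0 : 'rV[R]_n))%:E) =
  \int[@leb R n]_t ((1 + (Ecos Y t * Ecos Z t + Esin Y t * Esin Z t)) * Gam (v + w) t)%:E)%E.
Proof.
move=> v0 w0 mY mZ.
have vw0 : 0 < v + w by rewrite addr_gt0.
have mY1 : measurable_fun setT (Y \o fst : T * T -> _) by exact: measurableT_comp.
have mZ2 : measurable_fun setT (Z \o snd : T * T -> _) by exact: measurableT_comp.
have E1 : (\int[@leb R n]_x (sm v Y x * sm w Z x)%:E =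
    \int[(P \x P)%E]_z (hk (v + w) (Y z.1 - Z z.2))%:E)%E.
  transitivity (\int[@leb R n]_x \int[(P \x P)%E]_z (hk v (x - Y z.1) * hk w (x - Z z.2))%:E)%E.
    apply: eq_integral => x _; rewrite fubini_tonelli1//; last 2 first.
    - apply/measurable_EFinP; apply: measurable_funM.
        apply: measurableT_comp; first exact: measurable_hk.
        exact: measurable_rVB.
      apply: measurableT_comp; first exact: measurable_hk.
      exact: measurable_rVB.
    - by move=> z; rewrite lee_fin mulr_ge0 ?hk_ge0.
    rewrite /fubini_F/=.
    transitivity (\int[P]_w1 ((hk v (x - Y w1))%:E * (sm w Z x)%:E))%E.
      rewrite ge0_integralZr//.
      - by rewrite -(smE x (ltW v0) mY) EFinM.
      - by have /integrableP[] := integrable_hk x (ltW v0) mY.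
      - by move=> z _; rewrite lee_fin hk_ge0.
      - by rewrite lee_fin sm_ge0.
    apply: eq_integral => w1 _.
    transitivity (\int[P]_w2 ((hk v (x - Y w1))%:E * (hk w (x - Z w2))%:E))%E.
      rewrite ge0_integralZl//.
      - by rewrite -(smE x (ltW w0) mZ).
      - by have /integrableP[] := integrable_hk x (ltW w0) mZ.
      - by move=> z _; rewrite lee_fin hk_ge0.
      - by rewrite lee_fin hk_ge0.
    by apply: eq_integral => w2 _; rewrite EFinM.
  pose f (u : 'rV[R]_n * (T * T)) := (hk v (u.1 - Y u.2.1) * hk w (u.1 - Z u.2.2))%:E.
  have mf : measurable_fun setT f.
    apply/measurable_EFinP; apply: measurable_funM.
      apply: measurableT_comp; first exact: measurable_hk.
      apply: measurable_rVB => //.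
      by apply: (measurableT_comp mY1).
    apply: measurableT_comp; first exact: measurable_hk.
    apply: measurable_rVB => //.
    by apply: (measurableT_comp mZ2).
  have f0 u : (0 <= f u)%E by rewrite lee_fin mulr_ge0 ?hk_ge0.
  have F1 := fubini_tonelli (m1 := @leb R n) (m2 := PP) f mf f0.
  apply: (etrans F1).
  by apply: eq_integral => z _; rewrite /f /= integral_hk_conv.
have E2 t : ((1 + (Ecos Y t * Ecos Z t + Esin Y t * Esin Z t))%:E =
   \int[(P \x P)%E]_z (1 + cos (dotp (Y z.1 - Z z.2) t))%:E)%E.
  rewrite fubini_tonelli1//; last first.
    apply/measurable_EFinP; apply: measurable_funD => //.
    apply: measurableT_comp; first exact: measurable_cos.
    by apply: measurable_dotp => //; exact: measurable_rVB.
  rewrite /fubini_F/=.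
  transitivity (\int[P]_x (1 + Ecos Z t * cos (dotp t (Y x)) + Esin Z t * sin (dotp t (Y x)))%:E)%E.
    by rewrite integral_trig ?addrA -/(Ecos Y t) -/(Esin Y t) ?[Ecos Z t * _]mulrC ?[Esin Z t * _]mulrC//; exact: measurable_dotp.
  apply: eq_integral => x _.
  transitivity (\int[P]_y (1 + cos (dotp t (Y x)) * cos (dotp t (Z y)) + sin (dotp t (Y x)) * sin (dotp t (Z y)))%:E)%E.
    by rewrite integral_trig; [rewrite -/(Ecos Z t) -/(Esin Z t) ![_ * cos _]mulrC ![_ * sin _]mulrC|exact: measurable_dotp].
  by apply: eq_integral => y _; rewrite /= (dotpC (_ - _)) dotpBr cosB addrA.
transitivity (\int[@leb R n]_t \int[(P \x P)%E]_z ((1 + cos (dotp (Y z.1 - Z z.2) t)) * Gam (v + w) t)%:E)%E; last first.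
  apply: eq_integral => t _; rewrite EFinM E2.
  transitivity (\int[(P \x P)%E]_z ((1 + cos (dotp (Y z.1 - Z z.2) t))%:E * (Gam (v + w) t)%:E))%E.
    by apply: eq_integral => z _; rewrite EFinM.
  rewrite ge0_integralZr//.
  - apply/measurable_EFinP; apply: measurable_funD => //.
    apply: measurableT_comp; first exact: measurable_cos.
    by apply: measurable_dotp => //; exact: measurable_rVB.
  - by rewrite lee_fin Gam_ge0.
pose f (u : 'rV[R]_n * (T * T)) := ((1 + cos (dotp (Y u.2.1 - Z u.2.2) u.1)) * Gam (v + w) u.1)%:E.
have mf : measurable_fun setT f.
  apply/measurable_EFinP; apply: measurable_funM.
    apply: measurable_funD => //.
    apply: measurableT_comp; first exact: measurable_cos.
    apply: measurable_dotp => //.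
    apply: measurable_rVB.
    + by apply: (measurableT_comp mY1).
    + by apply: (measurableT_comp mZ2).
  by apply: measurableT_comp => //; exact: measurable_Gam.
have f0 u : (0 <= f u)%E.
  by rewrite lee_fin mulr_ge0 ?Gam_ge0// -lerBlDl sub0r cos_geN1.
have F1 := fubini_tonelli (m1 := @leb R n) (m2 := PP) f mf f0.
apply/esym/(etrans F1).
transitivity (\int[(P \x P)%E]_z (((2 * pi) ^+ n)%:E * ((hk (v + w) (0 : 'rV[R]_n))%:E + (hk (v + w) (Y z.1 - Z z.2))%:E)))%E.
  by apply: eq_integral => z _; rewrite /f /= integral_hk_cos// -EFinD -EFinM.
have mh : measurable_fun setT (fun z : T * T => (hk (v + w) (Y z.1 - Z z.2))%:E).
  apply/measurable_EFinP; apply: measurableT_comp; first exact: measurable_hk.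
  exact: measurable_rVB.
rewrite ge0_integralZl//; last 3 first.
- exact: emeasurable_funD.
- by move=> z _; rewrite -EFinD lee_fin addr_ge0 ?hk_ge0.
- by rewrite lee_fin exprn_ge0// mulr_ge0// pi_ge0.
rewrite ge0_integralD//; try by move=> z _; rewrite lee_fin hk_ge0.
have EQ : (\int[PP]_z (hk (v + w) (0 : 'rV[R]_n))%:E = (hk (v + w) (0 : 'rV[R]_n))%:E)%E.
  by rewrite integral_cst// [X in (_ * X)%E](probability_setT PP) mule1.
congr (_ * _)%E; rewrite [RHS]addeC; congr (_ + _)%E; first exact: EQ.
exact/esym/E1.
Qed.

End smoothing.

(** * Almost everywhere convergence, with a majorant, of rapidly Cauchy sequences in L^2 *)

Section fast_cauchy.
Context {R : realType}.

Lemma cvg_fast_cauchy (u : nat -> R) (M : R) :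
  (forall k, `|u k.+1 - u k| <= M * 2^-1 ^+ k) ->
  cvgn u /\ forall k, `|u k - u 0%N| <= M * 2.
Proof.
move=> uM.
have M0 : 0 <= M by have := uM 0%N; rewrite expr0 mulr1; exact: le_trans.
have h2 : `|2^-1 : R| < 1 by rewrite ger0_norm ?invr_ge0// invf_lt1// ltr1n.
have gE : cvgn (series (geometric M 2^-1)) by exact: is_cvg_geometric_series.
have uE k : u k = u 0%N + series (fun i => u i.+1 - u i) k.
  by rewrite seriesEnat/= telescope_sumr// addrC subrK.
split.
  rewrite (_ : u = (fun k => u 0%N + series (fun i => u i.+1 - u i) k)); last exact/funext.
  apply: is_cvgD; first exact: is_cvg_cst.
  apply: (@normed_cvg _ R^o).
  by apply: series_le_cvg gE => k //=; rewrite mulr_ge0.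
move=> k; rewrite [u k]uE addrAC subrr add0r seriesEnat/=.
apply: (le_trans (ler_norm_sum _ _ _)).
apply: (@le_trans _ _ (\sum_(0 <= i < k) M * 2^-1 ^+ i)); first by apply: ler_sum => i _.
have -> : M * 2 = M * (1 - 2^-1)^-1 by congr (_ * _); field.
rewrite -[leRHS](cvg_lim _ (@cvg_geometric_series R M 2^-1 h2))//.
rewrite -[leLHS]/(series (geometric M 2^-1) k).
apply: nondecreasing_cvgn_le => //.
by apply: nondecreasing_series => i _ /=; rewrite mulr_ge0// exprn_ge0.
Qed.

Context d (T : measurableType d) (mu : {measure set T -> \bar R}).

Lemma ge0_integral_EFinZl (k : R) (f : T -> R) : 0 <= k -> measurable_fun setT f ->
  (forall x, 0 <= f x) -> (\int[mu]_x (k * f x)%:E = k%:E * \int[mu]_x (f x)%:E)%E.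
Proof.
move=> k0 mf f0; rewrite -ge0_integralZl//.
  exact/measurable_EFinP.
by move=> x _; rewrite lee_fin.
Qed.

(** Let S be the sum of 4^k (u_(k+1) - u_k)^2. Its integral is at most the sum of C 4^-k, so S is
    finite off a null set. There each increment is at most 2^-k sqrt S, and sqrt S <= 1 + S; the
    latter form is integrable over sets of finite measure, as a dominated convergence will
    require. *)
Lemma fast_L2_cauchy (u : nat -> T -> R) (C : R) :
  (forall k, measurable_fun setT (u k)) -> 0 <= C ->
  (forall k, \int[mu]_x ((u k.+1 x - u k x) ^+ 2)%:E <= (C * 16^-1 ^+ k)%:E)%E ->
  exists (A : set T) (S : T -> R), [/\ measurable A, mu (~` A) = 0%E,
    mu.-integrable setT (EFin \o S), forall x, 0 <= S x &
    forall x k, A x -> `|u k.+1 x - u k x| <= (1 + S x) * 2^-1 ^+ k].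
Proof.
move=> mu_ C0 uC.
pose D k x := (4 ^+ k * (u k.+1 x - u k x) ^+ 2)%:E : \bar R.
have D0 k x : (0 <= D k x)%E by rewrite lee_fin mulr_ge0 ?sqr_ge0// exprn_ge0.
have mD k : measurable_fun setT (D k).
  apply/measurable_EFinP; apply: measurable_funM => //; apply: measurable_funX.
  exact: measurable_funB.
pose S x := (\sum_(k <oo) D k x)%E.
have S0 x : (0 <= S x)%E by exact: nneseries_ge0.
have mS : measurable_fun setT S by exact: ge0_emeasurable_sum.
have iS : mu.-integrable setT S.
  apply/integrableP; split => //.
  under eq_integral do rewrite gee0_abs//.
  rewrite integral_nneseries//.
  apply: (@le_lt_trans _ _ (\sum_(k <oo) (C * 4^-1 ^+ k)%:E)%E).
    apply: lee_nneseries => [k _ _|k _]; first by apply: integral_ge0 => x _; exact: D0.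
    rewrite ge0_integral_EFinZl ?exprn_ge0//; last 2 first.
    - by apply: measurable_funX; exact: measurable_funB.
    - by move=> x; rewrite sqr_ge0.
    apply: (le_trans (lee_wpmul2l _ (uC k))); first by rewrite lee_fin exprn_ge0.
    rewrite -EFinM lee_fin mulrCA -exprMn.
    by rewrite (_ : 4 * 16^-1 = 4^-1) //; field.
  have cg : cvgn (series (geometric C 4^-1)).
    by apply: is_cvg_geometric_series; rewrite ger0_norm ?invr_ge0// invf_lt1// ltr1n.
  rewrite (_ : (\sum_(k <oo) _)%E = (limn (series (geometric C 4^-1)))%:E) ?ltry//.
  rewrite -EFin_lim//; congr (limn _); apply/funext => k.
  by rewrite /= seriesEnat/= sumEFin.
have [N [mN N0 AN]] := integrable_ae measurableT iS.
exists (~` N), (fine \o S); split => //.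
- exact: measurableC.
- by rewrite setCK.
- apply: le_integrable iS => //.
    apply/measurable_EFinP; exact: measurableT_comp.
  by move=> x _ /=; have := S0 x; case: (S x) => [r| |]// _; rewrite /= ?normr0 ?leey.
- by move=> x /=; rewrite fine_ge0.
move=> x k /= NA.
have Sfin : S x \is a fin_num by apply: contrapT => h; apply: NA; apply: AN => /(_ I).
have DS : 4 ^+ k * (u k.+1 x - u k x) ^+ 2 <= fine (S x).
  rewrite -lee_fin fineK// -/(D k x).
  rewrite (le_trans _ (@nneseries_lim_ge _ (D ^~ x) xpredT 0 k.+1 _))//.
  by rewrite big_nat_recr//= leeDr// sume_ge0.
have F0 : 0 <= fine (S x) by rewrite fine_ge0.
have B0 : 0 <= (1 + fine (S x)) * 2^-1 ^+ k.
  by rewrite mulr_ge0 ?addr_ge0// exprn_ge0// invr_ge0.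
rewrite -(@ler_pXn2r _ 2) ?nnegrE//.
have e4 : 4 ^+ k * (2^-1 ^+ k) ^+ 2 = 1 :> R.
  rewrite -exprM mulnC exprM -exprMn (_ : 4 * 2^-1 ^+ 2 = 1 :> R) ?expr1n//.
  by field.
rewrite real_normK ?num_real// -(@ler_pM2l _ (4 ^+ k)) ?exprn_gt0//.
rewrite exprMn [leRHS]mulrCA e4 mulr1.
by apply: (le_trans DS); nra.
Qed.

End fast_cauchy.

(** * Parseval's identity with the auxiliary constant removed *)

Section parseval_real.
Context d (T : measurableType d) {R : realType} (P : probability T R) (n : nat).
Implicit Types Y Z : T -> 'rV[R]_n.
Local Notation Ecos := (Ecos P).
Local Notation Esin := (Esin P).
Local Notation sm := (sm P).
Local Notation leb := (@leb R n).

Lemma Rintegral_prob_norm_le (f : T -> R) (c : R) : measurable_fun setT f ->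
  (forall x, `|f x| <= c) -> `|\int[P]_w f w| <= c.
Proof.
move=> mf fc.
have i1 := integrable_bounded P mf fc.
apply: (le_trans (le_normr_Rintegral _ i1)) => //.
rewrite (_ : c = \int[P]_w c); last by rewrite /Rintegral integral_prob_cst.
apply: le_Rintegral => //; first exact: integrable_norm i1.
exact: finite_measure_integrable_cst.
Qed.

Lemma Ecos_norm_le1 Y t : measurable_fun setT Y -> `|Ecos Y t| <= 1.
Proof.
move=> mY; apply: Rintegral_prob_norm_le => [|w]; last by rewrite ler_norml cos_geN1 cos_le1.
by apply: measurableT_comp; [exact: measurable_cos|exact: measurable_dotp].
Qed.

Lemma Esin_norm_le1 Y t : measurable_fun setT Y -> `|Esin Y t| <= 1.
Proof.
move=> mY; apply: Rintegral_prob_norm_le => [|w]; last by rewrite ler_norml sin_geN1 sin_le1.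
by apply: measurableT_comp; [exact: measurable_sin|exact: measurable_dotp].
Qed.

Lemma integrable_Gam (s : R) : 0 < s -> leb.-integrable setT (EFin \o @Gam R n s).
Proof.
move=> s0; apply/integrableP; split.
  by apply/measurable_EFinP; exact: measurable_Gam.
under eq_integral => x _ do rewrite /= ger0_norm ?Gam_ge0//.
by rewrite /= integral_Gam// ltry.
Qed.

(** The real part of the characteristic function of Y times the conjugate of that of Z. For Y = Z it
    is the squared modulus. *)
Definition corr Y Z t := Ecos Y t * Ecos Z t + Esin Y t * Esin Z t.

Lemma measurable_corr Y Z : measurable_fun setT Y -> measurable_fun setT Z ->
  measurable_fun setT (corr Y Z).
Proof.
move=> mY mZ; apply: measurable_funD; apply: measurable_funM.
- exact: measurable_Ecos.
- exact: measurable_Ecos.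
- exact: measurable_Esin.
- exact: measurable_Esin.
Qed.

Lemma integrable_corr_Gam (s : R) Y Z : 0 < s ->
  measurable_fun setT Y -> measurable_fun setT Z ->
  leb.-integrable setT (EFin \o (fun t => corr Y Z t * Gam s t)).
Proof.
move=> s0 mY mZ.
apply: (le_integrable _ _ _ (integrableZl measurableT 2 (integrable_Gam s0))) => //.
  apply/measurable_EFinP; apply: measurable_funM; first exact: measurable_corr.
  exact: measurable_Gam.
move=> t _; rewrite /= lee_fin !normrM ler_wpM2r// (le_trans (ler_normD _ _))// !normrM.
rewrite (ger0_norm (ler0n _ 2)) (_ : 2 = 1 * 1 + 1 * 1 :> R); last by rewrite mulr1.
by rewrite lerD// ler_pM ?Ecos_norm_le1 ?Esin_norm_le1.
Qed.

(** The contribution of the added 1 to [parseval] is the finite mass of a Gaussian, the same on both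
    sides, and cancels. *)
Lemma parsevalR (v w : R) Y Z : 0 < v -> 0 < w ->
  measurable_fun setT Y -> measurable_fun setT Z ->
  leb.-integrable setT (EFin \o (fun x => sm v Y x * sm w Z x)) /\
  (2 * pi) ^+ n * (\int[leb]_x (sm v Y x * sm w Z x)) =
  \int[leb]_t (corr Y Z t * Gam (v + w) t).
Proof.
move=> v0 w0 mY mZ.
have vw0 : 0 < v + w by rewrite addr_gt0.
have K0 : 0 < (2 * pi) ^+ n :> R by rewrite exprn_gt0// mulr_gt0// pi_gt0.
have := parseval P v0 w0 mY mZ.
have i1 := integrable_corr_Gam vw0 mY mZ.
have i2 := integrable_Gam vw0.
have i12 : leb.-integrable setT (EFin \o (fun t => Gam (v + w) t + corr Y Z t * Gam (v + w) t)).
  exact: (integrableD _ i2 i1).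
rewrite [X in _ = X -> _](_ : _ = \int[leb]_t (Gam (v + w) t + corr Y Z t * Gam (v + w) t)%:E)%E; last first.
  by apply: eq_integral => t _; rewrite mulrDl mul1r.
rewrite (EFin_Rintegral i12) RintegralD// {1}/Rintegral integral_Gam//=.
set I := (\int[_]_x (sm v Y x * _)%:E)%E; set h := hk _ _; set J := Rintegral _ _ _ => E.
have I0 : (0 <= I)%E by apply: integral_ge0 => x _; rewrite lee_fin mulr_ge0 ?sm_ge0.
have Ifin : (I < +oo)%E.
  rewrite ltey; apply/eqP => Iy; move: E.
  by rewrite Iy addye// gt0_muley// lte_fin.
split.
  apply/integrableP; split.
    by apply/measurable_EFinP; apply: measurable_funM; apply: measurable_sm => //; exact: ltW.
  by under eq_integral => x _ do rewrite /= ger0_norm ?mulr_ge0 ?sm_ge0//.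
rewrite /Rintegral -/I; move: E I0 Ifin; case: I => [r| |]//= + _ _.
by rewrite -EFinD -EFinM => -[]; rewrite mulrDr addrC => /addrI.
Qed.

(** The squared modulus of phi_Y g - phi_Z h, with phi the characteristic functions. *)
Definition fdiff Y g Z h t :=
  (Ecos Y t * g t - Ecos Z t * h t) ^+ 2 + (Esin Y t * g t - Esin Z t * h t) ^+ 2.

Lemma fdiff_ge0 Y g Z h t : 0 <= fdiff Y g Z h t.
Proof. by rewrite addr_ge0 ?sqr_ge0. Qed.

Lemma measurable_fdiff Y g Z h : measurable_fun setT Y -> measurable_fun setT Z ->
  measurable_fun setT g -> measurable_fun setT h ->
  measurable_fun setT (fdiff Y g Z h).
Proof.
move=> mY mZ mg mh.
have [c1 c2] := (measurable_Ecos P mY, measurable_Ecos P mZ).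
have [s1 s2] := (measurable_Esin P mY, measurable_Esin P mZ).
by apply: measurable_funD; apply: measurable_funX; apply: measurable_funB;
  apply: measurable_funM.
Qed.

(** Expand both squares and apply [parsevalR] to the three products. This is Plancherel for the
    difference of two smoothed laws. *)
Lemma parseval_diff (v w : R) Y Z : 0 < v -> 0 < w ->
  measurable_fun setT Y -> measurable_fun setT Z ->
  (\int[leb]_x ((sm v Y x - sm w Z x) ^+ 2)%:E =
  (((2 * pi) ^+ n)^-1 * \int[leb]_t fdiff Y (Gam v) Z (Gam w) t)%:E)%E.
Proof.
move=> v0 w0 mY mZ.
have K0 : 0 < (2 * pi) ^+ n :> R by rewrite exprn_gt0// mulr_gt0// pi_gt0.
have [i11 e11] := parsevalR v0 v0 mY mY.
have [i12 e12] := parsevalR v0 w0 mY mZ.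
have [i22 e22] := parsevalR w0 w0 mZ mZ.
have j11 := integrable_corr_Gam (addr_gt0 v0 v0) mY mY.
have j12 := integrable_corr_Gam (addr_gt0 v0 w0) mY mZ.
have j22 := integrable_corr_Gam (addr_gt0 w0 w0) mZ mZ.
have expand (f g h : 'rV[R]_n -> R) : leb.-integrable setT (EFin \o f) ->
    leb.-integrable setT (EFin \o g) -> leb.-integrable setT (EFin \o h) ->
    leb.-integrable setT (EFin \o (fun t => f t + - 2 * g t + h t)) /\
    \int[leb]_t (f t + - 2 * g t + h t) =
    \int[leb]_t f t + - 2 * \int[leb]_t g t + \int[leb]_t h t.
  move=> jf jg jh.
  have jg2 : leb.-integrable setT (EFin \o (fun t => - 2 * g t)) by exact: (integrableZl _ (- 2) jg).
  have jfg : leb.-integrable setT (EFin \o (fun t => f t + - 2 * g t)) by exact: (integrableD _ jf jg2).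
  split; first exact: (integrableD _ jfg jh).
  by rewrite RintegralD// RintegralD// RintegralZl.
have [iE E] := expand _ _ _ i11 i12 i22.
have [jE F] := expand _ _ _ j11 j12 j22.
transitivity (\int[leb]_x (sm v Y x * sm v Y x + - 2 * (sm v Y x * sm w Z x) +
    sm w Z x * sm w Z x)%:E)%E.
  apply: eq_integral => x _; congr (_%:E).
  by move: (sm v Y x) (sm w Z x) => a b; ring.
rewrite (EFin_Rintegral iE) E; congr (_%:E).
have -> : \int[leb]_t fdiff Y (Gam v) Z (Gam w) t = \int[leb]_t (corr Y Y t * Gam (v + v) t +
   - 2 * (corr Y Z t * Gam (v + w) t) + corr Z Z t * Gam (w + w) t).
  apply: eq_Rintegral => t _; rewrite /fdiff /corr !GamD.
  by move: (Gam v t) (Gam w t) (Ecos Y t) (Ecos Z t) (Esin Y t) (Esin Z t) => *; ring.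
have alg (K a b c A B C : R) : 0 < K -> K * a = A -> K * b = B -> K * c = C ->
    a + - 2 * b + c = K^-1 * (A + - 2 * B + C).
  by move=> k0 <- <- <-; field; rewrite gt_eqF.
by rewrite F; exact: (alg _ _ _ _ _ _ _ K0 e11 e12 e22).
Qed.

Lemma fdiff_le Y g Z h t :
  fdiff Y g Z h t <= 2 * (corr Y Y t * g t ^+ 2) + 2 * (corr Z Z t * h t ^+ 2).
Proof.
rewrite /fdiff /corr; set a := Ecos Y t; set b := Esin Y t; set c := Ecos Z t; set e := Esin Z t.
move: a b c e (g t) (h t) => a b c e gt ht.
have := sqr_ge0 (a * gt + c * ht); have := sqr_ge0 (b * gt + e * ht); lra.
Qed.

Lemma corr_ge0 Y t : 0 <= corr Y Y t.
Proof. by rewrite /corr -!expr2 addr_ge0 ?sqr_ge0. Qed.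

End parseval_real.

(** * Weak convergence of the smoothed laws as the variance tends to 0 *)

Section weak.
Context d (T : measurableType d) {R : realType} (P : probability T R) (n : nat).
Local Notation leb := (@leb R n).
Implicit Types Y : T -> 'rV[R]_n.

Lemma fatou_cvg d' (T' : measurableType d') (m : {measure set T' -> \bar R})
    (f_ : nat -> T' -> R) (f : T' -> R) (L : \bar R) :
  (forall k, measurable_fun setT (f_ k)) -> (forall k x, 0 <= f_ k x) ->
  (forall x, f_ k x @[k --> \oo] --> f x) ->
  (\int[m]_x (f_ k x)%:E)%E @[k --> \oo] --> L ->
  (\int[m]_x (f x)%:E <= L)%E.
Proof.
move=> mf f0 ff fL.
have mf' k : measurable_fun setT (fun x => (f_ k x)%:E) by exact/measurable_EFinP.
have := fatou m measurableT mf' (fun k x _ => f0 k x).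
rewrite is_cvg_limn_einfE; last by apply/cvg_ex; exists L.
rewrite (cvg_lim _ fL)//; apply: le_trans.
rewrite le_eqVlt; apply/orP; left; apply/eqP; apply: eq_integral => x _.
have fx : (f_ k x)%:E @[k --> \oo] --> (f x)%:E by apply: cvg_EFin; [exact: nearW|exact: ff].
rewrite is_cvg_limn_einfE; last by apply/cvg_ex; exists (f x)%:E.
by rewrite (cvg_lim _ fx).
Qed.

Lemma integral_hk0 (v : R) : 0 < v -> (\int[leb]_y (hk v y)%:E = 1)%E.
Proof.
move=> v0; rewrite -(@integral_hk R n v 0 v0).
by congr (integral _ _ _); apply/funext => y; rewrite subr0.
Qed.

Lemma integrable_hk0 (v : R) : 0 < v -> leb.-integrable setT (EFin \o @hk R n v).
Proof.
move=> v0; apply/integrableP; split.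
  by apply/measurable_EFinP; exact: measurable_hk.
under eq_integral => x _ do rewrite /= ger0_norm ?hk_ge0//.
by rewrite integral_hk0// ltry.
Qed.

Lemma hk_scale (a : R) (y : 'rV[R]_n) : 0 < a -> a ^+ n * hk (a ^+ 2) (a *: y) = hk 1 y.
Proof.
move=> a0; rewrite /hk GamZ mulrV ?unitfE ?expf_neq0 ?gt_eqF// mulrA; congr (_ * _); last first.
  by rewrite invr1.
rewrite -exprMn; congr (_ ^+ _); rewrite mulr1.
rewrite sqrtrM ?mulr_ge0 ?pi_ge0// sqrtr_sqr gtr0_norm// invfM mulrCA mulfV ?mulr1// gt_eqF//.
Qed.

Lemma integral_hk_affine (a : R) (b : 'rV[R]_n) (h : 'rV[R]_n -> R) : 0 < a ->
  measurable_fun setT h -> (forall x, 0 <= h x) ->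
  (\int[leb]_x (h x * hk (a ^+ 2) (x - b))%:E =
   \int[leb]_y (h (a *: y + b) * hk 1 y)%:E)%E.
Proof.
move=> a0 mh h0.
have an0 : 0 < a ^+ n by rewrite exprn_gt0.
have mF : measurable_fun setT (fun x => h x * hk (a ^+ 2) (x - b)).
  apply: measurable_funM => //; apply: measurableT_comp; first exact: measurable_hk.
  by apply: measurable_rVB.
have F0 x : 0 <= h x * hk (a ^+ 2) (x - b) by rewrite mulr_ge0 ?hk_ge0.
have := @ge0_integral_leb_affine R n a b (fun x => (h x * hk (a ^+ 2) (x - b))%:E) a0.
move=> /(_ _ _)/esym E.
transitivity ((a ^+ n)%:E * \int[leb]_y (h (a *: y + b) * hk (a ^+ 2) (a *: y))%:E)%E.
  transitivity ((a ^+ n)%:E * ((a ^- n)%:E * \int[leb]_x (h x * hk (a ^+ 2) (x - b))%:E))%E.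
    by rewrite muleA -EFinM mulfV ?mul1e// gt_eqF.
  rewrite E; last 2 first.
  - exact/measurable_EFinP.
  - by move=> x; rewrite lee_fin.
  congr (_ * integral _ _ _)%E; apply/funext => y; rewrite addrK //.
rewrite -ge0_integral_EFinZl ?ltW//.
- by apply: eq_integral => y _; rewrite mulrCA hk_scale.
- apply: measurable_funM.
    by apply: measurableT_comp => //; exact: measurable_affine.
  apply: measurableT_comp; first exact: measurable_hk.
  by apply: measurable_rVZ => //; exact: measurable_cst.
- by move=> x; rewrite mulr_ge0 ?hk_ge0.
Qed.

(** Tonelli and the substitution x = a y + Y turn the smoothed law into a random Gaussian
    perturbation of [Y]. *)
Lemma integral_smE (a : R) (h : 'rV[R]_n -> R) Y : 0 < a ->
  measurable_fun setT Y -> measurable_fun setT h -> (forall x, 0 <= h x) ->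
  (\int[leb]_x (h x * sm P (a ^+ 2) Y x)%:E =
   \int[P]_w \int[leb]_y (h (a *: y + Y w) * hk 1 y)%:E)%E.
Proof.
move=> a0 mY mh h0.
have a20 : 0 <= a ^+ 2 by rewrite exprn_ge0// ltW.
pose f (z : 'rV[R]_n * T) := (h z.1 * hk (a ^+ 2) (z.1 - Y z.2))%:E.
have mf : measurable_fun setT f.
  apply/measurable_EFinP; apply: measurable_funM; first exact: measurableT_comp.
  exact: measurable_hkB.
have f0 z : (0 <= f z)%E by rewrite lee_fin mulr_ge0 ?hk_ge0.
transitivity (\int[leb]_x \int[P]_w f (x, w))%E.
  apply: eq_integral => x _; rewrite EFinM smE//.
  rewrite -ge0_integralZl//.
  - by have /integrableP[] := integrable_hk P x a20 mY.
  - by move=> w _; rewrite lee_fin hk_ge0.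
  - by rewrite lee_fin.
rewrite (fubini_tonelli (m1 := leb) (m2 := P) f mf f0).
by apply: eq_integral => w _; rewrite /f /= (integral_hk_affine (Y w) a0 mh h0).
Qed.

Lemma integral_sm (v : R) Y : 0 < v -> measurable_fun setT Y ->
  (\int[leb]_x (sm P v Y x)%:E = 1)%E.
Proof.
move=> v0 mY; have s0 : 0 < Num.sqrt v by rewrite sqrtr_gt0.
have -> : v = Num.sqrt v ^+ 2 by rewrite sqr_sqrtr// ltW.
have := @integral_smE (Num.sqrt v) (fun=> 1) Y s0 mY.
under eq_integral do rewrite mul1r.
move=> ->//; under eq_integral do under eq_integral do rewrite mul1r.
transitivity (\int[P]_w (1%:E))%E; last exact: integral_prob_cst.
by apply: eq_integral => w _; rewrite integral_hk0.
Qed.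

(** By [integral_smE] the left side is the mean of h(a_k y + Y) over a standard normal y and over P,
    and domination applies to each of the two integrals in turn. Continuity of h is asked only along
    the sequences s_k y + x that arise. *)
Lemma sm_weak_cvg (a : nat -> R) (h : 'rV[R]_n -> R) Y :
  (forall k, 0 < a k) -> a k @[k --> \oo] --> (0 : R) ->
  measurable_fun setT Y -> measurable_fun setT h -> (forall x, 0 <= h x <= 1) ->
  (forall (s : nat -> R) x y, s k @[k --> \oo] --> (0 : R) ->
     h (s k *: y + x) @[k --> \oo] --> h x) ->
  (\int[leb]_x (h x * sm P (a k ^+ 2) Y x)%:E)%E @[k --> \oo] -->
  (\int[P]_w (h (Y w))%:E)%E.
Proof.
move=> a0 ac mY mh h01 hc.
have h0 x : 0 <= h x by have /andP[] := h01 x.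
have h1 x : h x <= 1 by have /andP[] := h01 x.
have i1 := @integrable_hk0 1 ltr01.
have e1 := @integral_hk0 1 ltr01.
have mJ k w : measurable_fun setT (fun y : 'rV[R]_n => h (a k *: y + Y w) * hk 1 y).
  apply: measurable_funM; last exact: measurable_hk.
  by apply: measurableT_comp => //; exact: measurable_affine.
have bJ k w y : `|h (a k *: y + Y w) * hk 1 y| <= hk 1 y.
  have nn : 0 <= h (a k *: y + Y w) * hk 1 y by rewrite mulr_ge0// hk_ge0.
  by rewrite ger0_norm// ler_piMl// hk_ge0.
pose J k w := \int[leb]_y (h (a k *: y + Y w) * hk 1 y).
have iJ k w : leb.-integrable setT (EFin \o (fun y => h (a k *: y + Y w) * hk 1 y)).
  apply: (le_integrable _ _ _ i1) => //; first exact/measurable_EFinP.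
  by move=> y _; rewrite /= lee_fin [leRHS]ger0_norm ?hk_ge0.
have JE k w : (J k w)%:E = (\int[leb]_y (h (a k *: y + Y w) * hk 1 y)%:E)%E.
  by rewrite EFin_Rintegral.
have lim_J w : J k w @[k --> \oo] --> h (Y w).
  have -> : h (Y w) = \int[leb]_y (h (Y w) * hk 1 y).
    by rewrite RintegralZl// {1}/Rintegral e1 mulr1.
  apply: (Rintegral_dominated_cvg (mu := leb) (g := @hk R n 1)) => //.
  by move=> y; apply: cvgM; [exact: hc|exact: cvg_cst].
have J0 k w : 0 <= J k w by apply: Rintegral_ge0 => y _; rewrite mulr_ge0 ?hk_ge0.
have J1 k w : J k w <= 1.
  rewrite -lee_fin JE -e1; apply: ge0_le_integral => //.
  - by move=> y _; rewrite lee_fin mulr_ge0 ?hk_ge0.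
  - exact/measurable_EFinP.
  - by apply/measurable_EFinP; exact: measurable_hk.
  - by move=> y _; rewrite lee_fin ler_piMl// hk_ge0.
have mJk k : measurable_fun setT (J k).
  apply/measurable_EFinP.
  rewrite (_ : _ \o _ = fun w => \int[leb]_y (h (a k *: y + Y w) * hk 1 y)%:E)%E; last first.
    by apply/funext => w; rewrite /= JE.
  apply: (measurable_fun_fubini_tonelli_F (m2 := leb) (fun z : T * 'rV[R]_n => (h (a k *: z.2 + Y z.1) * hk 1 z.2)%:E)).
  - apply/measurable_EFinP; apply: measurable_funM.
      apply: measurableT_comp => //; apply: measurable_rVD; last exact: measurableT_comp.
      by apply: measurable_rVZ => //; exact: measurable_cst.
    by apply: measurableT_comp; [exact: measurable_hk|exact: measurable_snd].
  - by move=> z; rewrite lee_fin mulr_ge0 ?hk_ge0.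
have ic : P.-integrable setT (EFin \o (fun=> 1)) by exact: finite_measure_integrable_cst.
have bJk k w : `|J k w| <= 1 by rewrite ger0_norm.
have [_] := EFin_dominated_cvg mJk lim_J ic bJk.
apply: cvg_trans; apply: near_eq_cvg; apply: nearW => k.
by rewrite integral_smE//; apply: eq_integral => w _; exact: JE.
Qed.

End weak.

(** * Continuous cut-offs approximating the indicator of a box *)

Section trapezoid.
Context {R : realType} {n : nat}.
Implicit Types (a b x y : 'rV[R]_n).

(** The projection of [s] onto the unit interval. *)
Definition tau (s : R) : R := (`|s| - `|s - 1| + 1) / 2.

Lemma tau_ge1 s : 1 <= s -> tau s = 1.
Proof.
move=> s1; have [s0 s2] : 0 <= s /\ 0 <= s - 1 by split; lra.
by rewrite /tau (ger0_norm s0) (ger0_norm s2); field.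
Qed.

Lemma tau_le0 s : s <= 0 -> tau s = 0.
Proof.
move=> s0; have s1 : s - 1 <= 0 by lra.
by rewrite /tau (ler0_norm s0) (ler0_norm s1); field.
Qed.

Lemma tau01 s : 0 <= tau s <= 1.
Proof.
have [s1|s1] := leP 1 s; first by rewrite tau_ge1// ler01 lexx.
have [s0|s0] := leP s 0; first by rewrite tau_le0// lexx ler01.
by rewrite /tau gtr0_norm// ltr0_norm ?subr_lt0//; lra.
Qed.

Lemma continuous_tau : continuous tau.
Proof.
move=> s; apply: cvgM; last exact: cvg_cst.
apply: cvgD; last exact: cvg_cst.
apply: cvgB; first exact: (@norm_continuous R R^o).
apply: (cvg_comp (fun s => s - 1) (@Num.norm R R)); last exact: (@norm_continuous R R^o).
by apply: cvgB; [exact: cvg_id|exact: cvg_cst].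
Qed.

(** It vanishes outside the open box, so it also confines majorants that are integrable only on
    bounded sets. *)
Definition trap a b (m : nat) x : R :=
  \prod_i (tau (m%:R * (x 0 i - a 0 i)) * tau (m%:R * (b 0 i - x 0 i))).

Lemma trap01 a b m x : 0 <= trap a b m x <= 1.
Proof.
have h i : 0 <= tau (m%:R * (x 0 i - a 0 i)) * tau (m%:R * (b 0 i - x 0 i)) <= 1.
  have /andP[p0 p1] := tau01 (m%:R * (x 0 i - a 0 i)).
  have /andP[q0 q1] := tau01 (m%:R * (b 0 i - x 0 i)).
  by rewrite mulr_ge0//= mulr_ile1.
rewrite prodr_ge0/=; last by move=> i _; have /andP[] := h i.
by rewrite -[leRHS](@big1_eq R 1 *%R _ (index_enum 'I_n) xpredT) ler_prod.
Qed.

Lemma trap_out a b m x : ~ box a b x -> trap a b m x = 0.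
Proof.
move=> /existsNP[i /negP]; rewrite negb_and -!leNgt => h.
rewrite /trap (bigD1 i)//=; case/orP: h => h.
  by rewrite [tau (_ * (x 0 i - _))]tau_le0 ?mul0r// mulr_ge0_le0// subr_le0.
by rewrite [tau (_ * (_ - x 0 i))]tau_le0 ?mulr0 ?mul0r// mulr_ge0_le0// subr_le0.
Qed.

Lemma cvg_prod_seq (I : Type) (s : seq I) (f : nat -> I -> R) (l : I -> R) :
  (forall i, f k i @[k --> \oo] --> l i) ->
  (\prod_(i <- s) f k i) @[k --> \oo] --> \prod_(i <- s) l i.
Proof.
move=> fl; elim: s => [|i s IH].
  by rewrite big_nil; under eq_fun do rewrite big_nil; exact: cvg_cst.
by rewrite big_cons; under eq_fun do rewrite big_cons; exact: cvgM.
Qed.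

Lemma trap_cvg a b m (s : nat -> R) x y : s k @[k --> \oo] --> (0 : R) ->
  trap a b m (s k *: y + x) @[k --> \oo] --> trap a b m x.
Proof.
move=> s0; apply: cvg_prod_seq => i.
have c : (s k *: y + x) 0 i @[k --> \oo] --> x 0 i.
  rewrite (_ : (fun k => _) = (fun k => s k * y 0 i + x 0 i)); last first.
    by apply/funext => k; rewrite !mxE.
  have : (s k * y 0 i + x 0 i) @[k --> \oo] --> (0 * y 0 i + x 0 i : R).
    by apply: cvgD; [apply: cvgM => //; exact: cvg_cst|exact: cvg_cst].
  by rewrite mul0r add0r.
apply: cvgM; apply: (cvg_comp _ tau); try exact: continuous_tau.
  by apply: cvgM; [exact: cvg_cst|apply: cvgB => //; exact: cvg_cst].
by apply: cvgM; [exact: cvg_cst|apply: cvgB => //; exact: cvg_cst].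
Qed.

Lemma cvg_tau_gt0 (s : R) : 0 < s -> tau (m%:R * s) @[m --> \oo] --> (1 : R).
Proof.
move=> s0; apply: cvg_near_cst; near=> m; rewrite tau_ge1//.
rewrite -ler_pdivrMr// mul1r; near: m; exact: nbhs_infty_ger.
Unshelve. all: by end_near. Qed.

Lemma trap_cvg_indic a b x : trap a b m x @[m --> \oo] --> (\1_(box a b) x : R).
Proof.
have [bx|nbx] := pselect (box a b x); last first.
  rewrite indicE memNset//; under eq_fun do rewrite trap_out//; exact: cvg_cst.
rewrite indicE mem_set//= -[X in _ --> X](@big1_eq R 1 *%R _ (index_enum 'I_n) xpredT).
apply: cvg_prod_seq => i; rewrite -[X in _ --> X](mulr1 1).
by have /andP[ax xb] := bx i; apply: cvgM; apply: cvg_tau_gt0; rewrite subr_gt0.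
Qed.

Lemma measurable_trap a b m : measurable_fun setT (trap a b m).
Proof.
have mt : measurable_fun setT tau by apply: continuous_measurable_fun; exact: continuous_tau.
by apply: measurable_prod => i _; apply: measurable_funM;
  apply: measurableT_comp => //; apply: measurable_funM => //;
  apply: measurable_funB => //; exact: measurable_coord.
Qed.

End trapezoid.

(** * The measure with a given density; densities are determined on boxes *)

Section density_measure.
Context {R : realType} {n : nat} (p : 'rV[R]_n -> R).
Hypotheses (mp : measurable_fun setT p) (p0 : forall x, 0 <= p x).

(** The two proofs are arguments so that the measure structure can be attached to the resulting
    term. *)
Definition density_measure of measurable_fun setT p & (forall x, 0 <= p x) :=
  fun A : set 'rV[R]_n => (\int[@leb R n]_(x in A) (p x)%:E)%E.

Local Notation nu := (density_measure mp p0).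

Let nu0 : nu set0 = 0%E. Proof. by rewrite /density_measure integral_set0. Qed.

Let nu_ge0 A : (0 <= nu A)%E.
Proof. by apply: integral_ge0 => x _; rewrite lee_fin. Qed.

Let nu_sigma_additive : semi_sigma_additive nu.
Proof.
move=> A mA tA mUA; rewrite /density_measure ge0_integral_bigcup//=.
- by apply: is_cvg_ereal_nneg_natsum_cond => k _ _; exact: nu_ge0.
- by apply/measurable_EFinP; exact: measurable_funTS.
- by move=> x _; rewrite lee_fin.
Qed.

HB.instance Definition _ := isMeasure.Build _ _ _ nu nu0 nu_ge0 nu_sigma_additive.

Lemma density_of_boxes d (T : measurableType d) (P : probability T R) (Y : T -> 'rV[R]_n) :
  measurable_fun setT Y ->
  (forall a b : 'rV[R]_n, (forall i, a 0 i < b 0 i) ->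
     P (Y @^-1` box a b) = (\int[@leb R n]_(x in box a b) (p x)%:E)%E) ->
  forall A, measurable A -> P (Y @^-1` A) = (\int[@leb R n]_(x in A) (p x)%:E)%E.
Proof.
move=> mY PE A mA.
apply: (@measure_unique_boxes R n
  (measure_function_pushforward__canonical__measure_function_Measure P mY) nu) mA => //=.
- move=> a b _; rewrite /pushforward (le_lt_trans (probability_le1 P _)) ?ltry//.
  by rewrite -[X in measurable X]setTI; apply: mY => //; exact: measurable_box.
Qed.

End density_measure.

(** * A square-integrable characteristic function yields a density, with an L^2 bound *)

Section exists_density.
Context d (T : measurableType d) {R : realType} (P : probability T R) (n : nat).
Local Notation leb := (@leb R n).
Implicit Types Y Z : T -> 'rV[R]_n.

Lemma integral_eq_off_null d' (T' : measurableType d') (m : {measure set T' -> \bar R})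
    (A : set T') (f g : T' -> R) : measurable A -> m (~` A) = 0%E ->
  measurable_fun setT f -> measurable_fun setT g -> (forall x, A x -> f x = g x) ->
  (\int[m]_x (f x)%:E = \int[m]_x (g x)%:E)%E.
Proof.
move=> mA A0 mf mg fg; apply: ae_eq_integral => //.
- exact/measurable_EFinP.
- exact/measurable_EFinP.
- exists (~` A); split => //; first exact: measurableC.
  by move=> x /= h Ax; apply: h => _; rewrite fg.
Qed.

Lemma cvg_scale_inv : ((k.+1)%:R^-1 : R) @[k --> \oo] --> (0 : R).
Proof. exact: cvg_harmonic. Qed.

Lemma continuous_Gam_scale (t : 'rV[R]_n) (s : nat -> R) :
  s k @[k --> \oo] --> (0 : R) -> Gam (s k) t @[k --> \oo] --> (1 : R).
Proof.
move=> s0; have -> : (1 : R) = expR (- (0 * dotp t t / 2)) by rewrite !mul0r oppr0 expR0.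
apply: (cvg_comp (fun k => - (s k * dotp t t / 2)) (@expR R)); last exact: continuous_expR.
by apply: cvgN; apply: cvgM; [apply: cvgM => //; exact: cvg_cst|exact: cvg_cst].
Qed.

Lemma cvg_to_eq (f : nat -> R) (l l' : R) : l = l' ->
  f k @[k --> \oo] --> l -> f k @[k --> \oo] --> l'.
Proof. by move=> ->. Qed.

Lemma cvg_sqr (f : nat -> R) (l : R) :
  f k @[k --> \oo] --> l -> f k ^+ 2 @[k --> \oo] --> l ^+ 2.
Proof. by move=> fl; under eq_fun do rewrite expr2; rewrite expr2; exact: cvgM. Qed.

Lemma subsequence_below (a : nat -> R) (e : nat -> R) : (forall k, 0 < e k) ->
  a k @[k --> \oo] --> (0 : R) ->
  exists m : nat -> nat, forall k, (k <= m k)%N /\ a (m k) <= e k.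
Proof.
move=> e0 a0.
have : forall k, exists m, (k <= m)%N /\ a m <= e k.
  move=> k; have /cvgr0Pnorm_lt/(_ (e k) (e0 k)) h := a0.
  have : \forall m \near \oo, (k <= m)%N /\ a m <= e k.
    near=> m; split; first by near: m; exact: nbhs_infty_ge.
    by rewrite (le_trans (ler_norm _))// ltW//; near: m.
  by move=> /filter_ex.
by move=> h; have [m mP] := choice h; exists m.
Unshelve. all: by end_near. Qed.

(** The transforms of the smoothings of Y are that of Y times Gaussians tending to 1, so by
    Plancherel the smoothings are Cauchy in L^2 as the variance tends to 0. A rapidly convergent
    subsequence has an almost everywhere limit [p]. Weak convergence identifies [p] as the density,
    and Fatou carries the L^2 distance to any other smoothed law over to [p]. *)
Lemma exists_density Y : measurable_fun setT Y ->
  leb.-integrable setT (EFin \o corr P Y Y) ->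
  exists p : 'rV[R]_n -> R, [/\ measurable_fun setT p, forall x, 0 <= p x,
    forall A, measurable A -> P (Y @^-1` A) = (\int[leb]_(x in A) (p x)%:E)%E &
    forall w Z, 0 < w -> measurable_fun setT Z ->
      (\int[leb]_x ((p x - sm P w Z x) ^+ 2)%:E <=
       (((2 * pi) ^+ n)^-1 * \int[leb]_t fdiff P Y (fun=> 1%R) Z (Gam w) t)%:E)%E].
Proof.
move=> mY iY.
have K0 : 0 < (2 * pi) ^+ n :> R by rewrite exprn_gt0// mulr_gt0// pi_gt0.
set K := (2 * pi) ^+ n in K0 *.
pose al (m : nat) : R := m.+1%:R^-1.
have al0 m : 0 < al m by rewrite invr_gt0.
pose v m := al m ^+ 2.
have v0 m : 0 < v m by rewrite exprn_gt0.
have mc := measurable_corr P mY mY.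
have c0 t : 0 <= corr P Y Y t by exact: corr_ge0.
have G01 m t : 0 <= @Gam R n (v m) t <= 1 by rewrite Gam_ge0/= Gam_le1// ltW.
have mG m : measurable_fun setT (@Gam R n (v m)) by exact: measurable_Gam.
have iq (q : 'rV[R]_n -> R) : measurable_fun setT q -> (forall t, `|q t| <= 1) ->
    leb.-integrable setT (EFin \o (fun t => corr P Y Y t * q t)).
  by move=> mq q1; exact: integrable_bounded_mul.
pose q m t := (1 - @Gam R n (v m) t) ^+ 2.
have mq m : measurable_fun setT (q m).
  by apply: measurable_funX; apply: measurable_funB.
have q1 m t : `|q m t| <= 1.
  have /andP[h1 h2] := G01 m t; rewrite ger0_norm ?sqr_ge0// /q; nra.
(* The squared L^2 distance between the transforms of Y smoothed with variance [v m] and of Y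
   itself. *)
pose aa m := \int[leb]_t (corr P Y Y t * q m t).
have alc : al k @[k --> \oo] --> (0 : R) by exact: cvg_scale_inv.
have vc : v k @[k --> \oo] --> (0 : R).
  by apply: (cvg_to_eq (expr0n R 2)); apply: cvg_sqr.
have aa0 : aa k @[k --> \oo] --> (0 : R).
  have -> : (0 : R) = \int[leb]_t (0 : R).
    by rewrite /Rintegral integral0.
  apply: (Rintegral_dominated_cvg (mu := leb) (g := corr P Y Y)) => //.
  - by move=> m; apply: measurable_funM.
  - move=> t; apply: (cvg_to_eq (mulr0 (corr P Y Y t))); apply: cvgM; first exact: cvg_cst.
    apply: (cvg_to_eq (expr0n R 2)); apply: cvg_sqr.
    apply: (cvg_to_eq (subrr (1 : R))); apply: cvgB; first exact: cvg_cst.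
    exact: continuous_Gam_scale.
  - by move=> m t; rewrite normrM ger0_norm// ler_piMr.
(* 16^-k is the rate that [fast_L2_cauchy] asks for. *)
have e0 k : 0 < (16^-1 : R) ^+ k by rewrite exprn_gt0// invr_gt0.
have [m mP] := subsequence_below e0 aa0.
have mge k : (k <= m k)%N by have [] := mP k.
have aam k : aa (m k) <= 16^-1 ^+ k by have [] := mP k.
pose u k := sm P (v (m k)) Y.
have mu_ k : measurable_fun setT (u k) by apply: measurable_sm => //; exact: ltW.
have u0 k x : 0 <= u k x by exact: sm_ge0.
have uC k : (\int[leb]_x ((u k.+1 x - u k x) ^+ 2)%:E <= (K^-1 * 4 * 16^-1 ^+ k)%:E)%E.
  rewrite parseval_diff// lee_fin -/K -mulrA ler_pM2l ?invr_gt0//.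
  have i1 := iq _ (mq (m k.+1)) (q1 (m k.+1)).
  have i2 := iq _ (mq (m k)) (q1 (m k)).
  have i1' : leb.-integrable setT (EFin \o (fun t => 2 * (corr P Y Y t * q (m k.+1) t))).
    exact: (integrableZl _ 2 i1).
  have i2' : leb.-integrable setT (EFin \o (fun t => 2 * (corr P Y Y t * q (m k) t))).
    exact: (integrableZl _ 2 i2).
  have i3 : leb.-integrable setT (EFin \o (fun t => corr P Y Y t * (Gam (v (m k.+1)) t - Gam (v (m k)) t) ^+ 2)).
    apply: iq.
      by apply: measurable_funX; apply: measurable_funB.
    move=> t; have /andP[h1 h2] := G01 (m k.+1) t; have /andP[h3 h4] := G01 (m k) t.
    by rewrite ger0_norm ?sqr_ge0//; move: h1 h2 h3 h4; move: (Gam _ t) (Gam _ t) => x y *; nra.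
  have -> : \int[leb]_t fdiff P Y (Gam (v (m k.+1))) Y (Gam (v (m k))) t =
      \int[leb]_t (corr P Y Y t * (Gam (v (m k.+1)) t - Gam (v (m k)) t) ^+ 2).
    apply: eq_Rintegral => t _; rewrite /fdiff /corr.
    by move: (Gam (v (m k.+1)) t) (Gam (v (m k)) t) (Ecos P Y t) (Esin P Y t) => *; ring.
  (* The bound is (x - y)^2 <= 2 (1 - x)^2 + 2 (1 - y)^2; then 2 16^-(k+1) + 2 16^-k <= 4 16^-k
     explains the constant 4. *)
  apply: (@le_trans _ _ (2 * aa (m k.+1) + 2 * aa (m k))).
    have -> : 2 * aa (m k.+1) + 2 * aa (m k) =
        \int[leb]_t (2 * (corr P Y Y t * q (m k.+1) t) + 2 * (corr P Y Y t * q (m k) t)).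
      by rewrite (RintegralD measurableT i1' i2') (RintegralZl 2 measurableT i1) (RintegralZl 2 measurableT i2).
    apply: le_Rintegral => //; first exact: (integrableD _ i1' i2').
    move=> t _; rewrite /q; have := c0 t.
    move: (corr P Y Y t) (Gam (v (m k.+1)) t) (Gam (v (m k)) t) => c x y c_ge0.
    by have := mulr_ge0 c_ge0 (sqr_ge0 (2 - x - y)); lra.
  have := aam k.+1; have := aam k; have := e0 k; rewrite exprS => h1 h2 h3.
  by move: h1 h2 h3; move: (_ ^+ k) (aa _) (aa _) => x y z *; lra.
have C0 : 0 <= K^-1 * 4 by rewrite mulr_ge0// invr_ge0 ltW.
have [A [S [mA A0 iS S0 AS]]] := fast_L2_cauchy mu_ C0 uC.
have mS : measurable_fun setT S by have /integrableP[/measurable_EFinP] := iS.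
(* Cutting to 0 off the good set makes the sequence converge everywhere, so that its limit is
   measurable. *)
pose u' k x := u k x * \1_A x.
have mu' k : measurable_fun setT (u' k).
  by apply: measurable_funM => //; exact: measurable_indic.
have u'0 k x : 0 <= u' k x by rewrite mulr_ge0.
have uu' k x : A x -> u k x = u' k x by move=> Ax; rewrite /u' indicE mem_set// mulr1.
have cu' x : cvgn (u' ^~ x).
  have [Ax|nAx] := pselect (A x).
    have [+ _] := @cvg_fast_cauchy R (u ^~ x) _ (AS x ^~ Ax).
    by rewrite (_ : u ^~ x = u' ^~ x)//; apply/funext => k; exact: uu'.
  rewrite (_ : u' ^~ x = fun=> 0); first exact: is_cvg_cst.
  by apply/funext => k; rewrite /u' indicE memNset// mulr0.
have bu' k x : u' k x <= u 0%N x + 2 * (1 + S x).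
  have h : 0 <= u 0%N x + 2 * (1 + S x) by rewrite addr_ge0// mulr_ge0// addr_ge0.
  have [Ax|nAx] := pselect (A x); last by rewrite /u' indicE memNset// mulr0.
  have [_ /(_ k)] := @cvg_fast_cauchy R (u ^~ x) _ (AS x ^~ Ax).
  rewrite -uu'// => /(le_trans (ler_norm _)); clear.
  by move: (u k x) (u 0%N x) (S x) => a b c; lra.
pose p x := limn (u' ^~ x).
have u'p x : u' k x @[k --> \oo] --> p x by exact: cu'.
have mp : measurable_fun setT p by apply: (measurable_fun_cvg mu') => // x _; exact: u'p.
have p0 x : 0 <= p x by apply: limr_ge => //; apply: nearW.
have int_u' (F : R -> 'rV[R]_n -> R) :
    (forall f, measurable_fun setT f -> measurable_fun setT (fun x => F (f x) x)) ->
    forall k, (\int[leb]_x (F (u' k x) x)%:E = \int[leb]_x (F (u k x) x)%:E)%E.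
  move=> mF k; apply: (integral_eq_off_null mA A0); [exact: mF|exact: mF|].
  by move=> x /uu' ->.
have iu0 : leb.-integrable setT (EFin \o u 0%N).
  apply/integrableP; split; first exact/measurable_EFinP.
  under eq_integral => x _ do rewrite /= ger0_norm//.
  by rewrite integral_sm// ltry.
have ip : leb.-integrable setT (EFin \o p).
  apply/integrableP; split; first exact/measurable_EFinP.
  under eq_integral => x _ do rewrite /= ger0_norm//.
  have : (\int[leb]_x (p x)%:E <= 1)%E.
    apply: (fatou_cvg mu') => //.
    have -> : (fun k => \int[leb]_x (u' k x)%:E)%E = fun=> 1%E.
      by apply/funext => k; rewrite (int_u' (fun r _ => r))// integral_sm.
    exact: cvg_cst.
  by move=> /le_lt_trans -> //; exact: ltry.
exists p; split => //.
  apply: density_of_boxes => // a b ab.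
  have mB : measurable (box a b) by exact: measurable_box.
  (* Both sides are limits of the integrals of the trapezoid against the smoothings: the left one by
     weak convergence, the right one by domination. *)
  have trap_eq j : (\int[P]_w (trap a b j (Y w))%:E = \int[leb]_x (trap a b j x * p x)%:E)%E.
    have amk k : 0 < al (m k) by [].
    have amc : al (m k) @[k --> \oo] --> (0 : R).
      apply: (squeeze_cvgr _ (cvg_cst 0) alc); apply: nearW => k.
      by rewrite ltW//= lef_pV2 ?posrE// ler_nat ltnS.
    have lim1 := sm_weak_cvg (P := P) amk amc mY (measurable_trap a b j) (trap01 a b j)
      (fun s x y => @trap_cvg _ _ a b j s x y).
    (* The constant term of the bound [bu'] is integrable only on the box, to which the trapezoid
       confines it. *)
    pose g x := u 0%N x + (2 * \1_(box a b) x + 2 * S x).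
    have ig : leb.-integrable setT (EFin \o g).
      have i1 : leb.-integrable setT (EFin \o (fun x => 2 * \1_(box a b) x : R)).
        have i0 : leb.-integrable setT (EFin \o (fun x => \1_(box a b) x : R)).
          apply/integrableP; split.
            by apply/measurable_EFinP; exact: measurable_indic.
          under eq_integral => x _ do rewrite /= ger0_norm//.
          have E := @leb_box R n a b (fun i => ltW (ab i)).
          by rewrite integral_indic// setIT [X in (X < _)%E]E ltry.
        exact: (integrableZl _ 2 i0).
      have i2 : leb.-integrable setT (EFin \o (fun x => 2 * S x)) by exact: (integrableZl _ 2 iS).
      exact: (integrableD _ iu0 (integrableD measurableT i1 i2)).
    have [_ lim2] : leb.-integrable setT (EFin \o (fun x => trap a b j x * p x)) /\
        (\int[leb]_x (trap a b j x * u' k x)%:E)%E @[k --> \oo] -->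
        (\int[leb]_x (trap a b j x * p x)%:E)%E.
      apply: (EFin_dominated_cvg (g := g)) => //.
      - by move=> k; apply: measurable_funM => //; exact: measurable_trap.
      - by move=> x; apply: cvgM; [exact: cvg_cst|exact: u'p].
      - move=> k x; have /andP[t0 t1] := trap01 a b j x.
        have g0 : 0 <= g x by rewrite /g !addr_ge0// mulr_ge0.
        rewrite ger0_norm ?mulr_ge0//.
        have [Bx|nBx] := pselect (box a b x); last by rewrite trap_out// mul0r.
        rewrite (@le_trans _ _ (u' k x))//; first by rewrite ler_piMl.
        by rewrite (le_trans (bu' k x))// /g indicE mem_set// mulrDr mulr1.
    apply: (cvg_unique _ lim1); first exact: ereal_hausdorff.
    apply: cvg_trans lim2; apply: near_eq_cvg; apply: nearW => k.
    rewrite (int_u' (fun r x => trap a b j x * r)) => // f mf.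
    by apply: measurable_funM => //; exact: measurable_trap.
  have [_ limP] : P.-integrable setT (EFin \o (fun w => \1_(box a b) (Y w) : R)) /\
      (\int[P]_w (trap a b j (Y w))%:E)%E @[j --> \oo] --> (\int[P]_w (\1_(box a b) (Y w))%:E)%E.
    apply: (EFin_dominated_cvg (g := fun=> 1)) => //.
    - by move=> j; apply: measurableT_comp => //; exact: measurable_trap.
    - by move=> w; exact: trap_cvg_indic.
    - exact: finite_measure_integrable_cst.
    - by move=> j w; have /andP[t0 t1] := trap01 a b j (Y w); rewrite ger0_norm.
  have [_ limL] : leb.-integrable setT (EFin \o (fun x => \1_(box a b) x * p x)) /\
      (\int[leb]_x (trap a b j x * p x)%:E)%E @[j --> \oo] --> (\int[leb]_x (\1_(box a b) x * p x)%:E)%E.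
    apply: (EFin_dominated_cvg (g := p)) => //.
    - by move=> j; apply: measurable_funM => //; exact: measurable_trap.
    - by move=> x; apply: cvgM; [exact: trap_cvg_indic|exact: cvg_cst].
    - move=> j x; have /andP[t0 t1] := trap01 a b j x.
      by rewrite ger0_norm ?mulr_ge0// ler_piMl.
  have : (\int[P]_w (\1_(box a b) (Y w))%:E = \int[leb]_x (\1_(box a b) x * p x)%:E)%E.
    apply: (cvg_unique _ limP); first exact: ereal_hausdorff.
    by apply: cvg_trans limL; apply: near_eq_cvg; apply: nearW => j; rewrite trap_eq.
  have mYB : measurable (Y @^-1` box a b).
    by rewrite -[X in measurable X]setTI; exact: mY.
  rewrite (_ : (\int[P]_w (\1_(box a b) (Y w))%:E)%E = P (Y @^-1` box a b)); last first.
    by rewrite -(setIT (Y @^-1` _)) -integral_indic.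
  move=> ->; rewrite [RHS]integral_mkcond; apply: eq_integral => x _.
  by rewrite patchE indicE; case: ifPn => _; rewrite ?mul1r ?mul0r.
(* The L^2 bound: Fatou on the side of the densities, dominated convergence on the side of the
   transforms. *)
move=> w Z w0 mZ.
have iZ : leb.-integrable setT (EFin \o (fun t => corr P Z Z t * Gam w t ^+ 2)).
  have := integrable_corr_Gam P (addr_gt0 w0 w0) mZ mZ.
  by rewrite (_ : (fun t => corr P Z Z t * Gam (w + w) t) = (fun t => corr P Z Z t * Gam w t ^+ 2))//;
    apply/funext => t; rewrite GamD expr2.
apply: (fatou_cvg (f_ := fun k x => (u' k x - sm P w Z x) ^+ 2)).
- move=> k; apply: measurable_funX; apply: measurable_funB => //.
  by apply: measurable_sm => //; exact: ltW.
- by move=> k x; rewrite sqr_ge0.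
- by move=> x; apply: cvg_sqr; apply: cvgB => //; exact: cvg_cst.
have -> : (fun k => \int[leb]_x ((u' k x - sm P w Z x) ^+ 2)%:E)%E =
    (fun k => (K^-1 * \int[leb]_t fdiff P Y (Gam (v (m k))) Z (Gam w) t)%:E).
  apply/funext => k; rewrite (int_u' (fun r x => (r - sm P w Z x) ^+ 2)).
    by rewrite parseval_diff.
  move=> f mf; apply: measurable_funX; apply: measurable_funB => //.
  by apply: measurable_sm => //; exact: ltW.
apply: cvg_EFin; first exact: nearW.
apply: cvgM; first exact: cvg_cst.
apply: (Rintegral_dominated_cvg (mu := leb)
  (g := fun t => 2 * corr P Y Y t + 2 * (corr P Z Z t * Gam w t ^+ 2))).
- move=> k; apply: measurable_fdiff => //; exact: measurable_Gam.
- move=> t; have Gc : Gam (v (m k)) t @[k --> \oo] --> (1 : R).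
    apply: continuous_Gam_scale; apply: (squeeze_cvgr _ (cvg_cst 0) vc); apply: nearW => k.
    rewrite ltW//= ler_pXn2r ?nnegrE ?(ltW (al0 _))//.
    by rewrite /al lef_pV2 ?posrE// ler_nat ltnS.
  apply: cvgD; apply: cvg_sqr; apply: cvgB; try exact: cvg_cst.
    by apply: cvgM; [exact: cvg_cst|].
  by apply: cvgM; [exact: cvg_cst|].
- have i1 : leb.-integrable setT (EFin \o (fun t => 2 * corr P Y Y t)) by exact: (integrableZl _ 2 iY).
  have i2 : leb.-integrable setT (EFin \o (fun t => 2 * (corr P Z Z t * Gam w t ^+ 2))).
    exact: (integrableZl _ 2 iZ).
  exact: (integrableD _ i1 i2).
- move=> k t; rewrite ger0_norm ?fdiff_ge0// (le_trans (fdiff_le _ _ _ _ _ _))// lerD2r ler_pM2l//.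
  have /andP[h1 h2] := G01 (m k) t.
  by rewrite ler_piMr// expr_le1.
Qed.

End exists_density.

(** * Integration against a restricted measure *)

Section mrestr.
Context d (T : measurableType d) {R : realType} (mu : {measure set T -> \bar R}).

Lemma ge0_integral_mrestr (B : set T) (mB : measurable B) (f : T -> \bar R) :
  measurable_fun setT f -> (forall x, 0 <= f x)%E ->
  (\int[mrestr mu mB]_x f x = \int[mu]_(x in B) f x)%E.
Proof.
move=> mf f0.
have mBC : measurable (~` B) by exact: measurableC.
have B0 : mrestr mu mB (~` B) = 0%E by rewrite /mrestr setICl measure0.
rewrite (ge0_negligible_integral mBC measurableT _ _ B0)//.
rewrite setTD setCK; apply: eq_measure_integral => A mA AB.
rewrite /= /mrestr; congr (mu _); apply/seteqP; split=> [x []//|x Ax].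
by split=> //; exact: AB.
Qed.

End mrestr.

Lemma measurable_fun2 d d1 d2 d3 (T : measurableType d) (T1 : measurableType d1)
    (T2 : measurableType d2) (T3 : measurableType d3) (G : T1 -> T2 -> T3) (f : T -> T1) (g : T -> T2) :
  measurable_fun setT (fun z => G z.1 z.2) -> measurable_fun setT f -> measurable_fun setT g ->
  measurable_fun setT (fun w => G (f w) (g w)).
Proof. by move=> mG mf mg; exact: (measurableT_comp mG (measurable_fun_pair mf mg)). Qed.

(** * Expectations of functions of X and S_n as finite averages over sign patterns *)

Section cube_sums.
Context d0 (T : measurableType d0) {R : realType} (P : probability T R) (d : nat).
Variables (X : T -> 'rV[R]_d) (Xs : nat -> T -> 'rV[R]_d).
Hypothesis mX : measurable_fun setT X.
Hypothesis mXs : forall k, measurable_fun setT (Xs k).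
Hypothesis Xs_indep : independent_seq P Xs.
Hypothesis Xs_unif : forall k, uniform_on_cube P (Xs k).
Hypothesis X_indep : independent_of_seq P X Xs.

Definition vertex (c : {ffun 'I_d -> bool}) : 'rV[R]_d := \row_j (-1) ^+ c j.

Lemma vertex_inj : injective vertex.
Proof.
move=> c c' /rowP h; apply/ffunP => j; have := h j; rewrite !mxE.
have n1 : (1 : R) <> -1 by move/eqP; rewrite -subr_eq0 opprK -(natrD R 1 1) pnatr_eq0.
by case: (c j); case: (c' j) => //=; rewrite ?expr0 ?expr1 => // /esym.
Qed.

Lemma measurable_set1_rV (v : 'rV[R]_d) : measurable [set v].
Proof.
rewrite (_ : [set v] = \big[setI/setT]_(i < d) (fun x : 'rV[R]_d => x 0 i) @^-1` [set v 0 i]).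
  apply: bigsetI_measurable => i _.
  by rewrite -[X in measurable X]setTI; apply: measurable_coord => //; exact: measurable_set1.
rewrite -bigcap_seq; apply/seteqP; split => [x /= -> i _//|x /= bx].
by apply/rowP => i; exact: (bx i (mem_index_enum i)).
Qed.

Variable n : nat.
Definition word := {ffun 'I_n -> {ffun 'I_d -> bool}}.

Definition idx : {fset nat} := seq_fset tt (iota 0 n).

Lemma idxE i : (i \in idx) = (i < n)%N.
Proof. by rewrite seq_fsetE mem_iota. Qed.

(** Independence is stated for a set at every natural index, hence the value [setT] beyond the first
    n. *)
Definition target (e : word) (i : nat) : set 'rV[R]_d :=
  if insub i is Some o then [set vertex (e o)] else setT.

Definition cyl (e : word) := \bigcap_(i in [set` idx]) (Xs i @^-1` target e i).

Lemma cylP (e : word) w : cyl e w <-> forall i : 'I_n, Xs i w = vertex (e i).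
Proof.
split => [h i|h i /=].
  have /h : [set` idx] (i : nat) by rewrite /= idxE.
  by rewrite /target /= valK.
rewrite idxE => il.
by rewrite /target insubT//=; exact: (h (Ordinal il)).
Qed.

Lemma measurable_target e i : measurable (target e i).
Proof. rewrite /target; case: (insub i) => *; [exact: measurable_set1_rV|exact: measurableT]. Qed.

Lemma sigma_cyl e : <<s \bigcup_n preimage_set_system setT (Xs n) measurable >> (cyl e).
Proof.
apply: (@fin_bigcap_measurable _ (g_sigma_algebraType
  (\bigcup_n preimage_set_system setT (Xs n) measurable))); first exact: finite_fset.
move=> i _; apply: sub_sigma_algebra; exists i => //; exists (target e i) => //.
  exact: measurable_target.
by rewrite setTI.
Qed.

Lemma measurable_cyl e : measurable (cyl e).
Proof.
apply: fin_bigcap_measurable; first exact: finite_fset.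
move=> i _; rewrite -[X in measurable X]setTI; apply: mXs => //; exact: measurable_target.
Qed.

Lemma prob_cyl e : P (cyl e) = (((2 ^+ d)^-1) ^+ n)%:E.
Proof.
rewrite /cyl Xs_indep; last exact: measurable_target.
rewrite (eq_big_seq (fun=> ((2 ^+ d)^-1)%:E)); last first.
  move=> i; rewrite idxE => il; rewrite /target insubT//=.
  rewrite Xs_unif// => k; rewrite mxE.
  by case: (e _ k); [left|right]; rewrite ?expr1 ?expr0.
rewrite prodEFin big_const_seq count_predT iter_mulr_1; congr (_ ^+ _)%:E.
by rewrite size_seq_fset undup_id ?iota_uniq// size_iota.
Qed.

Lemma cyl_disjoint e e' w : cyl e w -> cyl e' w -> e = e'.
Proof.
move=> /cylP h /cylP h'; apply/ffunP => i; apply: vertex_inj.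
by rewrite -h -h'.
Qed.

Definition cyls : set T := \bigcup_(e in [set: word]) cyl e.

Lemma measurable_cyls : measurable cyls.
Proof. by apply: fin_bigcup_measurable => [|e _]; [exact: finite_finset|exact: measurable_cyl]. Qed.

Lemma card_word : #|{: word}| = ((2 ^ d) ^ n)%N.
Proof. by rewrite !card_ffun card_bool !card_ord. Qed.

Lemma sum_word : \sum_(e : word) ((2 ^+ d)^-1) ^+ n = 1 :> R.
Proof.
rewrite sumr_const (eq_card (_ : _ =i {: word}))// card_word -[LHS]mulr_natr.
by rewrite !natrX -exprMn mulVf ?expr1n// expf_neq0// pnatr_eq0.
Qed.

(** There are 2^(d n) disjoint cylinders of mass 2^(-d n) each. The hypothesis gives only the masses
    of the vertices; that the steps take no other values, up to a null event, follows from this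
    count. *)
Lemma prob_cyls : P cyls = 1%E.
Proof.
rewrite /cyls measure_fin_bigcup//; last 3 first.
- exact: finite_finset.
- apply/trivIsetP => e e' _ _ ee'; apply/seteqP; split => // w [h h'].
  by move/eqP: ee'; apply; exact: cyl_disjoint h h'.
- by move=> e _; exact: measurable_cyl.
rewrite (_ : [set: word] = [set` index_enum word]); last first.
  by apply/seteqP; split => // e _; exact: mem_index_enum.
rewrite -fsbig_seq ?index_enum_uniq// (eq_bigr (fun=> (((2 ^+ d)^-1) ^+ n)%:E)); last by move=> e _; exact: prob_cyl.
rewrite sumEFin; congr (_%:E).
exact: sum_word.
Qed.

Definition walk (e : word) : 'rV[R]_d := \sum_i vertex (e i).

Lemma walk_cyl e w : cyl e w -> \sum_(k < n) Xs k w = walk e.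
Proof. by move=> /cylP h; apply: eq_bigr => i _; rewrite h. Qed.

(** Independence says that the image under X of P restricted to the cylinder is a multiple of the
    law of X. *)
Lemma integral_cyl e (g : 'rV[R]_d -> \bar R) : measurable_fun setT g ->
  (forall x, 0 <= g x)%E ->
  (\int[P]_(w in cyl e) g (X w) = (((2 ^+ d)^-1) ^+ n)%:E * \int[P]_w g (X w))%E.
Proof.
move=> mg g0.
have mB := measurable_cyl e.
have mgX : measurable_fun setT (fun w => g (X w)) by exact: measurableT_comp.
rewrite -(ge0_integral_mrestr P mB mgX)//.
have c0 : 0 <= ((2 ^+ d)^-1) ^+ n :> R by rewrite exprn_ge0// invr_ge0 exprn_ge0.
have E1 := @ge0_integral_pushforward _ _ _ _ _ _ mX (mrestr P mB) setT g measurableT mg (fun x _ => g0 x).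
have E2 := @ge0_integral_pushforward _ _ _ _ _ _ mX P setT g measurableT mg (fun x _ => g0 x).
rewrite preimage_setT in E1, E2.
apply: (etrans (esym E1)); rewrite -[X in (_ * X)%E]E2.
have -> : (((2 ^+ d)^-1) ^+ n)%:E = ((NngNum c0)%:num)%:E by [].
rewrite -ge0_integral_mscale//; apply: eq_measure_integral => A mA _.
rewrite /= /pushforward /mrestr /mscale/= /pushforward.
by rewrite X_indep//; [rewrite prob_cyl muleC|exact: sigma_cyl].
Qed.

(** Almost surely exactly one cylinder occurs, and on it S_n is the deterministic vector
    [walk e]. *)
Lemma ge0_integral_walk (G : 'rV[R]_d -> 'rV[R]_d -> R) :
  measurable_fun setT (fun z => G z.1 z.2) -> (forall x y, 0 <= G x y) ->
  (\int[P]_w (G (X w) (\sum_(k < n) Xs k w))%:E =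
   \sum_(e : word) ((((2 ^+ d)^-1) ^+ n)%:E * \int[P]_w (G (X w) (walk e))%:E))%E.
Proof.
move=> mG G0.
have mS : measurable_fun setT (fun w => \sum_(k < n) Xs k w).
  apply: measurable_fun_rV => i.
  rewrite (_ : (fun x => _) = (fun w => \sum_(k < n) Xs k w 0 i)).
    by apply: measurable_sum => k; apply: (measurableT_comp (measurable_coord i)).
  by apply/funext => w; rewrite summxE.
have mF : measurable_fun setT (fun w => G (X w) (\sum_(k < n) Xs k w)).
  exact: (measurable_fun2 mG).
have mFi e : measurable_fun setT (fun x => G x (walk e)).
  exact: (measurable_fun2 mG).
have mFX e : measurable_fun setT (fun w => G (X w) (walk e)) by exact: (measurableT_comp (mFi e)).
pose F w := \sum_(e : word) (G (X w) (walk e) * \1_(cyl e) w).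
have mFF : measurable_fun setT F.
  by apply: measurable_sum => e; apply: measurable_funM => //; apply: measurable_indic; exact: measurable_cyl.
have P0 : P (~` cyls) = 0%E.
  rewrite probability_setC; last exact: measurable_cyls.
  by rewrite [X in (_ - X)%E]prob_cyls subee.
rewrite (integral_eq_off_null measurable_cyls P0 mF mFF); last first.
  move=> w [e _ ew].
  rewrite /F (bigD1 e)//= indicE mem_set// mulr1 (walk_cyl ew) big1 ?addr0// => e' ee'.
  rewrite indicE memNset ?mulr0// => e'w; move/eqP: ee'; apply.
  exact: cyl_disjoint e'w ew.
rewrite /F; under eq_integral do rewrite -sumEFin.
rewrite ge0_integral_sum//; last 2 first.
- move=> e; apply/measurable_EFinP; apply: measurable_funM => //.
  by apply: measurable_indic; exact: measurable_cyl.
- by move=> e w _; rewrite lee_fin mulr_ge0.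
apply: eq_bigr => e _.
rewrite -(@integral_cyl e (fun x => (G x (walk e))%:E)); last 2 first.
- exact/measurable_EFinP.
- by move=> x; rewrite lee_fin.
rewrite [RHS]integral_mkcond; apply: eq_integral => w _.
by rewrite patchE indicE; case: ifPn => _; rewrite ?mulr1 ?mulr0.
Qed.

(** Apply the nonnegative case to 1 + G; the constants cancel because the weights sum to 1. *)
Lemma Rintegral_walk (G : 'rV[R]_d -> 'rV[R]_d -> R) :
  measurable_fun setT (fun z => G z.1 z.2) -> (forall x y, `|G x y| <= 1) ->
  \int[P]_w G (X w) (\sum_(k < n) Xs k w) =
  ((2 ^+ d)^-1) ^+ n * \sum_(e : word) \int[P]_w G (X w) (walk e).
Proof.
move=> mG G1.
have mG1 : measurable_fun setT (fun z : 'rV[R]_d * 'rV[R]_d => 1 + G z.1 z.2) by exact: measurable_funD.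
have G0 x y : 0 <= 1 + G x y.
  by rewrite -lerBlDl sub0r; have := G1 x y; rewrite ler_norml => /andP[].
have int1 (Z : T -> R) : measurable_fun setT Z -> (forall w, `|Z w| <= 1) ->
    (\int[P]_w (1 + Z w)%:E = (1 + \int[P]_w Z w)%:E)%E.
  move=> mZ Z1.
  have iZ := integrable_bounded P mZ Z1.
  have i1 : P.-integrable setT (EFin \o (fun=> 1)) by exact: finite_measure_integrable_cst.
  rewrite EFin_Rintegral; last exact: (integrableD _ i1 iZ).
  by rewrite RintegralD// [X in X + _](_ : _ = 1)// /Rintegral integral_prob_cst.
have mS : measurable_fun setT (fun w => \sum_(k < n) Xs k w).
  apply: measurable_fun_rV => i.
  rewrite (_ : (fun x => _) = (fun w => \sum_(k < n) Xs k w 0 i)).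
    by apply: measurable_sum => k; apply: (measurableT_comp (measurable_coord i)).
  by apply/funext => w; rewrite summxE.
have := ge0_integral_walk mG1 G0.
rewrite int1//; last first.
  exact: (measurable_fun2 mG).
under eq_bigr => e _.
  rewrite int1//; last first.
    exact: (measurable_fun2 mG).
  rewrite -EFinM mulrDr mulr1.
  over.
rewrite sumEFin => -[]; rewrite big_split/= sum_word.
by move=> /addrI ->; rewrite mulr_sumr.
Qed.

End cube_sums.

(** * Characteristic function of the random walk on the cube *)

Section trig_sums.
Context {R : realType} (d n : nat).
Local Open Scope complex_scope.

Definition cis (a : R) : R[i] := cos a +i* sin a.

Lemma cisD a b : cis (a + b) = cis a * cis b.
Proof. by rewrite /cis cosD sinD addrC [X in _ +i* X]addrC; simpc; rewrite addrC. Qed.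

Lemma cis0 : cis 0 = 1.
Proof. by rewrite /cis cos0 sin0. Qed.

Lemma cis_sum (I : Type) (r : seq I) (f : I -> R) :
  cis (\sum_(i <- r) f i) = \prod_(i <- r) cis (f i).
Proof. exact: (big_morph cis cisD cis0). Qed.

Lemma dotp_sumr (I : Type) (r : seq I) (u : 'rV[R]_d) (f : I -> 'rV[R]_d) :
  dotp u (\sum_(i <- r) f i) = \sum_(i <- r) dotp u (f i).
Proof.
apply: (big_morph (dotp u) (dotpDr u)).
by rewrite dotpC dotp0l.
Qed.

(** By distributivity the sum over sign vectors is the product over coordinates of exp(i u_j) +
    exp(-i u_j) = 2 cos u_j. *)
Lemma sum_cis_vertex (u : 'rV[R]_d) :
  \sum_(c : {ffun 'I_d -> bool}) cis (dotp u (vertex c)) =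
  (2 ^+ d * \prod_j cos (u 0 j))%:C.
Proof.
transitivity (\sum_(c : {ffun 'I_d -> bool}) \prod_j cis (u 0 j * (-1) ^+ c j)).
  by apply: eq_bigr => c _; rewrite /dotp cis_sum; apply: eq_bigr => j _; rewrite mxE.
rewrite -(bigA_distr_bigA (fun j (b : bool) => cis (u 0 j * (-1) ^+ b))).
transitivity (\prod_(j < d) (2 * cos (u 0 j))%:C).
  apply: eq_bigr => j _; rewrite big_bool expr1 expr0 mulr1 mulrN1 /cis cosN sinN.
  by apply/eqP; rewrite eq_complex /= addNr eqxx andbT; apply/eqP; ring.
rewrite -(rmorph_prod (real_complex R)); congr (_%:C).
by rewrite big_split/= prodr_const card_ord.
Qed.

Lemma sum_cis_walk (u : 'rV[R]_d) :
  \sum_(e : word d n) cis (dotp u (walk e)) =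
  ((2 ^+ d) ^+ n * (\prod_j cos (u 0 j)) ^+ n)%:C.
Proof.
transitivity (\sum_(e : word d n) \prod_i cis (dotp u (vertex (e i)))).
  by apply: eq_bigr => e _; rewrite /walk dotp_sumr cis_sum.
rewrite -(bigA_distr_bigA (fun i c => cis (dotp u (vertex c)))).
rewrite (eq_bigr (fun=> (2 ^+ d * \prod_j cos (u 0 j))%:C)); last first.
  by move=> i _; exact: sum_cis_vertex.
by rewrite prodr_const card_ord -rmorphXn/= exprMn.
Qed.

Lemma Re_sum (I : Type) (r : seq I) (f : I -> R[i]) :
  complex.Re (\sum_(i <- r) f i) = \sum_(i <- r) complex.Re (f i).
Proof. by apply: (big_morph (@complex.Re R)) => // -[a b] [a' b']. Qed.

Lemma Im_sum (I : Type) (r : seq I) (f : I -> R[i]) :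
  complex.Im (\sum_(i <- r) f i) = \sum_(i <- r) complex.Im (f i).
Proof. by apply: (big_morph (@complex.Im R)) => // -[a b] [a' b']. Qed.

Lemma sum_cos_walk (u : 'rV[R]_d) :
  ((2 ^+ d)^-1) ^+ n * \sum_(e : word d n) cos (dotp u (walk e)) =
  (\prod_j cos (u 0 j)) ^+ n.
Proof.
have /(congr1 (@complex.Re R)) := sum_cis_walk u; rewrite Re_sum/= => ->.
by rewrite mulrA -exprMn mulVf ?expr1n ?mul1r// expf_neq0// pnatr_eq0.
Qed.

Lemma sum_sin_walk (u : 'rV[R]_d) :
  \sum_(e : word d n) sin (dotp u (walk e)) = 0.
Proof. by have /(congr1 (@complex.Im R)) := sum_cis_walk u; rewrite Im_sum. Qed.

End trig_sums.

(** * Characteristic function of the normalised sums *)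

Section char_normalized_sum.
Context d0 (T : measurableType d0) {R : realType} (P : probability T R) (d : nat).
Variables (X : T -> 'rV[R]_d) (Xs : nat -> T -> 'rV[R]_d).
Hypothesis mX : measurable_fun setT X.
Hypothesis mXs : forall k, measurable_fun setT (Xs k).
Hypothesis Xs_indep : independent_seq P Xs.
Hypothesis Xs_unif : forall k, uniform_on_cube P (Xs k).
Hypothesis X_indep : independent_of_seq P X Xs.
Variable n : nat.

Lemma measurable_normalized_sum : measurable_fun setT (normalized_sum X Xs n).
Proof.
apply: measurable_rVZ; first exact: measurable_cst.
apply: measurable_rVD => //.
apply: measurable_fun_rV => i.
rewrite (_ : (fun x => _) = (fun w => \sum_(k < n) Xs k w 0 i)).
  by apply: measurable_sum => k; apply: (measurableT_comp (measurable_coord i)).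
by apply/funext => w; rewrite summxE.
Qed.

Lemma Rintegral_cosD (U : T -> R) (b : R) : measurable_fun setT U ->
  \int[P]_w cos (U w + b) = cos b * \int[P]_w cos (U w) - sin b * \int[P]_w sin (U w).
Proof.
move=> mU; have := integral_trig P 0 (cos b) (- sin b) mU.
rewrite /Rintegral => /(congr1 fine) /=; rewrite add0r mulNr => <-.
congr fine; apply: eq_integral => w _.
by rewrite cosD add0r mulNr [cos b * _]mulrC [sin b * _]mulrC.
Qed.

Lemma Rintegral_sinD (U : T -> R) (b : R) : measurable_fun setT U ->
  \int[P]_w sin (U w + b) = sin b * \int[P]_w cos (U w) + cos b * \int[P]_w sin (U w).
Proof.
move=> mU; have := integral_trig P 0 (sin b) (cos b) mU.
rewrite /Rintegral => /(congr1 fine) /=; rewrite add0r => <-.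
congr fine; apply: eq_integral => w _.
by rewrite sinD add0r addrC [cos b * _]mulrC [sin b * _]mulrC.
Qed.

Let u (t : 'rV[R]_d) := (Num.sqrt n%:R)^-1 *: t.

Let mdot (h : R -> R) t : measurable_fun setT h ->
  measurable_fun setT (fun z : 'rV[R]_d * 'rV[R]_d => h (dotp (u t) z.1 + dotp (u t) z.2)).
Proof.
move=> mh; apply: measurableT_comp => //.
by apply: measurable_funD; apply: measurable_dotp.
Qed.

Lemma dotp_normalized_sum t w : dotp t (normalized_sum X Xs n w) =
  dotp (u t) (X w) + dotp (u t) (\sum_(k < n) Xs k w).
Proof. by rewrite /normalized_sum dotpZr -dotpDr /u dotpZl. Qed.

(** The characteristic function of the walk is real, so the sine terms of the addition formula
    average to 0. *)
Lemma Ecos_normalized_sum t : Ecos P (normalized_sum X Xs n) t =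
  Ecos P X (u t) * (\prod_j cos (u t 0 j)) ^+ n.
Proof.
rewrite /Ecos.
transitivity (\int[P]_w cos (dotp (u t) (X w) + dotp (u t) (\sum_(k < n) Xs k w))).
  by apply: eq_Rintegral => w _; rewrite dotp_normalized_sum.
rewrite (@Rintegral_walk _ _ _ P d X Xs mX mXs Xs_indep Xs_unif X_indep n (fun x y => cos (dotp (u t) x + dotp (u t) y))); last 2 first.
- by apply: (mdot t); exact: measurable_cos.
- by move=> x y; rewrite ler_norml cos_geN1 cos_le1.
rewrite -sum_cos_walk mulrCA; congr (_ * _).
rewrite (eq_bigr (fun e => cos (dotp (u t) (walk e)) * Ecos P X (u t) -
    sin (dotp (u t) (walk e)) * Esin P X (u t))); last first.
  by move=> e _; apply: Rintegral_cosD; exact: measurable_dotp.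
by rewrite sumrB -!mulr_suml sum_sin_walk mul0r subr0 mulrC.
Qed.

Lemma Esin_normalized_sum t : Esin P (normalized_sum X Xs n) t =
  Esin P X (u t) * (\prod_j cos (u t 0 j)) ^+ n.
Proof.
rewrite /Esin.
transitivity (\int[P]_w sin (dotp (u t) (X w) + dotp (u t) (\sum_(k < n) Xs k w))).
  by apply: eq_Rintegral => w _; rewrite dotp_normalized_sum.
rewrite (@Rintegral_walk _ _ _ P d X Xs mX mXs Xs_indep Xs_unif X_indep n (fun x y => sin (dotp (u t) x + dotp (u t) y))); last 2 first.
- by apply: (mdot t); exact: measurable_sin.
- by move=> x y; rewrite ler_norml sin_geN1 sin_le1.
rewrite -sum_cos_walk mulrCA; congr (_ * _).
rewrite (eq_bigr (fun e => sin (dotp (u t) (walk e)) * Ecos P X (u t) +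
    cos (dotp (u t) (walk e)) * Esin P X (u t))); last first.
  by move=> e _; apply: Rintegral_sinD; exact: measurable_dotp.
by rewrite big_split/= -!mulr_suml sum_sin_walk mul0r add0r mulrC.
Qed.

End char_normalized_sum.

(** * Expectations as integrals against a density *)

Section density_change.
Context d (T : measurableType d) {R : realType} (P : probability T R) (n : nat).
Local Notation leb := (@leb R n).
Variables (Y : T -> 'rV[R]_n) (p : 'rV[R]_n -> R).
Hypotheses (mY : measurable_fun setT Y) (mp : measurable_fun setT p).
Hypothesis p0 : forall x, 0 <= p x.
Hypothesis Yp : forall A, measurable A -> P (Y @^-1` A) = (\int[leb]_(x in A) (p x)%:E)%E.

Definition subgraph d' (U : measurableType d') (f : U -> R) : set (U * measurableTypeR R) :=
  [set z | 0 <= z.2 < f z.1].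

Lemma measurable_subgraph d' (U : measurableType d') (f : U -> R) :
  measurable_fun setT f -> measurable (subgraph f).
Proof.
move=> mf.
have m2 : measurable_fun setT (fun z : U * measurableTypeR R => z.2 : R) by exact: measurable_snd.
have m1 : measurable_fun setT (fun z : U * measurableTypeR R => f z.1 - z.2).
  by apply: measurable_funB => //; exact: measurableT_comp.
rewrite (_ : subgraph f = (fun z : U * measurableTypeR R => z.2 : R) @^-1` `[0, +oo[ `&`
    (fun z : U * measurableTypeR R => f z.1 - z.2) @^-1` `]0, +oo[).
  apply: measurableI; rewrite -[X in measurable X]setTI.
  - by apply: m2 => //; exact: measurable_itv.
  - by apply: m1 => //; exact: measurable_itv.
by apply/seteqP; split => z /=; rewrite !in_itv/= !andbT subr_gt0 => /andP.
Qed.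

Lemma integral_subgraph (r : R) : 0 <= r ->
  (\int[@lebesgue_measure R]_s (\1_[set s | (0 <= s < r)%R] s)%:E = r%:E)%E.
Proof.
move=> r0; rewrite (_ : [set s | 0 <= s < r] = `[0, r[%classic); last first.
  by apply/seteqP; split => s /=; rewrite in_itv.
rewrite integral_indic// setIT.
rewrite [LHS](lebesgue_measure_itv `[0, r[)/= lte_fin; case: ltP => [_|]; first by rewrite oppr0 adde0.
by move=> h; congr (_%:E); apply/eqP; rewrite eq_le r0.
Qed.

(** Layer cake: f(x) is the length of the set of s with 0 <= s < f(x). For each level s the claim is
    the definition of the density on the set [E s], and Tonelli integrates over s on both sides. *)
Lemma ge0_integral_density (f : 'rV[R]_n -> R) : measurable_fun setT f -> (forall x, 0 <= f x) ->
  (\int[P]_w (f (Y w))%:E = \int[leb]_x (f x * p x)%:E)%E.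
Proof.
move=> mf f0.
pose E (s : R) := [set x | 0 <= s < f x].
have mE s : measurable (E s).
  rewrite (_ : E s = f @^-1` [set y | 0 <= s < y]) //.
  rewrite -[X in measurable X]setTI; apply: mf => //.
  have [s0|s0] := leP 0 s.
    by rewrite (_ : [set _ | _] = `]s, +oo[%classic)//; apply/seteqP; split => y /=; rewrite in_itv/= andbT.
  by rewrite (_ : [set _ | _] = set0)//; apply/seteqP; split => y.
have mfY : measurable_fun setT (fun w => f (Y w)) by exact: measurableT_comp.
pose G (z : T * measurableTypeR R) := (\1_(subgraph (fun w => f (Y w))) z : R)%:E.
have mG : measurable_fun setT G.
  by apply/measurable_EFinP; apply: measurable_indic; exact: measurable_subgraph.
have G0 z : (0 <= G z)%E by rewrite lee_fin.
pose H (z : 'rV[R]_n * measurableTypeR R) := (\1_(subgraph f) z * p z.1 : R)%:E.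
have mH : measurable_fun setT H.
  apply/measurable_EFinP; apply: measurable_funM.
    by apply: measurable_indic; exact: measurable_subgraph.
  exact: measurableT_comp.
have H0 z : (0 <= H z)%E by rewrite lee_fin mulr_ge0.
transitivity (\int[P]_w \int[@lebesgue_measure R]_s G (w, s))%E.
  apply: eq_integral => w _; rewrite -integral_subgraph//.
have F1 := fubini_tonelli (m1 := P) (m2 := @lebesgue_measure R) G mG G0.
apply: (etrans F1).
have F2 := fubini_tonelli (m1 := leb) (m2 := @lebesgue_measure R) H mH H0.
transitivity (\int[leb]_x \int[@lebesgue_measure R]_s H (x, s))%E; last first.
  apply: eq_integral => x _; rewrite /H mulrC EFinM -(integral_subgraph (f0 x)) -ge0_integralZl//.
  - by apply: eq_integral => s _; rewrite mulrC -EFinM.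
  - apply/measurable_EFinP; apply: measurable_indic.
    rewrite (_ : [set s | 0 <= s < f x] = `[0, f x[%classic)//.
  - by rewrite lee_fin.
apply: (etrans _ (esym F2)).
apply: eq_integral => s _.
transitivity (\int[P]_w (\1_(Y @^-1` E s) w)%:E)%E; first by [].
rewrite integral_indic//; last by rewrite -[X in measurable X]setTI; exact: mY.
rewrite setIT; apply: (etrans (Yp (mE s))); rewrite integral_mkcond; apply: eq_integral => x _.
rewrite patchE /H indicE.
rewrite (_ : ((x, s) \in subgraph f) = (x \in E s))//.
by case: ifPn => _; rewrite ?mul1r ?mul0r.
Qed.

Lemma integrable_density : leb.-integrable setT (EFin \o p).
Proof.
apply/integrableP; split; first exact/measurable_EFinP.
under eq_integral => x _ do rewrite /= ger0_norm//.
by rewrite -Yp// preimage_setT [X in (X < _)%E]probability_setT ltry.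
Qed.

Lemma Rintegral_density (g : 'rV[R]_n -> R) : measurable_fun setT g -> (forall x, `|g x| <= 1) ->
  \int[P]_w g (Y w) = \int[leb]_x (g x * p x).
Proof.
move=> mg g1.
have g0 x : 0 <= 1 + g x.
  by rewrite -lerBlDl sub0r; have := g1 x; rewrite ler_norml => /andP[].
have mg1 : measurable_fun setT (fun x => 1 + g x) by exact: measurable_funD.
have igY : P.-integrable setT (EFin \o (fun w => g (Y w))).
  by apply: (@integrable_bounded _ _ _ P _ 1) => //; exact: measurableT_comp.
have i1 : P.-integrable setT (EFin \o (fun=> 1)) by exact: finite_measure_integrable_cst.
have ip := integrable_density.
have igp : leb.-integrable setT (EFin \o (fun x => g x * p x)).
  apply: (le_integrable _ _ _ ip) => //.
    by apply/measurable_EFinP; exact: measurable_funM.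
  by move=> x _; rewrite /= lee_fin normrM ler_piMl.
have i2 : leb.-integrable setT (EFin \o (fun x => p x + g x * p x)) by exact: (integrableD _ ip igp).
have := ge0_integral_density mg1 g0.
rewrite (EFin_Rintegral (integrableD measurableT i1 igY)).
rewrite (RintegralD measurableT i1 igY).
have -> : \int[P]_w (1 : R) = 1 by rewrite /Rintegral integral_prob_cst.
have -> : (\int[leb]_x ((1 + g x) * p x)%:E = \int[leb]_x (p x + g x * p x)%:E)%E.
  by apply: eq_integral => x _; rewrite mulrDl mul1r.
rewrite (EFin_Rintegral i2) (RintegralD measurableT ip igp).
have -> : \int[leb]_x p x = 1.
  by rewrite /Rintegral -Yp// preimage_setT [X in fine X]probability_setT.
by move=> -[] /addrI.
Qed.

End density_change.

(** * Lipschitz bounds for the Gaussian *)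

Section lipschitz.
Context {R : realType}.

(** The derivative has modulus |c| exp(-c^2/2), at most 1 because |c| <= 1 + c^2/2 <= exp(c^2/2). *)
Lemma gam_lipschitz (a b : R) : `|gam 1 a - gam 1 b| <= `|a - b|.
Proof.
wlog ab : a b / a < b.
  move=> h; have [/h//|/h|->] := ltgtP a b; last by rewrite subrr normr0.
  by rewrite distrC [leRHS]distrC.
have dg (x : R) : x \in `]a, b[ -> is_derive x 1 (gam 1) (- (1 * x) * gam 1 x).
  by move=> _; exact: is_derive_gam.
have cg : {within `[a, b], continuous (gam 1)}.
  exact/continuous_subspaceT/continuous_gam.
have [c _ E] := MVT ab dg cg.
rewrite distrC E normrM distrC ler_piMl// mul1r normrM normrN (ger0_norm (gam_ge0 _ _)).
rewrite /gam mul1r expRN ler_pdivrMr ?expR_gt0// mul1r.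
apply: le_trans (expR_ge1Dx _); rewrite -[c ^+ 2]real_normK ?num_real//.
by have := sqr_ge0 (`|c| - 1); lra.
Qed.

Lemma prod_lipschitz (I : Type) (r : seq I) (a b : I -> R) :
  (forall i, 0 <= a i <= 1) -> (forall i, 0 <= b i <= 1) ->
  `|\prod_(i <- r) a i - \prod_(i <- r) b i| <= \sum_(i <- r) `|a i - b i|.
Proof.
move=> a01 b01; elim: r => [|i r IH]; first by rewrite !big_nil subrr normr0.
rewrite !big_cons.
set A := \prod_(j <- r) a j; set B := \prod_(j <- r) b j.
have -> : a i * A - b i * B = (a i - b i) * A + b i * (A - B) by ring.
have A01 : 0 <= A <= 1.
  rewrite prodr_ge0/=; last by move=> j _; have /andP[] := a01 j.
  by rewrite -[leRHS](@big1_eq R 1 *%R _ r xpredT) ler_prod.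
have /andP[A0 A1] := A01; have /andP[b0 b1] := b01 i.
rewrite (le_trans (ler_normD _ _))// !normrM (ger0_norm A0) (ger0_norm b0) lerD//.
  by rewrite ler_piMr.
by rewrite (le_trans _ IH)// ler_piMl.
Qed.

Lemma Gam_lipschitz n (x y : 'rV[R]_n) : `|Gam 1 x - Gam 1 y| <= \sum_j `|x 0 j - y 0 j|.
Proof.
rewrite !Gam_prod (le_trans (prod_lipschitz _ _ _))//.
- by move=> i; rewrite gam_ge0/= gam_le1.
- by move=> i; rewrite gam_ge0/= gam_le1.
by apply: ler_sum => j _; exact: gam_lipschitz.
Qed.

End lipschitz.

(** * Pairing with an L^2 function *)

Section L2_pairing.
Context d (T : measurableType d) {R : realType} (mu : {measure set T -> \bar R}).

Lemma Lnorm2E (f : T -> R) :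
  ('N[mu]_2%:E[(fun x => (f x)%:E)] = (\int[mu]_x (f x ^+ 2)%:E) `^ 2^-1)%E.
Proof.
rewrite unlock; congr (_ `^ _)%E; apply: eq_integral => x _.
by rewrite /= powR_mulrn// real_normK ?num_real.
Qed.

(** Cauchy-Schwarz with a majorant [h] of [g], so that one norm serves all the oscillating test
    functions at once. *)
Lemma pairing_le (f g h : T -> R) : measurable_fun setT f -> measurable_fun setT g ->
  measurable_fun setT h -> (forall x, `|g x| <= h x) ->
  (\int[mu]_x `|g x * f x|%:E <=
   'N[mu]_2%:E[(fun x => (f x)%:E)] * 'N[mu]_2%:E[(fun x => (h x)%:E)])%E.
Proof.
move=> mf mg mh gh.
have h2 : (2^-1 + 2^-1 = 1 :> R)%R by rewrite -div1r -mulrDl divff.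
apply: le_trans (hoelder mu mf mh (ltr0Sn R 1) (ltr0Sn R 1) h2).
rewrite Lnorm1; apply: ge0_le_integral => //.
- apply/measurable_EFinP; apply: measurableT_comp => //; exact: measurable_funM.
- apply: measurableT_comp => //; apply/measurable_EFinP; exact: measurable_funM.
move=> x _; rewrite /= lee_fin !normrM mulrC ler_wpM2l//.
by rewrite (le_trans (gh x))// ler_norm.
Qed.

End L2_pairing.

(** * Fourier transform of the Gaussian, signed form *)

Section gauss_fourier.
Context {R : realType} (n : nat).
Local Notation leb := (@leb R n).

(** Subtract the instances (A, B) = (1, 0) and (1, 1) of the nonnegative formula. *)
Lemma Rintegral_Gam_cos (s b : R) (a : 'rV[R]_n) : 0 < s ->
  leb.-integrable setT (EFin \o (fun t => cos (b + dotp a t) * Gam s t)) /\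
  \int[leb]_t (cos (b + dotp a t) * Gam s t) =
  Num.sqrt (2 * pi / s) ^+ n * (Gam s^-1 a * cos b).
Proof.
move=> s0.
have iG := @integrable_Gam R n s s0.
have mc : measurable_fun setT (fun t : 'rV[R]_n => cos (b + dotp a t)).
  apply: measurableT_comp; first exact: measurable_cos.
  by apply: measurable_funD => //; apply: measurable_dotp.
have ic : leb.-integrable setT (EFin \o (fun t => cos (b + dotp a t) * Gam s t)).
  apply: (le_integrable _ _ _ iG) => //.
    by apply/measurable_EFinP; apply: measurable_funM => //; exact: measurable_Gam.
  move=> t _; rewrite /= lee_fin normrM ler_piMl//.
  by rewrite ler_norml cos_geN1 cos_le1.
split => //.
have B1 : `|1 : R| <= 1 by rewrite normr1.
have B0 : `|0 : R| <= 1 by rewrite normr0 ler01.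
have E1 := integral_Gam_cos b a s0 B1.
have E0 := integral_Gam_cos b a s0 B0.
have : (\int[leb]_t (Gam s t + cos (b + dotp a t) * Gam s t)%:E =
    (Num.sqrt (2 * pi / s) ^+ n * (1 + 1 * Gam s^-1 a * cos b))%:E)%E.
  by rewrite -E1; apply: eq_integral => t _; congr (_%:E); rewrite mulrDl !mul1r.
rewrite (EFin_Rintegral (integrableD measurableT iG ic)) (RintegralD measurableT iG ic).
have -> : \int[leb]_t Gam s t = Num.sqrt (2 * pi / s) ^+ n.
  have /(congr1 fine) /= := E0; rewrite !mul0r addr0 mulr1 => <-.
  by rewrite /Rintegral; congr fine; apply: eq_integral => t _; rewrite mul0r addr0 mul1r.
set c := _ ^+ _; rewrite (mulrDr c) mulr1.
by move: (Gam _ _) => g; rewrite mul1r => -[] /addrI.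
Qed.

End gauss_fourier.

(** * Cosine at shifts by integer multiples of pi *)

Section parity.
Context {R : realType}.

Lemma cos_pi_int (a : R) (z : int) : cos (a + pi * z%:~R) = (-1) ^+ `|z|%N * cos a.
Proof.
have nat_case (b : R) (m : nat) : cos (b + pi * m%:R) = (-1) ^+ m * cos b.
  elim: m => [|m IH]; first by rewrite mulr0 addr0 expr0 mul1r.
  by rewrite -natr1 mulrDr mulr1 addrA cosDpi IH exprS mulN1r mulNr.
case: z => m; first exact: nat_case.
rewrite NegzE mulrNz mulrN /= -[in RHS](subrK (pi * m.+1%:R) a) nat_case.
by rewrite mulrA -expr2 sqrr_sign mul1r.
Qed.

Lemma cos_pi_sum (I : Type) (r : seq I) (z : I -> int) (a : R) :
  cos (a + \sum_(i <- r) pi * (z i)%:~R) = \prod_(i <- r) (-1) ^+ `|z i|%N * cos a.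
Proof.
elim: r => [|i r IH]; first by rewrite !big_nil addr0 mul1r.
by rewrite !big_cons addrCA addrC cos_pi_int IH mulrA.
Qed.

End parity.

Lemma cvg_sqrt_nat_inv {R : realType} : ((Num.sqrt n%:R)^-1 : R) @[n --> \oo] --> (0 : R).
Proof.
apply/gtr0_cvgV0.
  by near=> n; rewrite sqrtr_gt0 ltr0n; near: n; exists 1%N.
apply/cvgryPge => A; near=> n.
rewrite (le_trans (ler_norm A))// -sqrtr_sqr ler_wsqrtr//.
near: n; exact: nbhs_infty_ger.
Unshelve. all: by end_near. Qed.

(** * Necessity: f vanishes at the nonzero lattice points *)

Section necessity.
Context d0 (T : measurableType d0) {R : realType} (P : probability T R) (d : nat).
Local Notation leb := (@leb R d).
Variables (X : T -> 'rV[R]_d) (Xs : nat -> T -> 'rV[R]_d).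
Hypothesis mX : measurable_fun setT X.
Hypothesis mXs : forall k, measurable_fun setT (Xs k).
Hypothesis Xs_indep : independent_seq P Xs.
Hypothesis Xs_unif : forall k, uniform_on_cube P (Xs k).
Hypothesis X_indep : independent_of_seq P X Xs.
Variable p : nat -> 'rV[R]_d -> R.
Let Z := normalized_sum X Xs.
Hypothesis Zp : forall n, (0 < n)%N -> is_density P (Z n) (p n).
Hypothesis pL2 : ('N[lebesgue_rV R d]_2%:E[(fun x => (p n x - std_normal_density x)%:E)])%E
      @[n --> \oo] --> 0%E.

(** The test function: a wave of phase [b] and frequency [a] under a Gaussian envelope that puts it
    in L^2. *)
Definition gwave (b : R) (a x : 'rV[R]_d) := cos (b + dotp a x) * Gam 1 x.

Lemma measurable_gwave b a : measurable_fun setT (gwave b a).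
Proof.
apply: measurable_funM; last exact: measurable_Gam.
apply: measurableT_comp; first exact: measurable_cos.
by apply: measurable_funD => //; apply: measurable_dotp.
Qed.

Lemma gwave_le b a x : `|gwave b a x| <= Gam 1 x.
Proof.
rewrite normrM (ger0_norm (Gam_ge0 _ _)) ler_piMl ?Gam_ge0//.
by rewrite ler_norml cos_geN1 cos_le1.
Qed.

Lemma gwave_le1 b a x : `|gwave b a x| <= 1.
Proof. by rewrite (le_trans (gwave_le _ _ _))// Gam_le1. Qed.

(** The mean 2^(-d/2) of the envelope under the standard normal law; only its positivity matters. *)
Definition gmass : R := (Num.sqrt (2 * pi * 1))^-1 ^+ d * Num.sqrt (2 * pi / 2) ^+ d.

Lemma gmass_gt0 : 0 < gmass.
Proof.
by rewrite mulr_gt0// exprn_gt0// ?invr_gt0 sqrtr_gt0 ?mulr1 ?divr_gt0// mulr_gt0 ?pi_gt0.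
Qed.

Lemma integral_gwave_hk b a :
  leb.-integrable setT (EFin \o (fun x => gwave b a x * hk 1 x)) /\
  \int[leb]_x (gwave b a x * hk 1 x) = gmass * (Gam 2^-1 a * cos b).
Proof.
have [i1 E1] := @Rintegral_Gam_cos R d 2 b a (ltr0Sn _ _).
have E x : gwave b a x * hk 1 x =
    (Num.sqrt (2 * pi * 1))^-1 ^+ d * (cos (b + dotp a x) * Gam 2 x).
  rewrite /gwave /hk invr1 mulrCA -!mulrA; congr (_ * (_ * _)).
  by rewrite -GamD.
have -> : (fun x => gwave b a x * hk 1 x) = (fun x =>
    (Num.sqrt (2 * pi * 1))^-1 ^+ d * (cos (b + dotp a x) * Gam 2 x)) by apply/funext.
split; first exact: (integrableZl measurableT _ i1).
rewrite (RintegralZl _ measurableT i1) E1; exact: mulrA.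
Qed.

(** The pairing is at most the L^2 distance times the norm of the envelope. The frequency does not
    enter this bound and may therefore vary with n. *)
Lemma test_cvg (b : R) (a : nat -> 'rV[R]_d) :
  (\int[P]_w gwave b (a n) (Z n w) - gmass * (Gam 2^-1 (a n) * cos b)) @[n --> \oo] --> (0 : R).
Proof.
pose F n x := p n x - hk 1 x.
pose N n := ('N[leb]_2%:E[(fun x => (F n x)%:E)])%E.
have N0 : N n @[n --> \oo] --> 0%E.
  rewrite (_ : N = (fun n => 'N[lebesgue_rV R d]_2%:E[(fun x => (p n x - std_normal_density x)%:E)])%E)//.
  apply/funext => n; rewrite /N lebE; congr ('N[_]__[_])%E; apply/funext => x.
  by rewrite std_normal_densityE.
pose c := ('N[leb]_2%:E[(fun x => (Gam 1 x)%:E)])%E.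
have cfin : c \is a fin_num.
  rewrite /c Lnorm2E (_ : (\int[leb]_x _)%E = ((2 * pi) ^+ d * hk 2 (0 : 'rV[R]_d))%:E) //.
  rewrite -integral_Gam//; apply: eq_integral => x _.
  by congr (_%:E); rewrite expr2 -GamD.
have cE : c = (fine c)%:E by rewrite fineK.
have bnd n : (0 < n)%N -> (`|\int[P]_w gwave b (a n) (Z n w) - gmass * (Gam 2^-1 (a n) * cos b)|%:E <= N n * c)%E.
  move=> n0; have [mp p0 Ep] := Zp n0.
  have mg := measurable_gwave b (a n).
  have mZ : measurable_fun setT (Z n) by apply: measurable_normalized_sum.
  have ip : leb.-integrable setT (EFin \o p n) by exact: (integrable_density mp p0 Ep).
  rewrite (Rintegral_density mZ mp p0 Ep mg (gwave_le1 b (a n))).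
  have [ih <-] := integral_gwave_hk b (a n).
  have igp : leb.-integrable setT (EFin \o (fun x => gwave b (a n) x * p n x)).
    rewrite (_ : (fun x => _) = (fun x => p n x * gwave b (a n) x)); last by apply/funext => x; rewrite mulrC.
    by apply: integrable_bounded_mul => // x; exact: gwave_le1.
  rewrite -(RintegralB measurableT igp ih).
  apply: (@le_trans _ _ (\int[leb]_x `|gwave b (a n) x * F n x|%:E)%E); last first.
    apply: pairing_le => //; last by move=> x; exact: gwave_le.
      by apply: measurable_funB => //; exact: measurable_hk.
    exact: measurable_Gam.
  have iB := integrableB measurableT igp ih.
  rewrite (_ : (\int[leb]_x _)%E = (\int[leb]_x `|(gwave b (a n) x * p n x - gwave b (a n) x * hk 1 x)%:E|)%E).
    rewrite -abse_EFin -(EFin_Rintegral iB).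
    apply: le_abse_integral => //.
    by have /integrableP[] := iB.
  by apply: eq_integral => x _; rewrite /F mulrBr.
have Nc : (N n * c)%E @[n --> \oo] --> 0%E.
  rewrite cE -[X in _ --> X](mul0e (fine c)%:E).
  by apply: cvgeZr.
apply/cvgrPdist_le => e e0.
have := Nc; move=> /fine_cvgP[Nf /cvgrPdist_le/(_ e e0)] H.
near=> n.
rewrite sub0r normrN.
rewrite -lee_fin (le_trans (bnd n _))//; first by near: n; exists 1%N.
have Nfn : (N n * c)%E \is a fin_num by near: n.
rewrite -(fineK Nfn) lee_fin.
have : `|0 - fine (N n * c)%E| <= e by near: n.
by rewrite sub0r normrN; apply: le_trans; exact: ler_norm.
Unshelve. all: by end_near. Qed.

Let W n w := (Num.sqrt n%:R)^-1 *: \sum_(k < n) Xs k w.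

Lemma measurable_walk_sum n : measurable_fun setT (W n).
Proof.
apply: measurable_rVZ; first exact: measurable_cst.
apply: measurable_fun_rV => i.
rewrite (_ : (fun x => _) = (fun w => \sum_(k < n) Xs k w 0 i)).
  by apply: measurable_sum => k; apply: (measurableT_comp (measurable_coord i)).
by apply/funext => w; rewrite summxE.
Qed.

(** Z n and W n differ by X / sqrt n, which tends to 0 pointwise; the envelope is Lipschitz and
    bounded. *)
Lemma Gam_normalized_sum_cvg :
  \int[P]_w `|Gam 1 (Z n w) - Gam 1 (W n w)| @[n --> \oo] --> (0 : R).
Proof.
have mZ n : measurable_fun setT (Z n) by apply: measurable_normalized_sum.
apply: (@cvg_to_eq R _ (\int[P]_w (0 : R))).
  by rewrite /Rintegral; under eq_integral do rewrite /=; rewrite integral0.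
apply: (@Rintegral_dominated_cvg _ _ R P _ _ (fun=> 1)).
- move=> n; apply: measurableT_comp => //; apply: measurable_funB.
    exact: (measurableT_comp (@measurable_Gam R d 1) (mZ n)).
  exact: (measurableT_comp (@measurable_Gam R d 1) (measurable_walk_sum n)).
- move=> w; apply: (@squeeze_cvgr _ _ _ _ (fun=> 0) (fun n => (Num.sqrt n%:R)^-1 * \sum_j `|X w 0 j|)).
  + near=> n; rewrite normr_ge0/= (le_trans (Gam_lipschitz _ _))// mulr_sumr.
    apply: ler_sum => j _; rewrite /Z /normalized_sum /W scalerDr !mxE addrK normrM.
    by rewrite ger0_norm// invr_ge0 sqrtr_ge0.
  + exact: cvg_cst.
  + rewrite -[X in _ --> X](mul0r (\sum_j `|X w 0 j|)).
    by apply: cvgM; [exact: cvg_sqrt_nat_inv|exact: cvg_cst].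
- by apply: (@integrable_bounded _ _ _ _ _ 1) => /= [|w]; [exact: measurable_cst|rewrite normr1].
- move=> n w; rewrite normr_id ler_distl.
  have h1 := Gam_le1 (Z n w) (@ler01 R); have h2 := Gam_le1 (W n w) (@ler01 R).
  have h3 := Gam_ge0 1 (Z n w); have h4 := Gam_ge0 1 (W n w).
  by rewrite lerBlDr (le_trans h2) ?lerDr// (le_trans h1)// lerDr.
Unshelve. all: by end_near. Qed.

Variable k : 'rV[int]_d.
Hypothesis k0 : k != 0.
Local Notation v := (pi_lattice R k).

(** Each coordinate of each step adds k_j or -k_j times pi, and these have the same parity. The
    resulting sign thus does not depend on the walk. *)
Lemma cos_pi_walk n (c : R) (e : word d n) : cos (c + dotp v (walk e)) =
  \prod_(i : 'I_n * 'I_d) (-1) ^+ `|k 0%R i.2|%N * cos c.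
Proof.
have -> : dotp v (walk e) =
    \sum_(i : 'I_n * 'I_d) pi * (k 0 i.2 * (-1) ^+ e i.1 i.2)%:~R :> R.
  rewrite /walk dotp_sumr -(pair_bigA _ (fun i j => pi * (k 0 j * (-1) ^+ e i j)%:~R))/=.
  apply: eq_bigr => i _; apply: eq_bigr => j _.
  by rewrite !mxE intrM mulrA rmorphXn/= rmorphN1.
rewrite cos_pi_sum; congr (_ * _); apply: eq_bigr => i _.
by rewrite abszM abszX/= exp1n muln1.
Qed.

Lemma norm_prod_sign n : `|\prod_(i : 'I_n * 'I_d) (-1) ^+ `|k 0%R i.2|%N| = 1 :> R.
Proof.
by rewrite normr_prod big1// => i _; rewrite normrX normrN1 expr1n.
Qed.

Lemma measurable_wave (c : R) : measurable_fun setT (fun x : 'rV[R]_d => cos (c + dotp v x)).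
Proof.
apply: measurableT_comp; first exact: measurable_cos.
by apply: measurable_funD => //; apply: measurable_dotp.
Qed.

(** At frequency sqrt n v the normalisation cancels and the argument of the cosine is c + <v, X> +
    <v, S_n>; the last term only contributes the deterministic sign. *)
Lemma integral_gwave_sum n (c : R) : (0 < n)%N ->
  \int[P]_w gwave c (Num.sqrt n%:R *: v) (Z n w) =
  \prod_(i : 'I_n * 'I_d) (-1) ^+ `|k 0%R i.2|%N *
  \int[P]_w (cos (c + dotp v (X w)) * Gam 1 (Z n w)).
Proof.
move=> n0; set s := \prod_i _.
have s1 : `|s| = 1 := norm_prod_sign n.
pose h x y : R := Gam 1 ((Num.sqrt n%:R)^-1 *: (x + y : 'rV[R]_d)).
pose G x y := cos (c + dotp v x + dotp v y) * h x y.
pose G' x y := s * (cos (c + dotp v x) * h x y).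
have mh : measurable_fun setT (fun z => h z.1 z.2).
  apply: (measurableT_comp (@measurable_Gam R d 1)).
  by apply: measurable_rVZ; [exact: measurable_cst|apply: measurable_rVD].
have h01 x y : `|h x y| <= 1 by rewrite ger0_norm ?Gam_ge0// Gam_le1.
have mG : measurable_fun setT (fun z => G z.1 z.2).
  apply: measurable_funM => //; apply: measurableT_comp; first exact: measurable_cos.
  apply: measurable_funD; last by apply: measurable_dotp.
  by apply: measurable_funD => //; apply: measurable_dotp.
have mG' : measurable_fun setT (fun z => G' z.1 z.2).
  apply: measurable_funM => //; apply: measurable_funM => //.
  by apply: (measurableT_comp (measurable_wave c)).
have cos1 (x : R) : `|cos x| <= 1 by rewrite ler_norml cos_geN1 cos_le1.
have G1 x y : `|G x y| <= 1 by rewrite normrM mulr_ile1.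
have G'1 x y : `|G' x y| <= 1 by rewrite !normrM s1 mul1r mulr_ile1.
transitivity (\int[P]_w G (X w) (\sum_(k < n) Xs k w)).
  apply: eq_Rintegral => w _; rewrite /gwave /G /h /Z /normalized_sum.
  rewrite dotpZl dotpZr mulrA divff ?mul1r ?dotpDr ?addrA//.
  by rewrite gt_eqF// sqrtr_gt0 ltr0n.
rewrite (@Rintegral_walk _ _ _ P d X Xs mX mXs Xs_indep Xs_unif X_indep n G mG G1).
transitivity (\int[P]_w G' (X w) (\sum_(k < n) Xs k w)).
  rewrite (@Rintegral_walk _ _ _ P d X Xs mX mXs Xs_indep Xs_unif X_indep n G' mG' G'1).
  congr (_ * _); apply: eq_bigr => e _; apply: eq_Rintegral => w _.
  by rewrite /G /G' cos_pi_walk mulrA.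
rewrite /G' RintegralZl//.
apply: (@integrable_bounded _ _ _ _ _ 1) => [|w].
  apply: measurable_funM; first exact: (measurableT_comp (measurable_wave c) mX).
  apply: (measurableT_comp (@measurable_Gam R d 1)).
  exact: (@measurable_normalized_sum _ _ R d X Xs mX mXs n).
by rewrite normrM mulr_ile1.
Qed.

Lemma integral_wave_indep n (c : R) :
  \int[P]_w (cos (c + dotp v (X w)) * Gam 1 (W n w)) =
  \int[P]_w cos (c + dotp v (X w)) * \int[P]_w Gam 1 (W n w).
Proof.
pose h y : R := Gam 1 ((Num.sqrt n%:R)^-1 *: (y : 'rV[R]_d)).
have mh : measurable_fun setT h.
  apply: (measurableT_comp (@measurable_Gam R d 1)).
  by apply: measurable_rVZ; [exact: measurable_cst|exact: measurable_id].
have h01 y : `|h y| <= 1 by rewrite ger0_norm ?Gam_ge0// Gam_le1.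
have cos1 (x : R) : `|cos x| <= 1 by rewrite ler_norml cos_geN1 cos_le1.
have mc : measurable_fun setT (fun w => cos (c + dotp v (X w))).
  exact: (measurableT_comp (measurable_wave c) mX).
have RW := @Rintegral_walk _ _ _ P d X Xs mX mXs Xs_indep Xs_unif X_indep n.
rewrite (RW (fun x y => cos (c + dotp v x) * h y)); last 2 first.
- apply: measurable_funM; last exact: (measurableT_comp mh).
  exact: (measurableT_comp (measurable_wave c)).
- by move=> x y; rewrite normrM mulr_ile1.
rewrite (RW (fun x y => h y)) //; last exact: (measurableT_comp mh).
rewrite mulrCA; congr (_ * _); rewrite mulr_sumr; apply: eq_bigr => e _.
rewrite RintegralZr//; last exact: (@integrable_bounded _ _ _ _ _ 1).
by congr (_ * _); rewrite /Rintegral integral_prob_cst.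
Qed.

Lemma cvg_Gam_pi_lattice : Gam 2^-1 (Num.sqrt n%:R *: v) @[n --> \oo] --> (0 : R).
Proof.
have v0 : 0 < dotp v v.
  have [j kj] : exists j, k 0 j != 0.
    apply/existsP; apply: contraNT k0 => /existsPn h; apply/eqP/rowP => j.
    by rewrite mxE; have := h j; rewrite negbK => /eqP.
  rewrite /dotp (bigD1 j)//= ltr_pwDl//.
    rewrite -expr2 exprn_even_gt0//= !mxE mulf_neq0 ?intr_eq0// gt_eqF//; exact: pi_gt0.
  by apply: sumr_ge0 => i _; rewrite -expr2 sqr_ge0.
pose q : R := expR (- (2^-1 * dotp v v / 2)).
have -> : (fun n => Gam 2^-1 (Num.sqrt n%:R *: v)) = (fun n => q ^+ n).
  apply/funext => n; rewrite GamZ sqr_sqrtr// /Gam /q -expRM_natl; congr expR.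
  by move: (dotp v v) => D; rewrite mulrN -!mulrA.
apply: cvg_expr; rewrite ger0_norm ?expR_ge0// /q expR_lt1 oppr_lt0.
by rewrite divr_gt0// mulr_gt0.
Qed.

(** Call the integral E. The test at frequency sqrt n v gives A n -> 0, the test at frequency 0
    gives h n -> gmass, and E h n - A n -> 0 because X is asymptotically independent of Z n. Hence E
    gmass = 0. *)
Lemma Rintegral_wave_eq0 (c : R) : \int[P]_w cos (c + dotp v (X w)) = 0.
Proof.
have mZ n : measurable_fun setT (Z n) by apply: measurable_normalized_sum.
have cos1 (x : R) : `|cos x| <= 1 by rewrite ler_norml cos_geN1 cos_le1.
set E := \int[P]_w _.
pose r n := \int[P]_w `|Gam 1 (Z n w) - Gam 1 (W n w)|.
have r0 : r n @[n --> \oo] --> (0 : R) := Gam_normalized_sum_cvg.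
pose h n := \int[P]_w Gam 1 (Z n w).
have hm : h n @[n --> \oo] --> gmass.
  apply: (@cvg_to_eq R h (0 + gmass)); first by rewrite add0r.
  have -> : h = (fun n => (\int[P]_w gwave 0 0 (Z n w) - gmass * (Gam 2^-1 (0 : 'rV[R]_d) * cos 0)) + gmass).
    apply/funext => n; rewrite Gam0 cos0 !mulr1 subrK.
    by apply: eq_Rintegral => w _; rewrite /gwave dotp0l addr0 cos0 mul1r.
  by apply: cvgD; [exact: test_cvg|exact: cvg_cst].
pose A n := \int[P]_w (cos (c + dotp v (X w)) * Gam 1 (Z n w)).
have A0 : A n @[n --> \oo] --> (0 : R).
  have B0 : \int[P]_w gwave c (Num.sqrt n%:R *: v) (Z n w) @[n --> \oo] --> (0 : R).
    apply: (@cvg_to_eq R _ (0 + gmass * (0 * cos c))); first by rewrite mul0r mulr0 addr0.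
    have -> : (fun n => \int[P]_w gwave c (Num.sqrt n%:R *: v) (Z n w)) = (fun n =>
        (\int[P]_w gwave c (Num.sqrt n%:R *: v) (Z n w) - gmass * (Gam 2^-1 (Num.sqrt n%:R *: v) * cos c))
        + gmass * (Gam 2^-1 (Num.sqrt n%:R *: v) * cos c)) by apply/funext => n; rewrite subrK.
    apply: cvgD; first exact: (test_cvg c (fun n => Num.sqrt n%:R *: v)).
    apply: cvgM; first exact: cvg_cst.
    by apply: cvgM; [exact: cvg_Gam_pi_lattice|exact: cvg_cst].
  apply/cvgrPdist_le => e e0; have /cvgrPdist_le/(_ e e0) H := B0; near=> n.
  have n0 : (0 < n)%N by near: n; exists 1%N.
  have : `|0 - \int[P]_w gwave c (Num.sqrt n%:R *: v) (Z n w)| <= e by near: n.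
  by rewrite !sub0r !normrN (integral_gwave_sum c n0) normrM norm_prod_sign mul1r.
(* Replacing Z by W costs at most [r n] in each of the two expectations, and with W the expectation
   in [A] factorises. *)
have Eh n : `|E * h n - A n| <= r n + r n.
  have mG U : measurable_fun setT U -> measurable_fun setT (fun w : T => Gam 1 (U w : 'rV[R]_d)).
    exact: (measurableT_comp (@measurable_Gam R d 1)).
  have iG (f : T -> R) U : measurable_fun setT U -> measurable_fun setT f -> (forall w, `|f w| <= 1) ->
      P.-integrable setT (EFin \o (fun w => f w * Gam 1 (U w : 'rV[R]_d))).
    move=> mU mf f1; apply: (@integrable_bounded _ _ _ _ _ 1) => [|w].
      by apply: measurable_funM => //; exact: mG.
    by rewrite normrM mulr_ile1// ger0_norm ?Gam_ge0// Gam_le1.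
  have key (f : T -> R) : measurable_fun setT f -> (forall w, `|f w| <= 1) ->
      `|\int[P]_w (f w * Gam 1 (Z n w)) - \int[P]_w (f w * Gam 1 (W n w))| <= r n.
    move=> mf f1; have i1 := iG f _ (mZ n) mf f1; have i2 := iG f _ (measurable_walk_sum n) mf f1.
    rewrite -(RintegralB measurableT i1 i2).
    have iB := integrableB measurableT i1 i2.
    rewrite (le_trans (le_normr_Rintegral measurableT iB))//.
    have mD : measurable_fun setT (fun w => Gam 1 (Z n w) - Gam 1 (W n w)).
      by apply: measurable_funB; apply: mG => //; exact: measurable_walk_sum.
    have D1 w : `|Gam 1 (Z n w) - Gam 1 (W n w)| <= 2.
      by rewrite (le_trans (ler_normB _ _))// !ger0_norm ?Gam_ge0// lerD ?Gam_le1.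
    apply: le_Rintegral => //.
    - exact: (integrable_norm iB).
    - apply: (@integrable_bounded _ _ _ _ _ 2) => [|w]; first exact: measurableT_comp.
      by rewrite normr_id.
    - by move=> w _ /=; rewrite -mulrBr normrM ler_piMl.
  have mc : measurable_fun setT (fun w => cos (c + dotp v (X w))).
    exact: (measurableT_comp (measurable_wave c) mX).
  have k1 := key _ mc (fun w => cos1 _).
  have k2 : `|h n - \int[P]_w Gam 1 (W n w)| <= r n.
    have := key (fun=> 1) (measurable_cst _) (fun w => ltac:(by rewrite normr1)).
    congr (`|_ - _| <= _); by apply: eq_Rintegral => w _; rewrite mul1r.
  move: k1 k2; rewrite integral_wave_indep -/E -/(A n).
  have E1 : `|E| <= 1 by apply: Rintegral_prob_norm_le.
  move: E1; move: (\int[P]_w Gam 1 (W n w)) (r n) (h n) (A n) E => g r' h' A' E' E1 k1 k2.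
  have -> : E' * h' - A' = E' * (h' - g) - (A' - E' * g) by ring.
  rewrite (le_trans (ler_normB _ _))// lerD// normrM.
  by rewrite (le_trans _ k2)// ler_piMl.
suff : E * gmass = 0.
  by move/eqP; rewrite mulf_eq0 (gt_eqF gmass_gt0) orbF => /eqP.
apply: (@cvg_unique _ (@Rhausdorff R) ((E * h n) @[n --> \oo]) _).
  by apply: cvgM => //; exact: cvg_cst.
have -> : (fun n => E * h n) = (fun n => (E * h n - A n) + A n).
  by apply/funext => n; rewrite subrK.
apply: (@cvg_to_eq R _ (0 + 0)); first by rewrite addr0.
apply: cvgD => //; apply: (@squeeze_cvgr _ _ _ _ (fun n => - (r n + r n)) (fun n => r n + r n)).
- by near=> n; rewrite -ler_norml.
- by apply: (@cvg_to_eq R _ (- (0 + 0))); [rewrite addr0 oppr0|apply: cvgN; exact: cvgD].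
- by apply: (@cvg_to_eq R _ (0 + 0)); [rewrite addr0|exact: cvgD].
Unshelve. all: by end_near. Qed.

Lemma charfun_pi_lattice_eq0 : charfun P X v = 0.
Proof.
rewrite /charfun.
have := Rintegral_wave_eq0 0; under eq_Rintegral do rewrite add0r; move=> ->.
(* The phase -pi/2 turns the cosine into the sine of the imaginary part. *)
have := Rintegral_wave_eq0 (- (pi / 2)).
by under eq_Rintegral do rewrite -sinE_cos; move=> ->.
Qed.

End necessity.

(** * Elementary inequalities for cosine, exponential and arctangent *)

Section real_bounds.
Context {R : realType}.
Notation mu := (@lebesgue_measure R).

Lemma derive_ge0_le (k k' : R -> R) (a b : R) : a <= b ->
  (forall x : R, is_derive x 1 k (k' x)) -> (forall x, a <= x <= b -> 0 <= k' x) ->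
  k a <= k b.
Proof.
move=> ab dk k0; rewrite -subr_ge0.
have ck : {within `[a, b], continuous k}.
  by apply: derivable_within_continuous => z _; by case: (dk z).
have [c cab ->] := MVT_segment ab (fun x _ => dk x) ck.
by rewrite mulr_ge0 ?subr_ge0// k0//; move: cab; rewrite in_itv.
Qed.

Lemma sin_ge_mulcos (x : R) : 0 <= x <= pi / 2 -> x * cos x <= sin x.
Proof.
move=> /andP[x0 xpi]; rewrite -subr_ge0.
rewrite [leLHS](_ : 0 = (fun x => sin x - x * cos x) 0); last by rewrite /= sin0 mul0r subrr.
apply: (@derive_ge0_le (fun x => sin x - x * cos x) (fun x => x * sin x)) => //.
  by move=> y; apply: is_derive_eq; rewrite /GRing.scale/=; ring.
move=> y /andP[y0 yx]; rewrite mulr_ge0// sin_ge0_pi// y0/= (le_trans yx)// (le_trans xpi)//.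
by rewrite ler_pdivrMr// ler_peMr ?pi_ge0// ler1n.
Qed.

(** The function 1 - cos y exp(y^2/2) vanishes at 0 and has derivative (sin y - y cos y) exp(y^2/2),
    nonnegative on [0, pi/2]. *)
Lemma cos_le_gam (x : R) : - (pi / 2) <= x <= pi / 2 -> 0 <= cos x <= gam 1 x.
Proof.
move=> xpi; rewrite cos_ge0_pihalf//=.
wlog x0 : x xpi / 0 <= x.
  move=> h; have [/h->//|/ltW x0] := leP 0 x.
  rewrite -cosN /gam -sqrrN; apply: h; last by rewrite oppr_ge0.
  by rewrite lerN2 lerNl andbC.
rewrite /gam mul1r expRN -div1r ler_pdivlMr ?expR_gt0//.
rewrite -subr_ge0.
pose k (y : R) := 1 - cos y * expR (y ^+ 2 / 2).
have -> : 1 - cos x * expR (x ^+ 2 / 2) = k x by [].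
have -> : 0 = k 0 by rewrite /k cos0 expr0n/= mul0r expR0 mulr1 subrr.
apply: (@derive_ge0_le k (fun y => (sin y - y * cos y) * expR (y ^+ 2 / 2))) => //.
  move=> y; apply: is_derive_eq; rewrite /GRing.scale/=.
  by field.
move=> y /andP[y0 yx]; rewrite mulr_ge0 ?expR_ge0// subr_ge0 sin_ge_mulcos// y0/=.
by have /andP[_] := xpi; exact: le_trans.
Qed.

Lemma cos_ge_quadratic (x : R) : 1 - x ^+ 2 / 2 <= cos x.
Proof.
wlog x0 : x / 0 <= x.
  move=> h; have [/h//|/ltW x0] := leP 0 x.
  by rewrite -cosN -sqrrN; apply: h; rewrite oppr_ge0.
rewrite -subr_ge0.
pose k (y : R) := cos y - (1 - y ^+ 2 / 2).
have -> : cos x - (1 - x ^+ 2 / 2) = k x by [].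
have -> : 0 = k 0 by rewrite /k cos0 expr0n/= mul0r subr0 subrr.
apply: (@derive_ge0_le k (fun y => y - sin y)) => //.
  by move=> y; apply: is_derive_eq; rewrite /GRing.scale/=; field.
move=> y /andP[y0 _].
pose l (y : R) := y - sin y.
have -> : y - sin y = l y by [].
have -> : 0 = l 0 by rewrite /l sin0 subrr.
by apply: (@derive_ge0_le l (fun z => 1 - cos z)) => // z _; rewrite subr_ge0 cos_le1.
Qed.

Lemma expr_diff_le (a b : R) n : 0 <= b <= a -> a <= 1 ->
  a ^+ n - b ^+ n <= n%:R * (a - b).
Proof.
move=> /andP[b0 ba] a1; elim: n => [|n IH]; first by rewrite !expr0 subrr mul0r.
rewrite !exprS.
have -> : a * a ^+ n - b * b ^+ n = a * (a ^+ n - b ^+ n) + (a - b) * b ^+ n by ring.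
rewrite -natr1 [leRHS]mulrDl mul1r lerD//.
  rewrite (le_trans _ IH)// ler_piMl// subr_ge0 lerXn2r ?nnegrE//.
  exact: le_trans ba.
by rewrite ler_piMr ?subr_ge0// exprn_ile1// (le_trans ba).
Qed.

(** With u = x / sqrt(n+1) the limit is gam 1 u raised to the power n+1. For |u| <= pi/2 one has cos
    u <= gam 1 u <= cos u + u^4/4, so the two powers differ by at most (n+1) u^4/4 = x^4 / (4
    (n+1)). *)
Lemma cvg_cos_gam (x : R) :
  cos ((Num.sqrt n.+1%:R)^-1 * x) ^+ n.+1 @[n --> \oo] --> gam 1 x.
Proof.
pose u n : R := (Num.sqrt n.+1%:R)^-1 * x.
have uE n : n.+1%:R * u n ^+ 2 = x ^+ 2.
  by rewrite /u exprMn exprVn sqr_sqrtr// mulrA divff// mul1r.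
have u0 : u n @[n --> \oo] --> (0 : R).
  rewrite -(mul0r x); apply: cvgM; last exact: cvg_cst.
  by have := @cvg_sqrt_nat_inv R; rewrite -cvg_shiftS.
have gamE n : gam 1 x = gam 1 (u n) ^+ n.+1.
  by rewrite /gam !mul1r -expRM_natl mulrN mulrA uE.
have p2 : 0 < pi / 2 :> R by rewrite divr_gt0 ?pi_gt0.
apply: (@squeeze_cvgr _ _ _ _ (fun n => gam 1 x - x ^+ 4 / 4 * n.+1%:R^-1) (fun=> gam 1 x)).
- near=> n.
  have un : `|u n| <= pi / 2.
    have : `|0 - u n| <= pi / 2 by near: n; exact: (cvgrPdist_le _ _).1 u0 _ p2.
    by rewrite sub0r normrN.
  move: un; rewrite ler_norml => un.
  have /andP[c0 cg] := cos_le_gam un.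
  have h0 := gam_ge0 1 (u n).
  rewrite -/(u n); apply/andP; split; last by rewrite (gamE n) lerXn2r ?nnegrE.
  rewrite lerBlDr -lerBlDl (gamE n) (le_trans (expr_diff_le _ _ _))//.
  + by rewrite c0.
  + by rewrite gam_le1.
  have nE : n.+1%:R * u n ^+ 4 = x ^+ 4 / n.+1%:R.
    rewrite (_ : x ^+ 4 = (x ^+ 2) ^+ 2); last by rewrite -exprM.
    rewrite -(uE n); have := pnatr_eq0 R n.+1; move: (n.+1%:R : R) (u n) => a b a0; field; by rewrite a0.
  have : gam 1 (u n) - cos (u n) <= u n ^+ 4 / 4.
    have := cos_ge_quadratic (u n).
    rewrite /gam mul1r expRN.
    set y := u n ^+ 2 / 2 => cy.
    have y0 : 0 <= y by rewrite divr_ge0// sqr_ge0.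
    have -> : u n ^+ 4 / 4 = y ^+ 2 by rewrite /y; field.
    have e1 := expR_ge1Dx y.
    (* This with cos u >= 1 - y gives the bound y^2 = u^4/4. *)
    have : (expR y)^-1 <= 1 - y + y ^+ 2.
      have y1 : 0 < 1 + y by rewrite ltr_pwDl.
      apply: (@le_trans _ _ (1 + y)^-1); first by rewrite lef_pV2// posrE expR_gt0.
      rewrite -div1r ler_pdivrMr//.
      have -> : (1 - y + y ^+ 2) * (1 + y) = 1 + y ^+ 3 by ring.
      by rewrite lerDl exprn_ge0.
    by clear -cy; move: (expR y)^-1 (cos _) cy => a b; lra.
  move=> h; rewrite (le_trans (ler_wpM2l (ler0n _ n.+1) h))//.
  by rewrite mulrA nE mulrAC.
- apply: (@cvg_to_eq R _ (gam 1 x - x ^+ 4 / 4 * 0)); first by rewrite mulr0 subr0.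
  apply: cvgB; first exact: cvg_cst.
  by apply: cvgM; [exact: cvg_cst|exact: cvg_harmonic].
- exact: cvg_cst.
Unshelve. all: by end_near. Qed.

(** The exponent e+1 is the one for which the radial integral below becomes that of an
    arctangent. *)
Lemma expR_inv_le (e : nat) (y : R) : 0 <= y ->
  expR (- y) <= e.+1`!%:R / (1 + y ^+ e.+1).
Proof.
move=> y0; have f0 : 0 < e.+1`!%:R :> R by rewrite ltr0n fact_gt0.
have f1 : 1 <= e.+1`!%:R :> R by rewrite ler1n fact_gt0.
have p0 : 0 < 1 + y ^+ e.+1 by rewrite ltr_pwDl// exprn_ge0.
rewrite expRN ler_pdivlMr// mulrC ler_pdivrMr ?expR_gt0//.
rewrite (le_trans _ (ler_wpM2l (ltW f0) (expR_ge1Dxn e y0)))//.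
by rewrite mulrDr mulr1 mulrCA divff ?gt_eqF// mulr1 lerD2r.
Qed.

Lemma atan_le (x : R) : 0 <= x -> 0 <= atan x <= x.
Proof.
move=> x0; rewrite -{1}atan0 le_atan//= -subr_ge0.
pose l (y : R) := y - atan y.
have -> : x - atan x = l x by [].
have -> : 0 = l 0 by rewrite /l atan0 subrr.
apply: (@derive_ge0_le l (fun z => 1 - (1 + z ^+ 2)^-1)) => // z _.
by rewrite subr_ge0 invf_le1 ?lerDl ?sqr_ge0// ltr_pwDl ?sqr_ge0.
Qed.

End real_bounds.

(** * The radial integral *)

Section radial.
Context {R : realType}.
Notation mu := (@lebesgue_measure R).

(** Off 0 the inverse is x exp(-ln(x^2)); at 0 both expressions are 0, the inverse of 0 being 0. *)
Lemma measurable_inv : measurable_fun setT (fun x : R => x^-1).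
Proof.
rewrite (_ : (fun x => _) = (fun x : R => x * expR (- ln (x ^+ 2)))).
  apply: measurable_funM => //; apply: measurableT_comp => //.
  apply: measurableT_comp => //; apply: measurableT_comp; first exact: measurable_ln.
  exact: measurable_funX.
apply/funext => x; have [->|x0] := eqVneq x 0; first by rewrite invr0 mul0r.
rewrite expRN lnK ?posrE; last by rewrite exprn_even_gt0.
by rewrite expr2 invfM mulrA divff ?mul1r.
Qed.

(** Put d = e+1 and r^2 = m^d. By [expR_inv_le] at y = m/u^2 the integrand is at most d! u^(d-1) /
    (r^2 + u^(2d)), which is the derivative of d!/(d r) atan(u^d / r). *)
Lemma radial_integral_le (e : nat) (m : R) : 0 < m ->
  (\int[mu]_(u in `]0%R, 1%R]) (u^-1 ^+ e.+2 * expR (- (m / u ^+ 2)))%:E <=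
   (e.+1`!%:R / (e.+1%:R * Num.sqrt (m ^+ e.+1)) * atan (Num.sqrt (m ^+ e.+1))^-1)%:E)%E.
Proof.
move=> m0; have r0 : 0 < Num.sqrt (m ^+ e.+1) by rewrite sqrtr_gt0 exprn_gt0.
have r2 : Num.sqrt (m ^+ e.+1) ^+ 2 = m ^+ e.+1 by rewrite sqr_sqrtr// exprn_ge0 ?ltW.
set r := Num.sqrt _ in r0 r2 *.
pose C : R := e.+1`!%:R.
pose k (u : R) := C / (e.+1%:R * r) * atan (r^-1 * u ^+ e.+1).
pose k' (u : R) := C * u ^+ e * (r ^+ 2 + (u ^+ e.+1) ^+ 2)^-1.
have den u : 0 < r ^+ 2 + (u ^+ e.+1) ^+ 2 by rewrite ltr_pwDl ?sqr_ge0// exprn_gt0.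
have dk (u : R) : is_derive u 1 k (k' u).
  have d1 : is_derive u 1 (fun u : R => r^-1 * u ^+ e.+1) (r^-1 * (e.+1%:R * u ^+ e)).
    have d0 : is_derive u 1 (fun u : R => u ^+ e.+1) (e.+1%:R * u ^+ e).
      have := @is_deriveX R R id e.+1 u 1 1 (is_derive_id u 1).
      rewrite exprfctE/= => h; apply: (is_derive_eq h).
      by rewrite /GRing.scale/= mulr1.
    exact: (is_deriveZ r^-1 d0).
  have d2 := @is_derive1_comp R (@atan R) (fun u : R => r^-1 * u ^+ e.+1) u _ _ (is_derive1_atan (r^-1 * u ^+ e.+1)) d1.
  have : is_derive u 1 k (C / (e.+1%:R * r) * ((1 + (r^-1 * u ^+ e.+1) ^+ 2)^-1 * (r^-1 * (e.+1%:R * u ^+ e)))).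
    exact: (is_deriveZ (C / (e.+1%:R * r)) d2).
  congr (is_derive _ _ _ _); rewrite /k' -/C.
  have := den u; rewrite exprMn.
  have e0 : (e.+1%:R : R) != 0 by rewrite pnatr_eq0.
  have r0' : r != 0 by rewrite gt_eqF.
  move: (u ^+ e) (u ^+ e.+1) (e.+1%:R : R) (r) (C) e0 r0' => a b c r' C' c0 r'0 D0.
  clear -c0 r'0 D0; field; rewrite c0 r'0 /= gt_eqF//.
have ck : continuous k'.
  move=> u; apply: cvgM.
    by apply: cvgM; [exact: cvg_cst|exact: exprn_continuous].
  apply: cvgV; first by rewrite gt_eqF.
  apply: cvgD; first exact: cvg_cst.
  rewrite -exprM; under eq_fun do rewrite -exprM.
  exact: exprn_continuous.
have mk : measurable_fun setT k' by exact: continuous_measurable_fun.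
apply: (@le_trans _ _ (\int[mu]_(u in `]0%R, 1%R]) (k' u)%:E)%E).
  apply: ge0_le_integral => //.
  - move=> u; rewrite /= in_itv/= => /andP[u0 _].
    by rewrite lee_fin mulr_ge0 ?expR_ge0// exprn_ge0// invr_ge0 ltW.
  - apply/measurable_EFinP; apply: measurable_funTS; apply: measurable_funM.
      by apply: measurable_funX; exact: measurable_inv.
    apply: measurableT_comp => //; apply: measurableT_comp => //.
    apply: measurable_funM => //; apply: (measurableT_comp measurable_inv).
    exact: measurable_funX.
  - by apply/measurable_EFinP; exact: measurable_funTS.
  move=> u; rewrite /= in_itv/= => /andP[u0 _]; rewrite lee_fin.
  have u0' : u != 0 by rewrite gt_eqF.
  have y0 : 0 <= m / u ^+ 2 by rewrite divr_ge0 ?exprn_ge0// ltW.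
  apply: (le_trans (ler_wpM2l _ (expR_inv_le e y0))).
    by rewrite exprn_ge0// invr_ge0 ltW.
  have -> : (m / u ^+ 2) ^+ e.+1 = r ^+ 2 * ((u ^+ e.+1) ^+ 2)^-1.
    by rewrite exprMn -r2 exprVn -!exprM mulnC.
  have -> : u^-1 ^+ e.+2 = u ^+ e * ((u ^+ e.+1) ^+ 2)^-1.
    rewrite exprVn -exprM muln2 -addnn addSnnS (exprD u e e.+2) (invfM (u ^+ e) (u ^+ e.+2)) (mulrA (u ^+ e)) divff ?mul1r//.
    by rewrite expf_neq0.
  rewrite /k' -/C.
  have w0 : u ^+ e.+1 != 0 by rewrite expf_neq0.
  have := den u; move: (u ^+ e) (u ^+ e.+1) w0 => a w w0 D0.
  move: (r) (C) D0 => r' C' D0; clear -D0 w0.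
  rewrite le_eqVlt; apply/orP; left; apply/eqP.
  field; rewrite w0 gt_eqF//.
rewrite integral_itv_obnd_cbnd; last by apply/measurable_EFinP; exact: measurable_funTS.
rewrite (FTC2 ltr01 dk ck) lee_fin /k expr0n/= mulr0 atan0 mulr0 subr0 expr1n mulr1.
exact: lexx.
Qed.

End radial.

(** * The lattice pi Z^d, its nearest-point map and its cells *)

Section lattice.
Context {R : realType} {d : nat}.
Implicit Types s t : 'rV[R]_d.

Definition nearest t : 'rV[int]_d := \row_j Num.floor (t 0 j / pi + 2^-1).

(** Half-open, so that the lattice translates of the cell tile the space. *)
Definition hcell : set 'rV[R]_d := [set s | forall j, - (pi / 2) <= s 0 j < pi / 2].

Lemma nearestP t (k : 'rV[int]_d) : nearest t = k <-> hcell (t - pi_lattice R k).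
Proof.
have E j : (- (pi / 2) <= (t - pi_lattice R k) 0 j < pi / 2) = (Num.floor (t 0 j / pi + 2^-1) == k 0 j).
  rewrite floor_eq !mxE intrD; have := pi_gt0 R; move: (pi : R) (t 0 j) ((k 0 j)%:~R : R) => p x m p0.
  have -> : (- (p / 2) <= x - p * m) = (m <= x / p + 2^-1).
    rewrite -(ler_pM2l p0 m) mulrDr [p * (x / p)]mulrCA divff ?gt_eqF// mulr1.
    by apply/idP/idP => h; lra.
  have -> : (x - p * m < p / 2) = (x / p + 2^-1 < m + 1).
    rewrite -(ltr_pM2l p0 _ (m + 1)) !mulrDr [p * (x / p)]mulrCA divff ?gt_eqF// !mulr1.
    by apply/idP/idP => h; lra.
  by [].
split=> [nk j|h]; first by rewrite E -nk mxE.
by apply/rowP => j; apply/eqP; rewrite mxE -E.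
Qed.

Lemma nearest_bound t j : - (pi / 2) <= (t - pi_lattice R (nearest t)) 0 j <= pi / 2.
Proof.
by have /(_ j)/andP[-> /ltW] := (nearestP t (nearest t)).1 erefl.
Qed.

Lemma enorm_ge0 t : 0 <= enorm t. Proof. exact: sqrtr_ge0. Qed.

(** The norm is monotone in the absolute values of the coordinates, so rounding each coordinate
    separately is optimal. *)
Lemma dist_pi_latticeE t : dist_pi_lattice t = enorm (t - pi_lattice R (nearest t)).
Proof.
apply/eqP; rewrite eq_le; apply/andP; split.
  apply: ge_inf; last by exists (nearest t).
  by exists 0 => _ [k _ <-]; exact: enorm_ge0.
apply: lb_le_inf; first by exists (enorm (t - pi_lattice R 0)), 0.
move=> _ [k _ <-]; rewrite /enorm ler_wsqrtr//; apply: ler_sum => j _.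
rewrite -!expr2 -(ger0_norm (sqr_ge0 ((t - pi_lattice R k) 0 j))).
rewrite -[leLHS](ger0_norm (sqr_ge0 _)) !normrX lerXn2r ?nnegrE//.
have := nearest_bound t j; set m := nearest t.
have -> : (t - pi_lattice R k) 0 j = (t - pi_lattice R m) 0 j + pi * (m 0 j - k 0 j)%:~R.
  by rewrite !mxE intrB; ring.
move: (m 0 j - k 0 j) ((t - pi_lattice R m) 0 j) => z s /andP[s1 s2].
have p0 := pi_gt0 R.
have [->|z0] := eqVneq z 0; first by rewrite mulr0 addr0.
have z1 : 1 <= `|z%:~R : R|.
  by rewrite -intr_norm ler1z -gtz0_ge1 normr_gt0.
have s3 : `|s| <= pi / 2 by rewrite ler_norml s1.
(* For z nonzero, |s + pi z| >= pi - |s| >= |s|, as |s| <= pi/2. *)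
have := lerB_dist (pi * z%:~R) (- s).
rewrite opprK normrN normrM (gtr0_norm p0) addrC => h.
apply: le_trans h.
have : pi * 1 <= pi * `|z%:~R : R| by rewrite ler_wpM2l// ltW.
by move: `|z%:~R| `|s| (pi : R) s3 p0 => a b c; lra.
Qed.

Lemma measurable_enorm : measurable_fun setT (@enorm R d).
Proof.
apply: measurableT_comp; last by apply: measurable_dotp.
apply: continuous_measurable_fun; exact: sqrt_continuous.
Qed.

Lemma measurable_hcell : measurable hcell.
Proof.
rewrite (_ : hcell = \big[setI/setT]_(i < d)
  (fun x : 'rV[R]_d => x 0 i) @^-1` [set` `[- (pi / 2), (pi / 2) [ ]).
  apply: bigsetI_measurable => i _.
  by rewrite -[X in measurable X]setTI; apply: measurable_coord => //; exact: measurable_itv.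
rewrite -bigcap_seq; apply/seteqP; split => [x /= bx i _|x /= bx i].
  by rewrite /= in_itv /=; exact: bx.
by have := bx i (mem_index_enum i); rewrite /= in_itv.
Qed.

Lemma measurable_nearest (k : 'rV[int]_d) : measurable [set t | nearest t = k].
Proof.
rewrite (_ : [set t | _] = (fun t => 1 *: t + - pi_lattice R k) @^-1` hcell).
  rewrite -[X in measurable X]setTI; apply: measurable_affine => //; exact: measurable_hcell.
by apply/seteqP; split => t /=; rewrite scale1r; [move/nearestP|move=> /nearestP].
Qed.

(** The lattice is enumerated by the [pickle] codes, which makes the partition into cells a
    countable union over [nat]. *)
Lemma bigcup_nearest (p : pred 'rV[int]_d) :
  [set t | p (nearest t)] = \bigcup_i
    (if pickle_inv i is Some k then [set t | p k /\ nearest t = k] else set0).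
Proof.
apply/seteqP; split => [t pt|t [i _]].
  by exists (choice.pickle (nearest t)) => //; rewrite pickleK_inv.
by case: (pickle_inv i) => // k [pk /= ->].
Qed.

Lemma measurable_fun_nearest d' (T' : measurableType d') (f : 'rV[int]_d -> 'rV[R]_d -> T') :
  (forall k, measurable_fun setT (f k)) -> measurable_fun setT (fun t => f (nearest t) t).
Proof.
move=> mf _ B mB; rewrite setTI.
rewrite (_ : _ @^-1` B = \bigcup_i (if pickle_inv i is Some k then
    [set t | nearest t = k] `&` (f k @^-1` B) else set0)).
  apply: bigcupT_measurable => i; case: (pickle_inv i) => [k|]; last exact: measurable0.
  apply: measurableI; first exact: measurable_nearest.
  by rewrite -[X in measurable X]setTI; exact: mf.
apply/seteqP; split => [t Bt|t [i _]].
  by exists (choice.pickle (nearest t)) => //; rewrite pickleK_inv.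
by case: (pickle_inv i) => // k [/= -> ].
Qed.

Lemma measurable_nearest_pred (p : pred 'rV[int]_d) : measurable [set t | p (nearest t)].
Proof.
rewrite bigcup_nearest; apply: bigcupT_measurable => i.
case: (pickle_inv i) => [k|]; last exact: measurable0.
have [pk|pk] := boolP (p k).
  by rewrite (_ : [set t | _] = [set t | nearest t = k]);
    [exact: measurable_nearest|apply/seteqP; split => t //= []].
by rewrite (_ : [set t | _] = set0); [exact: measurable0|apply/seteqP; split => t //= []].
Qed.

Lemma measurable_dist_pi_lattice : measurable_fun setT (@dist_pi_lattice R d).
Proof.
rewrite (_ : @dist_pi_lattice R d = fun t => enorm (1 *: t + - pi_lattice R (nearest t))).
  apply: (@measurable_fun_nearest _ _ (fun k t => enorm (1 *: t + - pi_lattice R k))) => k.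
  exact: (measurableT_comp measurable_enorm (measurable_affine 1 _)).
by apply/funext => t; rewrite dist_pi_latticeE scale1r.
Qed.

Lemma ge0_integral_nearest (p : pred 'rV[int]_d) (F G : 'rV[R]_d -> \bar R) :
  measurable_fun setT F -> measurable_fun setT G ->
  (forall t, 0 <= F t)%E -> (forall t, 0 <= G t)%E ->
  (forall k, p k -> (\int[@leb R d]_(t in [set t | nearest t = k]) F t <=
    \int[@leb R d]_(t in [set t | nearest t = k]) G t)%E) ->
  (\int[@leb R d]_(t in [set t | p (nearest t)]) F t <=
   \int[@leb R d]_(t in [set t | p (nearest t)]) G t)%E.
Proof.
move=> mF mG F0 G0 FG; rewrite bigcup_nearest.
set D := fun i => _.
have mD i : measurable (D i).
  rewrite /D; case: (pickle_inv i) => [k|]; last exact: measurable0.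
  have [pk|pk] := boolP (p k).
    by rewrite (_ : [set t | _] = [set t | nearest t = k]);
      [exact: measurable_nearest|apply/seteqP; split => t //= []].
  by rewrite (_ : [set t | _] = set0); [exact: measurable0|apply/seteqP; split => t //= []].
have tD : trivIset setT D.
  apply/trivIsetP => i j _ _ ij; apply/seteqP; split => // t [].
  rewrite /D; case Ei : (pickle_inv i) => [k|]//; case Ej : (pickle_inv j) => [k'|]//= [_ tk] [_ tk'].
  have := @pickle_invK 'rV[int]_d i; have := @pickle_invK 'rV[int]_d j.
  by rewrite Ei Ej /= -tk -tk' => ji ii; move: ij; rewrite -ji -ii eqxx.
rewrite !ge0_integral_bigcup//; [|exact: measurable_funTS|exact: measurable_funTS].
apply: lee_nneseries => [i _ _|i _]; first exact: integral_ge0.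
rewrite /D; case: (pickle_inv i) => [k|]; last by rewrite !integral_set0.
have [pk|pk] := boolP (p k).
  by rewrite (_ : [set t | _] = [set t | nearest t = k]);
    [exact: FG|apply/seteqP; split => t //= []].
by rewrite (_ : [set t | _] = set0); [rewrite !integral_set0|apply/seteqP; split => t //= []].
Qed.

End lattice.

(** * The estimate on one cell, for q standing for |f|^2 and psi for |f| |f'| *)

Section cell_estimate.
Context {R : realType} (e : nat).
Notation mu := (@lebesgue_measure R).
Local Notation d := e.+1.
Local Notation leb := (@leb R d).
Variables (q psi : 'rV[R]_d -> R) (a : 'rV[R]_d).
Hypothesis mq : measurable_fun setT q.
Hypothesis mpsi : measurable_fun setT psi.
Hypothesis q0 : forall t, 0 <= q t.
Hypothesis psi0 : forall t, 0 <= psi t.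
Hypothesis q_segment : forall s,
  ((q (s + a))%:E <= \int[mu]_(u in `]0%R, 1%R]) (2 * enorm s * psi (u *: s + a))%:E)%E.

(** The bound of [radial_integral_le] at parameter m r^2, times r: the weight left at distance r
    from the centre of the cell. *)
Definition radial (m r : R) : R := r * (d`!%:R / (d%:R * Num.sqrt ((m * r ^+ 2) ^+ d)) *
  atan (Num.sqrt ((m * r ^+ 2) ^+ d))^-1).

Lemma radial_ge0 m r : 0 <= r -> 0 <= radial m r.
Proof.
move=> r0; rewrite mulr_ge0// mulr_ge0//.
by have /andP[] := @atan_le R (Num.sqrt ((m * r ^+ 2) ^+ d))^-1 (ltac:(by rewrite invr_ge0 sqrtr_ge0)).
Qed.

Lemma measurable_radial m : measurable_fun setT (radial m).
Proof.
have mr : measurable_fun setT (fun r : R => Num.sqrt ((m * r ^+ 2) ^+ d)).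
  apply: (@measurableT_comp _ _ _ _ _ _ (@Num.sqrt R)).
    apply: continuous_measurable_fun; exact: sqrt_continuous.
  by apply: measurable_funX; apply: measurable_funM => //; exact: measurable_funX.
apply: measurable_funM => //; apply: measurable_funM.
  apply: measurable_funM => //; apply: (measurableT_comp (@measurable_inv R)).
  exact: measurable_funM.
apply: (measurableT_comp _ (measurableT_comp (@measurable_inv R) mr)).
apply: continuous_measurable_fun => x; exact: continuous_atan.
Qed.

Lemma enormZ (c : R) (s : 'rV[R]_d) : 0 <= c -> enorm (c *: s) = c * enorm s.
Proof.
by move=> c0; rewrite /enorm dotpZl dotpZr mulrA -expr2 sqrtrM ?sqr_ge0// sqrtr_sqr ger0_norm.
Qed.

(** The cell is star-shaped about its centre, so the points x = u s + a stay inside it. *)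
Lemma hcell_star (u : R) (s : 'rV[R]_d) : 0 < u <= 1 -> hcell (u^-1 *: s) -> hcell s.
Proof.
move=> /andP[u0 u1] h j; have := h j; rewrite mxE => /andP[].
rewrite ler_pdivlMl// ltr_pdivrMl// => h1 h2.
have p0 : 0 < pi / 2 :> R by rewrite divr_gt0 ?pi_gt0.
by move: (pi / 2) p0 h1 h2 => p p0 h1 h2; apply/andP; split; nra.
Qed.

Let chi (u : R) : R := \1_(`]0%R, 1%R]%classic : set R) u.
Let c (s : 'rV[R]_d) : R := \1_hcell s.

Let mchi : measurable_fun setT (chi : measurableTypeR R -> R).
Proof. exact: measurable_indic. Qed.

Let mc : measurable_fun setT c.
Proof. by apply: measurable_indic; exact: measurable_hcell. Qed.

Let chi0 u : 0 <= chi u. Proof. by []. Qed.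
Let c0 s : 0 <= c s. Proof. by []. Qed.

(** Insert [q_segment], exchange the integrals over s and u, substitute x = u s + a for fixed u, and
    exchange back. The inner integral over u is then the one bounded by [radial_integral_le]. *)
Lemma cell_estimate (m : R) : 0 < m ->
  (\int[leb]_(t in [set t | hcell (t - a)%R]) (q t * expR (- (m * enorm (t - a) ^+ 2)))%:E <=
   \int[leb]_(t in [set t | hcell (t - a)%R]) (2 * psi t * radial m (enorm (t - a)))%:E)%E.
Proof.
move=> m0.
pose D := [set t : 'rV[R]_d | hcell (t - a)].
have msub : measurable_fun setT (fun t : 'rV[R]_d => t - a) by apply: measurable_rVB.
have mD : measurable D by rewrite -[D]setTI; apply: msub => //; exact: measurable_hcell.
have mE : measurable_fun setT (fun s : 'rV[R]_d => expR (- (m * enorm s ^+ 2))).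
  apply: measurableT_comp => //; apply: measurableT_comp => //.
  by apply: measurable_funM => //; apply: measurable_funX; exact: measurable_enorm.
have cD (F : 'rV[R]_d -> R) :
    (\int[leb]_(t in D) (F t)%:E = \int[leb]_t (c (t - a) * F t)%:E)%E.
  rewrite integral_mkcond; apply: eq_integral => t _.
  rewrite patchE /c indicE; have [tD|tD] := boolP (t \in D).
    by rewrite (_ : (t - a) \in _) ?mul1r//; apply/mem_set; exact: set_mem tD.
  rewrite (_ : (t - a \in _) = false) ?mul0r//.
  by apply: contraNF tD => /set_mem h; apply/mem_set.
rewrite -/D !cD.
pose F t := (c (t - a) * (q t * expR (- (m * enorm (t - a) ^+ 2))))%:E.
(* [H] is the integrand in (s, u), and [K] its bound in (x, u) after the substitution. The
   indicators [c] and [chi] allow integration over the full spaces. *)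
pose H (z : 'rV[R]_d * measurableTypeR R) := (chi z.2 * c z.1 * expR (- (m * enorm z.1 ^+ 2)) *
  (2 * enorm z.1) * psi (z.2 *: z.1 + a))%:E.
pose K (z : 'rV[R]_d * measurableTypeR R) := (c (z.1 - a) * (2 * psi z.1 * enorm (z.1 - a)) *
  (chi z.2 * (z.2^-1 ^+ e.+2 * expR (- (m * enorm (z.1 - a) ^+ 2 / z.2 ^+ 2)))))%:E.
have mF : measurable_fun setT F.
  apply/measurable_EFinP; apply: measurable_funM; first exact: (measurableT_comp mc).
  by apply: measurable_funM => //; exact: (measurableT_comp mE).
have mH : measurable_fun setT H.
  apply/measurable_EFinP; apply: measurable_funM.
    apply: measurable_funM; last first.
      by apply: measurable_funM => //; exact: (measurableT_comp measurable_enorm).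
    apply: measurable_funM; last exact: (measurableT_comp mE).
    by apply: measurable_funM; [exact: (measurableT_comp mchi)|exact: (measurableT_comp mc)].
  apply: (measurableT_comp mpsi); apply: measurable_rVD => //.
  by apply: measurable_rVZ.
have msub1 : measurable_fun setT (fun z : 'rV[R]_d * measurableTypeR R => z.1 - a).
  exact: (measurableT_comp msub).
have mK : measurable_fun setT K.
  apply/measurable_EFinP; apply: measurable_funM.
    apply: measurable_funM; first exact: (measurableT_comp mc).
    apply: measurable_funM; last exact: (measurableT_comp measurable_enorm).
    by apply: measurable_funM => //; exact: (measurableT_comp mpsi).
  apply: measurable_funM; first exact: (measurableT_comp mchi).
  apply: measurable_funM.
    by apply: measurable_funX; exact: (measurableT_comp (@measurable_inv R)).
  apply: measurableT_comp => //; apply: measurableT_comp => //; apply: measurable_funM.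
    apply: measurable_funM => //; apply: measurable_funX.
    exact: (measurableT_comp measurable_enorm).
  apply: (measurableT_comp (@measurable_inv R)); exact: measurable_funX.
have F0 t : (0 <= F t)%E by rewrite lee_fin !mulr_ge0 ?expR_ge0.
have H0 z : (0 <= H z)%E by rewrite lee_fin !mulr_ge0 ?expR_ge0 ?enorm_ge0.
have chiE u : chi u = (if 0 < u <= 1 then 1 else 0).
  rewrite /chi indicE; case: ifP => u01.
    by rewrite mem_set//= in_itv.
  by rewrite memNset//= in_itv/= u01.
have K0 z : (0 <= K z)%E.
  rewrite lee_fin mulr_ge0//; first by rewrite !mulr_ge0 ?enorm_ge0.
  rewrite chiE; case: ifP => [/andP[u0 _]|_]; last by rewrite mul0r.
  by rewrite mul1r mulr_ge0 ?expR_ge0// exprn_ge0// invr_ge0 ltW.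
have := @ge0_integral_leb_affine R d 1 a F ltr01 mF F0.
rewrite expr1n invr1 mul1e -/F => <-.
apply: (@le_trans _ _ (\int[leb]_s \int[mu]_u H (s, u))%E).
  apply: ge0_le_integral => //.
  - exact: (measurableT_comp mF (measurable_affine 1 a)).
  - exact: (measurable_fun_fubini_tonelli_F H).
  move=> s _; rewrite scale1r /F addrK.
  pose b : R := c s * expR (- (m * enorm s ^+ 2)).
  have b0 : 0 <= b by rewrite mulr_ge0 ?expR_ge0.
  have mL : measurable_fun setT (fun u : measurableTypeR R => 2 * enorm s * psi (u *: s + a)).
    apply: measurable_funM => //; apply: (measurableT_comp mpsi).
    by apply: measurable_rVD => //; apply: measurable_rVZ.
  have L0 u : 0 <= 2 * enorm s * psi (u *: s + a) by rewrite !mulr_ge0 ?enorm_ge0.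
  have -> : (\int[mu]_u H (s, u) =
      b%:E * \int[mu]_(u in `]0%R, 1%R]) (2 * enorm s * psi (u *: s + a))%:E)%E.
    rewrite [in RHS]integral_mkcond.
    rewrite (_ : (_ \_ _)%E = (fun u => (chi u * (2 * enorm s * psi (u *: s + a)))%:E)).
      have HZ := @ge0_integral_EFinZl R _ (measurableTypeR R) mu b
        (fun u => chi u * (2 * enorm s * psi (u *: s + a))) b0.
      apply: etrans (HZ _ _); last 2 first.
      - exact: measurable_funM.
      - by move=> u; rewrite mulr_ge0.
      by apply: eq_integral => u _; rewrite /H /b /=; congr (_%:E); ring.
    apply/funext => u; rewrite patchE /chi indicE.
    by case: (u \in _); rewrite ?mul1r ?mul0r.
  rewrite (_ : _%:E = (b%:E * (q (s + a))%:E)%E); last by rewrite -EFinM /b; congr (_%:E); ring.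
  by apply: lee_wpmul2l => //; exact: q_segment.
rewrite (fubini_tonelli (m1 := leb) (m2 := mu) H mH H0).
apply: (@le_trans _ _ (\int[mu]_u \int[leb]_s K (s, u))%E).
  apply: ge0_le_integral => //.
  - by move=> u _; apply: integral_ge0 => s _; exact: H0.
  - exact: (measurable_fun_fubini_tonelli_G H).
  - exact: (measurable_fun_fubini_tonelli_G K).
  move=> u _; have [u01|u01] := boolP (0 < u <= 1); last first.
    rewrite !integral0_eq// => s _; rewrite /H /K /= chiE (negbTE u01).
      by rewrite !(mul0r, mulr0).
    by rewrite !(mul0r, mulr0).
  have /andP[u0 u1] := u01.
  pose G x := (c (u^-1 *: (x - a)) * expR (- (m * (u^-1 * enorm (x - a)) ^+ 2)) *
    (2 * (u^-1 * enorm (x - a))) * psi x).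
  have mus : measurable_fun setT (fun x : 'rV[R]_d => u^-1 *: (x - a)) by exact: measurable_rVZ.
  have men : measurable_fun setT (fun x : 'rV[R]_d => u^-1 * enorm (x - a)).
    by apply: measurable_funM => //; exact: (measurableT_comp measurable_enorm).
  have mG : measurable_fun setT G.
    apply: measurable_funM => //; apply: measurable_funM; last exact: measurable_funM.
    apply: measurable_funM; first exact: (measurableT_comp mc).
    apply: measurableT_comp => //; apply: measurableT_comp => //.
    by apply: measurable_funM => //; exact: measurable_funX.
  have ui0 : 0 <= u^-1 by rewrite invr_ge0 ltW.
  have G0 x : 0 <= G x by rewrite !mulr_ge0 ?expR_ge0 ?enorm_ge0.
  have -> : (\int[leb]_s H (s, u) = \int[leb]_s (EFin \o G) (u *: s + a)%R)%E.
    apply: eq_integral => s _; rewrite /H /G /= addrK chiE u01 mul1r.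
    rewrite -(enormZ _ ui0) scalerA mulVf ?gt_eqF// scale1r.
    by congr ((_ * _)%:E).
  rewrite (ge0_integral_leb_affine a u0 (_ : measurable_fun setT (EFin \o G)))//; last first.
    exact/measurable_EFinP.
  have ud0 : 0 <= u ^- d by rewrite invr_ge0 exprn_ge0// ltW.
  rewrite -(ge0_integral_EFinZl leb ud0 mG G0).
  apply: ge0_le_integral => //.
  - by move=> x _; rewrite lee_fin mulr_ge0// invr_ge0 exprn_ge0// ltW.
  - by apply/measurable_EFinP; exact: measurable_funM.
  - apply: (measurableT_comp mK); exact: measurable_fun_pair.
  move=> x _; rewrite /G /K /= lee_fin chiE u01 mul1r.
  have cc : c (u^-1 *: (x - a)) <= c (x - a).
    rewrite /c !indicE; have [h|_] := boolP (_ \in hcell); last by [].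
    by rewrite (mem_set (hcell_star u01 (set_mem h))).
  rewrite (_ : m * (u^-1 * enorm (x - a)) ^+ 2 = m * enorm (x - a) ^+ 2 / u ^+ 2); last first.
    by rewrite exprMn exprVn; ring.
  (* The power u^-(e+2) collects the Jacobian u^-(e+1) and the factor 1/u from |s| = |x - a|/u. *)
  apply: (@le_trans _ _ (c (u^-1 *: (x - a)) * ((2 * psi x * enorm (x - a)) *
      (u^-1 ^+ e.+2 * expR (- (m * enorm (x - a) ^+ 2 / u ^+ 2)))))).
    rewrite le_eqVlt; apply/orP; left; apply/eqP.
    by rewrite -exprVn [u^-1 ^+ e.+2]exprS; ring.
  rewrite -[leRHS]mulrA; apply: ler_wpM2r => //.
  apply: mulr_ge0; first by rewrite !mulr_ge0 ?enorm_ge0.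
  by apply: mulr_ge0; [exact: exprn_ge0|exact: expR_ge0].
rewrite -(fubini_tonelli (m1 := leb) (m2 := mu) K mK K0).
apply: ge0_le_integral => //.
- by move=> s _; apply: integral_ge0 => u _; exact: K0.
- exact: (measurable_fun_fubini_tonelli_F K).
- apply/measurable_EFinP; apply: measurable_funM; first exact: (measurableT_comp mc).
  apply: measurable_funM; first exact: measurable_funM.
  exact: (measurableT_comp (measurable_radial m) (measurableT_comp measurable_enorm msub)).
move=> t _.
pose b : R := c (t - a) * (2 * psi t * enorm (t - a)).
have b0 : 0 <= b by rewrite !mulr_ge0 ?enorm_ge0.
have [r0|r0] := eqVneq (enorm (t - a)) 0.
  rewrite integral0_eq; last by move=> u _; rewrite /K /= r0 !(mulr0, mul0r).
  rewrite lee_fin; apply: mulr_ge0 => //; apply: mulr_ge0; first exact: mulr_ge0.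
  by apply: radial_ge0; exact: enorm_ge0.
have r1 : 0 < enorm (t - a) by rewrite lt_neqAle eq_sym r0 enorm_ge0.
have M0 : 0 < m * enorm (t - a) ^+ 2 by rewrite mulr_gt0// exprn_gt0.
have mV : measurable_fun setT (fun u : measurableTypeR R => u^-1 : R) := @measurable_inv R.
have -> : (\int[mu]_u K (t, u) = b%:E * \int[mu]_(u in `]0%R, 1%R])
    (u^-1 ^+ e.+2 * expR (- (m * enorm (t - a) ^+ 2 / u ^+ 2)))%:E)%E.
  rewrite [in RHS]integral_mkcond.
  rewrite (_ : (_ \_ _)%E = (fun u => (chi u *
      (u^-1 ^+ e.+2 * expR (- (m * enorm (t - a) ^+ 2 / u ^+ 2))))%:E)).
    have HZ := @ge0_integral_EFinZl R _ (measurableTypeR R) mu b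
      (fun u => chi u * (u^-1 ^+ e.+2 * expR (- (m * enorm (t - a) ^+ 2 / u ^+ 2)))) b0.
    apply: etrans (HZ _ _); first by [].
    - apply: measurable_funM => //; apply: measurable_funM; first exact: measurable_funX.
      apply: measurableT_comp => //; apply: measurableT_comp => //; apply: measurable_funM => //.
      by apply: (measurableT_comp mV); exact: measurable_funX.
    - move=> u; rewrite chiE; case: ifP => [/andP[u0 _]|_]; last by rewrite mul0r.
      by rewrite mul1r mulr_ge0 ?expR_ge0// exprn_ge0// invr_ge0 ltW.
  apply/funext => u; rewrite patchE /chi indicE.
  by case: (u \in _); rewrite ?mul1r ?mul0r.
apply: le_trans (lee_wpmul2l _ (radial_integral_le e M0)) _; first by rewrite lee_fin.
rewrite -EFinM lee_fin le_eqVlt; apply/orP; left; apply/eqP.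
by rewrite /b /radial; ring.
Qed.

End cell_estimate.

(** * The gradient of f, and |f|^2 along segments *)

Section gradient.
Context d0 (T : measurableType d0) {R : realType} (P : probability T R) (d : nat).
Notation mu := (@lebesgue_measure R).
Variable X : T -> 'rV[R]_d.
Hypothesis mX : measurable_fun setT X.
Hypothesis EX : ('E_P[fun w => enorm (X w)] < +oo)%E.
Local Notation C := (Ecos P X).
Local Notation S := (Esin P X).

Lemma le_coord_enorm (x : 'rV[R]_d) j : `|x 0 j| <= enorm x.
Proof.
rewrite /enorm -sqrtr_sqr ler_wsqrtr// /dotp (bigD1 j)//= -expr2 lerDl.
by apply: sumr_ge0 => i _; rewrite -expr2 sqr_ge0.
Qed.

Lemma integrable_coord j : P.-integrable setT (EFin \o (fun w => X w 0 j)).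
Proof.
have mj : measurable_fun setT (fun w => X w 0 j) by exact: (measurableT_comp (measurable_coord j)).
apply/integrableP; split; first exact/measurable_EFinP.
apply: le_lt_trans EX; rewrite unlock; apply: ge0_le_integral => //.
- by apply: measurableT_comp => //; apply/measurable_EFinP.
- by apply/measurable_EFinP; exact: (measurableT_comp measurable_enorm).
by move=> w _; rewrite /= lee_fin le_coord_enorm.
Qed.

(** [dcos j] and [dsin j] are the j-th partial derivatives of [C] and [S], with the differentiation
    carried out under the expectation. *)
Definition dcos j t := - \int[P]_w (X w 0 j * sin (dotp t (X w))).
Definition dsin j t := \int[P]_w (X w 0 j * cos (dotp t (X w))).

(** Adding |W| makes the integrand nonnegative, as Tonelli requires. *)
Lemma measurable_weighted (W : T -> R) (h : R -> R) : P.-integrable setT (EFin \o W) ->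
  measurable_fun setT h -> (forall x, `|h x| <= 1) ->
  measurable_fun setT (fun t : 'rV[R]_d => \int[P]_w (W w * h (dotp t (X w)))).
Proof.
move=> iW mh h1.
have mW : measurable_fun setT W by apply/measurable_EFinP; case/integrableP: iW.
have ih t : P.-integrable setT (EFin \o (fun w => W w * h (dotp t (X w)))).
  by apply: integrable_bounded_mul => //; apply: measurableT_comp => //; exact: measurable_dotp.
have i1 : P.-integrable setT (EFin \o (fun w => `|W w|)) by exact: integrable_norm iW.
rewrite (_ : (fun t => _) = (fun t => \int[P]_w (`|W w| + W w * h (dotp t (X w))) - \int[P]_w `|W w|)); last first.
  by apply/funext => t; rewrite (RintegralD measurableT i1 (ih t)) addrC addKr.
apply: measurable_funB => //; apply/measurable_EFinP.
rewrite (_ : _ \o _ = fun t => \int[P]_w (`|W w| + W w * h (dotp t (X w)))%:E)%E; last first.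
  by apply/funext => t; rewrite /= (EFin_Rintegral (integrableD measurableT i1 (ih t))).
apply: (measurable_fun_fubini_tonelli_F
  (fun z : 'rV[R]_d * T => (`|W z.2| + W z.2 * h (dotp z.1 (X z.2)))%:E)).
- have mW2 : measurable_fun setT (fun z : 'rV[R]_d * T => W z.2) by exact: measurableT_comp.
  apply/measurable_EFinP; apply: measurable_funD; first exact: measurableT_comp.
  apply: measurable_funM => //; apply: measurableT_comp => //.
  by apply: measurable_dotp => //; apply: measurableT_comp.
- move=> z; rewrite lee_fin -lerBlDl sub0r.
  have : `|W z.2 * h (dotp z.1 (X z.2))| <= `|W z.2| by rewrite normrM ler_piMr.
  by rewrite ler_norml => /andP[].
Qed.

Lemma cos_norm_le1 (x : R) : `|cos x| <= 1.
Proof. by rewrite ler_norml cos_geN1 cos_le1. Qed.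

Lemma sin_norm_le1 (x : R) : `|sin x| <= 1.
Proof. by rewrite ler_norml sin_geN1 sin_le1. Qed.

Lemma measurable_dcos j : measurable_fun setT (dcos j).
Proof.
apply: measurableT_comp => //; apply: measurable_weighted; first exact: integrable_coord.
  exact: measurable_sin.
exact: sin_norm_le1.
Qed.

Lemma measurable_dsin j : measurable_fun setT (dsin j).
Proof.
apply: measurable_weighted; first exact: integrable_coord.
  exact: measurable_cos.
exact: cos_norm_le1.
Qed.

Lemma Rintegral_dotp (s : 'rV[R]_d) (g : T -> R) : measurable_fun setT g ->
  (forall w, `|g w| <= 1) ->
  \int[P]_w (dotp s (X w) * g w) = \sum_j s 0 j * \int[P]_w (X w 0 j * g w).
Proof.
move=> mg g1.
have iXg j : P.-integrable setT (EFin \o (fun w => X w 0 j * g w)).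
  by apply: integrable_bounded_mul => //; exact: integrable_coord.
transitivity (\int[P]_w \sum_j (s 0 j * (X w 0 j * g w))).
  by apply: eq_Rintegral => w _; rewrite /dotp mulr_suml; apply: eq_bigr => j _; rewrite mulrA.
rewrite /Rintegral; under eq_integral do rewrite -sumEFin.
have iZ j : P.-integrable setT (EFin \o (fun w => s 0 j * (X w 0 j * g w))).
  exact: (integrableZl measurableT (s 0 j) (iXg j)).
rewrite integral_sum //.
under eq_bigr => j _ do rewrite (EFin_Rintegral (iZ j)).
rewrite sumEFin /=; apply: eq_bigr => j _.
by rewrite (RintegralZl (s 0 j) measurableT (iXg j)).
Qed.

Lemma integrable_dotp (s : 'rV[R]_d) : P.-integrable setT (EFin \o (fun w => dotp s (X w))).
Proof.
rewrite (_ : _ \o _ = (fun w => \sum_j (s 0 j * X w 0 j)%:E)%E); last first.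
  by apply/funext => w; rewrite sumEFin.
apply: integrable_sum => // j _; exact: (integrableZl measurableT (s 0 j) (integrable_coord j)).
Qed.

Lemma is_derive_Ecos_line (s a : 'rV[R]_d) (u : R) :
  is_derive u 1 (fun u => C (u *: s + a)) (\sum_j s 0 j * dcos j (u *: s + a)).
Proof.
have i1 : P.-integrable setT (EFin \o (fun=> 1)) by exact: finite_measure_integrable_cst.
have md t : measurable_fun setT (fun w => dotp t (X w)) by apply: measurable_dotp.
have iB : P.-integrable setT (EFin \o (fun w => 1 * dotp s (X w))).
  by rewrite (_ : (fun w => _) = (fun w => dotp s (X w))); [exact: integrable_dotp|apply/funext => w; rewrite mul1r].
have := is_derive_integral_cos u (md a) (md s) i1 iB.
have lineE v w : dotp a (X w) + v * dotp s (X w) = dotp (v *: s + a) (X w).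
  by rewrite dotpDl dotpZl addrC.
rewrite (_ : (fun u : R => _) = (fun u => C (u *: s + a))); last first.
  by apply/funext => v; apply: eq_Rintegral => w _; rewrite mul1r lineE.
move=> h; apply: (is_derive_eq h).
rewrite /dcos; under [RHS]eq_bigr do rewrite mulrN.
rewrite sumrN; congr (- _).
rewrite -(@Rintegral_dotp s (fun w => sin (dotp (u *: s + a) (X w)))) .
- by apply: eq_Rintegral => w _; rewrite mul1r lineE.
- by apply: measurableT_comp; [exact: measurable_sin|exact: md].
- by move=> w; exact: sin_norm_le1.
Qed.

Lemma is_derive_Esin_line (s a : 'rV[R]_d) (u : R) :
  is_derive u 1 (fun u => S (u *: s + a)) (\sum_j s 0 j * dsin j (u *: s + a)).
Proof.
have i1 : P.-integrable setT (EFin \o (fun=> 1)) by exact: finite_measure_integrable_cst.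
have md t : measurable_fun setT (fun w => dotp t (X w)) by apply: measurable_dotp.
have iB : P.-integrable setT (EFin \o (fun w => 1 * dotp s (X w))).
  by rewrite (_ : (fun w => _) = (fun w => dotp s (X w))); [exact: integrable_dotp|apply/funext => w; rewrite mul1r].
have := is_derive_integral_sin u (md a) (md s) i1 iB.
have lineE v w : dotp a (X w) + v * dotp s (X w) = dotp (v *: s + a) (X w).
  by rewrite dotpDl dotpZl addrC.
rewrite (_ : (fun u : R => _) = (fun u => S (u *: s + a))); last first.
  by apply/funext => v; apply: eq_Rintegral => w _; rewrite mul1r lineE.
move=> h; apply: (is_derive_eq h).
rewrite -(@Rintegral_dotp s (fun w => cos (dotp (u *: s + a) (X w)))) .
- by apply: eq_Rintegral => w _; rewrite mul1r lineE.
- by apply: measurableT_comp; [exact: measurable_cos|exact: md].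
- by move=> w; exact: cos_norm_le1.
Qed.

Lemma continuous_line_integral (W : T -> R) (s a : 'rV[R]_d) : P.-integrable setT (EFin \o W) ->
  continuous (fun u : R => \int[P]_w (W w * cos (dotp (u *: s + a) (X w)))) /\
  continuous (fun u : R => \int[P]_w (W w * sin (dotp (u *: s + a) (X w)))).
Proof.
move=> iW.
have md t : measurable_fun setT (fun w => dotp t (X w)) by apply: measurable_dotp.
have lineE v w : dotp (v *: s + a) (X w) = dotp a (X w) + v * dotp s (X w).
  by rewrite dotpDl dotpZl addrC.
split.
- rewrite (_ : (fun u => _) = (fun u : R => \int[P]_w (W w * cos (dotp a (X w) + u * dotp s (X w))))).
    exact: (continuous_integral_cos (md a) (md s) iW).
  by apply/funext => u; apply: eq_Rintegral => w _; rewrite lineE.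
- rewrite (_ : (fun u => _) = (fun u : R => \int[P]_w (W w * sin (dotp a (X w) + u * dotp s (X w))))).
    exact: (continuous_integral_sin (md a) (md s) iW).
  by apply/funext => u; apply: eq_Rintegral => w _; rewrite lineE.
Qed.

Lemma derive_line (f : 'rV[R]_d -> R) (v a : 'rV[R]_d) df :
  is_derive (0 : R) 1 (fun u => f (u *: v + a)) df -> 'D_v f a = df.
Proof.
case=> _ <-; rewrite /derive; congr (lim (_ @ 0^')).
by apply/funext => h; rewrite /= /shift/= addr0 scale0r add0r [h *: 1]mulr1.
Qed.

Lemma normc_charfun t : Normc.normc (charfun P X t) = Num.sqrt (corr P X X t).
Proof. by rewrite /charfun /= /corr !expr2. Qed.

Definition dnorm t := Num.sqrt (\sum_j (dcos j t ^+ 2 + dsin j t ^+ 2)).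

Lemma enormC_grad t : enormC (grad (charfun P X) t) = dnorm t.
Proof.
rewrite /enormC /dnorm; congr (Num.sqrt _); apply: eq_bigr => j _.
rewrite mxE /= sqr_sqrtr ?addr_ge0 ?sqr_ge0//.
have sumE (g : 'I_d -> R) : \sum_i (delta_mx 0 j : 'rV[R]_d) 0 i * g i = g j.
  rewrite (bigD1 j)//= big1 ?addr0; first by rewrite mxE !eqxx mul1r.
  by move=> i ij; rewrite mxE eqxx (negbTE ij) mul0r.
have hC := is_derive_Ecos_line (delta_mx 0 j) t 0.
have hS := is_derive_Esin_line (delta_mx 0 j) t 0.
rewrite (derive_line hC) (derive_line hS) !sumE.
by rewrite !scale0r !add0r.
Qed.

(** The sum of the squares (B x_i - c y_i)^2 equals B (A B - c^2). *)
Lemma cauchy_schwarz (I : finType) (x y : I -> R) :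
  `|\sum_i x i * y i| <= Num.sqrt (\sum_i x i ^+ 2) * Num.sqrt (\sum_i y i ^+ 2).
Proof.
set A := \sum_i x i ^+ 2; set B := \sum_i y i ^+ 2; set c := \sum_i x i * y i.
have A0 : 0 <= A by apply: sumr_ge0 => i _; exact: sqr_ge0.
have B0 : 0 <= B by apply: sumr_ge0 => i _; exact: sqr_ge0.
rewrite -sqrtrM// -sqrtr_sqr ler_wsqrtr//.
have [B1|B1] := eqVneq B 0.
  have y0 i : y i = 0.
    apply/eqP; rewrite -sqrf_eq0; apply/eqP.
    exact: (psumr_eq0P (fun i _ => sqr_ge0 (y i)) B1).
  by rewrite /c big1 ?expr0n ?mulr_ge0// => i _; rewrite y0 mulr0.
rewrite -subr_ge0 -(pmulr_rge0 _ (_ : 0 < B)); last by rewrite lt_neqAle eq_sym B1.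
have <- : \sum_i (B * x i - c * y i) ^+ 2 = B * (A * B - c ^+ 2).
  transitivity (B ^+ 2 * A - 2 * B * c * c + c ^+ 2 * B); last by ring.
  rewrite [B ^+ 2 * A]mulr_sumr [2 * B * c * c]mulr_sumr [c ^+ 2 * B]mulr_sumr -sumrB -big_split/=.
  by apply: eq_bigr => i _; ring.
by apply: sumr_ge0 => i _; exact: sqr_ge0.
Qed.

(** The product |f| |f'| of the integrability hypothesis. *)
Definition slope t := Num.sqrt (corr P X X t) * dnorm t.

Lemma measurable_slope : measurable_fun setT slope.
Proof.
have ms : measurable_fun setT (@Num.sqrt R).
  apply: continuous_measurable_fun; exact: sqrt_continuous.
apply: measurable_funM; first by apply: (measurableT_comp ms); exact: measurable_corr.
apply: (measurableT_comp ms); apply: measurable_sum => j.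
by apply: measurable_funD; apply: measurable_funX; [exact: measurable_dcos|exact: measurable_dsin].
Qed.

Lemma slope_ge0 t : 0 <= slope t.
Proof. by rewrite mulr_ge0// sqrtr_ge0. Qed.

Lemma continuous_sum_line (s : 'rV[R]_d) (f : 'I_d -> R -> R) : (forall j, continuous (f j)) ->
  continuous (fun u : R => \sum_j s 0 j * f j u).
Proof.
move=> cf; elim: (index_enum _) => [|j r IH].
  rewrite (_ : (fun u => _) = (fun=> 0)); first by move=> u; exact: cvg_cst.
  by apply/funext => u; rewrite big_nil.
rewrite (_ : (fun u => _) = (fun u => s 0 j * f j u + \sum_(i <- r) s 0 i * f i u)).
  move=> u; apply: cvgD; last exact: IH.
  by apply: cvgM; [exact: cvg_cst|exact: cf].
by apply/funext => u; rewrite big_cons.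
Qed.

(** As |f|^2 vanishes at [a], its value at s + a is the integral of its derivative along the
    segment, twice the real part of conj(f) times the derivative of f in direction s. Cauchy-Schwarz
    bounds this by 2 |s| |f| |f'|. *)
Lemma corr_segment (s a : 'rV[R]_d) : corr P X X a = 0 ->
  ((corr P X X (s + a))%:E <=
   \int[mu]_(u in `]0%R, 1%R]) (2 * enorm s * slope (u *: s + a))%:E)%E.
Proof.
move=> a0.
pose k (u : R) := corr P X X (u *: s + a).
pose cc (u : R) := C (u *: s + a); pose ss (u : R) := S (u *: s + a).
pose c' (u : R) := \sum_j s 0 j * dcos j (u *: s + a).
pose s' (u : R) := \sum_j s 0 j * dsin j (u *: s + a).
pose k' (u : R) := 2 * (cc u * c' u + ss u * s' u).
have dk (u : R) : is_derive u 1 k (k' u).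
  have dC : is_derive u 1 cc (c' u) := is_derive_Ecos_line s a u.
  have dS : is_derive u 1 ss (s' u) := is_derive_Esin_line s a u.
  have : is_derive u 1 (fun u => cc u * cc u + ss u * ss u) (k' u).
    apply: is_derive_eq; rewrite /GRing.scale/= /k'.
    by move: (cc u) (ss u) (c' u) (s' u) => x y z t; ring.
  by [].
have i1 : P.-integrable setT (EFin \o (fun=> 1)) by exact: finite_measure_integrable_cst.
have ccont : continuous cc.
  have [h _] := continuous_line_integral s a i1.
  rewrite (_ : cc = (fun u => \int[P]_w (1 * cos (dotp (u *: s + a) (X w)))))//.
  by apply/funext => u; apply: eq_Rintegral => w _; rewrite mul1r.
have scont : continuous ss.
  have [_ h] := continuous_line_integral s a i1.
  rewrite (_ : ss = (fun u => \int[P]_w (1 * sin (dotp (u *: s + a) (X w)))))//.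
  by apply/funext => u; apply: eq_Rintegral => w _; rewrite mul1r.
have c'cont : continuous c'.
  apply: continuous_sum_line => j u; apply: cvgN.
  by have [_] := continuous_line_integral s a (integrable_coord j); exact.
have s'cont : continuous s'.
  apply: continuous_sum_line => j u.
  by have [+ _] := continuous_line_integral s a (integrable_coord j); exact.
have ck : continuous k'.
  move=> u; apply: cvgM; first exact: cvg_cst.
  by apply: cvgD; apply: cvgM; [exact: ccont|exact: c'cont|exact: scont|exact: s'cont].
have mk : measurable_fun setT k' by exact: continuous_measurable_fun.
have k'le u : `|k' u| <= 2 * enorm s * slope (u *: s + a).
  set t := u *: s + a.
  have -> : k' u = 2 * \sum_j s 0 j * (cc u * dcos j t + ss u * dsin j t).
    rewrite /k' /c' /s'; congr (_ * _); rewrite !mulr_sumr -big_split/=.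
    by apply: eq_bigr => j _; rewrite -/t; ring.
  rewrite normrM ger0_norm// -!mulrA; apply: ler_wpM2l => //.
  apply: le_trans (cauchy_schwarz _ _) _.
  have -> : Num.sqrt (\sum_i s 0 i ^+ 2) = enorm s by [].
  apply: ler_wpM2l; first exact: enorm_ge0.
  rewrite /slope -sqrtrM ?corr_ge0// ler_wsqrtr// mulr_sumr; apply: ler_sum => j _.
  rewrite /corr -/(cc u) -/(ss u).
  move: (cc u) (ss u) (dcos j t) (dsin j t) => x y z w.
  rewrite -subr_ge0 [leRHS](_ : _ = (x * w - y * z) ^+ 2) ?sqr_ge0//; ring.
have := FTC2 ltr01 dk ck.
rewrite /k scale1r scale0r add0r a0 subr0 => <-.
rewrite (le_trans (lee_abs _))//.
apply: (@le_trans _ _ (\int[mu]_(u in `[0%R, 1%R]) `|(k' u)%:E|)%E).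
  apply: le_abse_integral => //.
  by apply/measurable_EFinP; exact: measurable_funTS.
rewrite -integral_itv_obnd_cbnd; last first.
  apply: measurableT_comp => //; apply/measurable_EFinP; exact: measurable_funTS.
apply: ge0_le_integral => //.
- apply: measurableT_comp => //; apply/measurable_EFinP; exact: measurable_funTS.
- apply/measurable_EFinP; apply: measurable_funTS; apply: measurable_funM => //.
  apply: (measurableT_comp measurable_slope).
  by apply: measurable_rVD => //; apply: measurable_rVZ.
by move=> u _; rewrite lee_fin.
Qed.

End gradient.

(** * The contribution of the cells around the nonzero lattice points *)

Section far_cells.
Context d0 (T : measurableType d0) {R : realType} (P : probability T R) (e : nat).
Local Notation d := e.+1.
Local Notation leb := (@leb R d).
Variable X : T -> 'rV[R]_d.
Hypothesis mX : measurable_fun setT X.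
Hypothesis EX : ('E_P[fun w => enorm (X w)] < +oo)%E.
Hypothesis X_slope : (\int[leb]_t (slope P X t / dist_pi_lattice t ^+ e)%:E < +oo)%E.
Hypothesis X_lattice : forall k : 'rV[int]_d, k != 0 -> corr P X X (pi_lattice R k) = 0.

Definition far_cells : set 'rV[R]_d := [set t | nearest t != 0].

Lemma measurable_far_cells : measurable far_cells.
Proof. exact: (@measurable_nearest_pred _ _ (fun k => k != 0)). Qed.

Definition cosprod n (t : 'rV[R]_d) := (\prod_j cos (t 0 j)) ^+ n.

Lemma measurable_cosprod n : measurable_fun setT (cosprod n).
Proof.
apply: measurable_funX; apply: measurable_prod => j _.
apply: measurableT_comp; first exact: measurable_cos.
exact: measurable_coord.
Qed.

(** A lattice shift changes the cosines only in sign, and the remainder lies in the cell where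
    [cos_le_gam] applies. *)
Lemma cosprod_le n t : `|cosprod n t| <= Gam n%:R (t - pi_lattice R (nearest t)).
Proof.
set s := t - _.
have -> : Gam n%:R s = Gam 1 s ^+ n.
  by rewrite /Gam -expRM_natl mul1r mulrN !mulrA.
rewrite normrX lerXn2r ?nnegrE ?normr_ge0 ?Gam_ge0//.
rewrite normr_prod Gam_prod; apply: ler_prod => j _; rewrite normr_ge0/=.
have /andP[c0 cg] := cos_le_gam (nearest_bound t j).
apply: le_trans cg; rewrite -[leRHS]ger0_norm//.
have -> : t 0 j = s 0 j + pi * (nearest t 0 j)%:~R by rewrite /s !mxE subrK.
by rewrite cos_pi_int normrM normrX normrN1 expr1n mul1r.
Qed.

(** Cell by cell: the square of the bound in [cosprod_le] is exp(-n |s|^2), the weight of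
    [cell_estimate], whose segment hypothesis is [corr_segment] at a centre where f vanishes. *)
Lemma far_le n : (0 < n)%N ->
  (\int[leb]_(t in far_cells) (corr P X X t * cosprod n t ^+ 2)%:E <=
   \int[leb]_(t in far_cells) (2 * slope P X t * radial e n%:R (dist_pi_lattice t))%:E)%E.
Proof.
move=> n0; have n0' : 0 < n%:R :> R by rewrite ltr0n.
have mq := measurable_corr P mX mX.
have ms := measurable_slope mX EX.
apply: (@ge0_integral_nearest _ _ (fun k : 'rV[int]_d => k != 0)
  (fun t => (corr P X X t * cosprod n t ^+ 2)%:E)
  (fun t => (2 * slope P X t * radial e n%:R (dist_pi_lattice t))%:E)).
- apply/measurable_EFinP; apply: measurable_funM => //; apply: measurable_funX.
  exact: measurable_cosprod.
- apply/measurable_EFinP; apply: measurable_funM; first exact: measurable_funM.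
  exact: (measurableT_comp (measurable_radial e _) measurable_dist_pi_lattice).
- by move=> t; rewrite lee_fin mulr_ge0 ?corr_ge0// sqr_ge0.
- move=> t; rewrite lee_fin; apply: mulr_ge0; first by rewrite mulr_ge0// slope_ge0.
  by apply: radial_ge0; rewrite dist_pi_latticeE enorm_ge0.
move=> k k0; have a0 := X_lattice k0.
have E : [set t : 'rV[R]_d | nearest t = k] = [set t | hcell (t - pi_lattice R k)].
  by apply/seteqP; split => t /=; move/nearestP.
have mD : measurable [set t : 'rV[R]_d | nearest t = k] by exact: measurable_nearest.
have := cell_estimate mq ms (fun t => corr_ge0 P X t) (@slope_ge0 _ _ _ P _ X)
  (fun s => corr_segment mX EX s a0) n0'.
rewrite -E; set L := (\int[_]_(_ in _) _)%E; set U := (\int[_]_(_ in _) _)%E => LU.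
apply: (@le_trans _ _ L).
  apply: ge0_le_integral => //.
  - by move=> t _; rewrite lee_fin mulr_ge0 ?corr_ge0// sqr_ge0.
  - apply/measurable_EFinP; apply: measurable_funTS; apply: measurable_funM => //; apply: measurable_funX.
    exact: measurable_cosprod.
  - apply/measurable_EFinP; apply: measurable_funTS; apply: measurable_funM => //.
    apply: measurableT_comp => //; apply: measurableT_comp => //; apply: measurable_funM => //.
    apply: measurable_funX; apply: (measurableT_comp measurable_enorm).
    by apply: measurable_rVB.
  move=> t tk; rewrite lee_fin ler_wpM2l ?corr_ge0//.
  rewrite -(ger0_norm (sqr_ge0 _)) normrX.
  have := cosprod_le n t; rewrite tk => h.
  apply: (@le_trans _ _ (Gam n%:R (t - pi_lattice R k) ^+ 2)).
    by rewrite lerXn2r ?nnegrE ?normr_ge0 ?Gam_ge0.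
  rewrite expr2 -GamD /Gam enormE ler_expR lerN2.
  by move: (dotp _ _) (n%:R : R) => x y; lra.
apply: (le_trans LU); apply: ge0_le_integral => //.
- move=> t _; rewrite lee_fin; apply: mulr_ge0; first by rewrite mulr_ge0// slope_ge0.
  by apply: radial_ge0; exact: enorm_ge0.
- apply/measurable_EFinP; apply: measurable_funTS; apply: measurable_funM; first exact: measurable_funM.
  apply: (measurableT_comp (measurable_radial e _)); apply: (measurableT_comp measurable_enorm).
  by apply: measurable_rVB.
- apply/measurable_EFinP; apply: measurable_funTS; apply: measurable_funM; first exact: measurable_funM.
  exact: (measurableT_comp (measurable_radial e _) measurable_dist_pi_lattice).
by move=> t tk; rewrite dist_pi_latticeE tk.
Qed.

Let rt n : R := Num.sqrt n.+1%:R.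

Lemma rt_gt0 n : 0 < rt n. Proof. by rewrite sqrtr_gt0. Qed.

(** The power of sqrt(n+1) cancels against the denominator of [radial], leaving n only inside the
    arctangent. Since that is bounded and tends to 0, both the majorant and the pointwise limit can
    be read off. *)
Lemma scaled_radialE n (r : R) : 0 < r ->
  rt n ^+ d * radial e n.+1%:R r = d`!%:R / d%:R * (r ^+ e)^-1 * atan ((rt n * r) ^+ d)^-1.
Proof.
move=> r0; rewrite /radial; have -> : Num.sqrt ((n.+1%:R * r ^+ 2) ^+ d) = (rt n * r) ^+ d.
  rewrite -[n.+1%:R](sqr_sqrtr (ler0n R n.+1)) -exprMn -exprM mulnC exprM sqrtr_sqr ger0_norm//.
  by rewrite exprn_ge0// mulr_ge0 ?ltW// rt_gt0.
set A := atan _; have x0 := rt_gt0 n.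
have d1 : (d%:R : R) != 0 by rewrite pnatr_eq0.
rewrite exprMn [r ^+ d]exprS; have y0 : r ^+ e != 0 by rewrite expf_neq0// gt_eqF.
have z0 : rt n ^+ d != 0 by rewrite expf_neq0// gt_eqF.
have {}r0 : r != 0 by rewrite gt_eqF.
move: (rt n ^+ d) (r ^+ e) (d%:R : R) (d`!%:R : R) A z0 y0 d1 => z y k l A z0 y0 d1.
by clear -z0 y0 d1 r0; field; rewrite y0 d1 r0 z0.
Qed.

Lemma scaled_radial_le n (r : R) : 0 <= r ->
  0 <= rt n ^+ d * radial e n.+1%:R r <= d`!%:R / d%:R * (pi / 2) / r ^+ e.
Proof.
rewrite le_eqVlt => /predU1P[<-|r0].
  rewrite /radial !mul0r mulr0 lexx/= mulr_ge0 ?invr_ge0 ?exprn_ge0//.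
  by rewrite mulr_ge0 ?divr_ge0 ?pi_ge0.
rewrite scaled_radialE//.
have p0 : 0 <= (d`!%:R / d%:R * (r ^+ e)^-1 : R).
  by rewrite mulr_ge0 ?divr_ge0// invr_ge0 exprn_ge0// ltW.
have x0 : 0 <= ((rt n * r) ^+ d)^-1.
  by rewrite invr_ge0 exprn_ge0// mulr_ge0 ?ltW// rt_gt0.
have /andP[a0 _] := atan_le x0.
rewrite mulr_ge0//= [leRHS](_ : _ = d`!%:R / d%:R * (r ^+ e)^-1 * (pi / 2)).
  by rewrite ler_wpM2l// ltW// atan_ltpi2.
by rewrite mulrAC.
Qed.

Lemma cvg_scaled_radial (r : R) : 0 <= r ->
  rt n ^+ d * radial e n.+1%:R r @[n --> \oo] --> (0 : R).
Proof.
rewrite le_eqVlt => /predU1P[<-|r0].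
  rewrite (_ : (fun n => _) = (fun=> 0)); first exact: cvg_cst.
  by apply/funext => n; rewrite /radial !mul0r mulr0.
rewrite (_ : (fun n => _) = (fun n => d`!%:R / d%:R * (r ^+ e)^-1 * atan ((rt n * r) ^+ d)^-1)); last first.
  by apply/funext => n; rewrite scaled_radialE.
apply: (@cvg_to_eq R _ (d`!%:R / d%:R * (r ^+ e)^-1 * 0)); first by rewrite mulr0.
apply: cvgM; first exact: cvg_cst.
have x0 n : 0 <= ((rt n * r) ^+ d)^-1.
  by rewrite invr_ge0 exprn_ge0// mulr_ge0 ?ltW// rt_gt0.
have rt0 : (rt n)^-1 @[n --> \oo] --> (0 : R).
  by have := @cvg_sqrt_nat_inv R; rewrite -cvg_shiftS.
apply: (@squeeze_cvgr _ _ _ _ (fun=> 0) (fun n => ((rt n)^-1 * r^-1) ^+ d)).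
- by near=> n; have := atan_le (x0 n); rewrite -invfM exprVn.
- exact: cvg_cst.
- apply: (@cvg_to_eq R _ ((0 * r^-1) ^+ d)); first by rewrite mul0r expr0n.
  have h : (rt n)^-1 * r^-1 @[n --> \oo] --> 0 * r^-1 by apply: cvgM => //; exact: cvg_cst.
  exact: (@continuous_cvg _ _ _ _ _ _ (fun x : R => x ^+ d) _ (@exprn_continuous R d _) h).
Unshelve. all: by end_near. Qed.

(** The far part of the squared L^2 norm of the transform, in unscaled coordinates; [rt n ^+ d] is
    the Jacobian. *)
Definition far n := (\int[leb]_(t in far_cells)
  (rt n ^+ d * (corr P X X t * cosprod n.+1 t ^+ 2))%:E)%E.

(** Dominated convergence: by [scaled_radial_le] the integrability hypothesis provides the
    majorant. *)
Lemma far_cvg : (forall n, far n < +oo)%E /\ far n @[n --> \oo] --> 0%E.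
Proof.
pose D := far_cells; have mD := measurable_far_cells.
pose F n t := \1_D t * (2 * slope P X t * (rt n ^+ d * radial e n.+1%:R (dist_pi_lattice t))) : R.
have ms := measurable_slope mX EX.
have mF n : measurable_fun setT (F n).
  apply: measurable_funM; first exact: measurable_indic.
  apply: measurable_funM; first exact: measurable_funM.
  apply: measurable_funM => //.
  exact: (measurableT_comp (measurable_radial e _) measurable_dist_pi_lattice).
have dist0 (t : 'rV[R]_d) : 0 <= dist_pi_lattice t by rewrite dist_pi_latticeE enorm_ge0.
have F0 n t : 0 <= F n t.
  rewrite mulr_ge0// mulr_ge0//; first by rewrite mulr_ge0// slope_ge0.
  by have /andP[] := scaled_radial_le n (dist0 t).
pose c : R := d`!%:R / d%:R * (pi / 2).
pose g t := 2 * c * (slope P X t / dist_pi_lattice t ^+ e).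
have isl : leb.-integrable setT (EFin \o (fun t => slope P X t / dist_pi_lattice t ^+ e)).
  apply/integrableP; split.
    apply/measurable_EFinP; apply: measurable_funM => //.
    apply: (measurableT_comp (@measurable_inv R)); apply: measurable_funX.
    exact: measurable_dist_pi_lattice.
  under eq_integral => t _.
    rewrite /= ger0_norm; last by rewrite mulr_ge0 ?slope_ge0// invr_ge0 exprn_ge0.
    over.
  exact: X_slope.
have ig : leb.-integrable setT (EFin \o g) by exact: (integrableZl measurableT (2 * c) isl).
have Fg n t : `|F n t| <= g t.
  rewrite ger0_norm// /F /g.
  have /andP[_ h] := scaled_radial_le n (dist0 t).
  apply: (@le_trans _ _ (1 * (2 * slope P X t * (c / dist_pi_lattice t ^+ e)))).
    rewrite ler_pM//.
    - rewrite mulr_ge0//; first by rewrite mulr_ge0// slope_ge0.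
      by have /andP[] := scaled_radial_le n (dist0 t).
    - by rewrite ler_wpM2l// mulr_ge0// slope_ge0.
  by rewrite mul1r le_eqVlt; apply/orP; left; apply/eqP; ring.
have Fc t : F n t @[n --> \oo] --> (0 : R).
  apply: (@cvg_to_eq R _ (\1_D t * (2 * slope P X t * 0))); first by rewrite !mulr0.
  apply: cvgM; first exact: cvg_cst.
  by apply: cvgM; [exact: cvg_cst|exact: cvg_scaled_radial].
have [_ FC] := EFin_dominated_cvg mF Fc ig Fg.
have farF n : (far n <= \int[leb]_t (F n t)%:E)%E.
  have rd0 : 0 <= rt n ^+ d by rewrite exprn_ge0// ltW// rt_gt0.
  have mq := measurable_corr P mX mX.
  have mL : measurable_fun D (fun t : 'rV[R]_d => (corr P X X t * cosprod n.+1 t ^+ 2)%:E).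
    apply/measurable_EFinP; apply: measurable_funTS; apply: measurable_funM => //; apply: measurable_funX.
    exact: measurable_cosprod.
  have L0 t : D t -> (0 <= (corr P X X t * cosprod n.+1 t ^+ 2)%:E)%E.
    by move=> _; rewrite lee_fin mulr_ge0 ?corr_ge0// sqr_ge0.
  rewrite /far; under eq_integral do rewrite EFinM.
  rewrite ge0_integralZl_EFin//.
  apply: (le_trans (lee_wpmul2l _ (far_le (ltn0Sn n)))); first by rewrite lee_fin.
  rewrite -ge0_integralZl_EFin//; last 2 first.
  - move=> t _; rewrite lee_fin; apply: mulr_ge0; first by rewrite mulr_ge0// slope_ge0.
    exact: radial_ge0.
  - apply/measurable_EFinP; apply: measurable_funTS; apply: measurable_funM; first exact: measurable_funM.
    exact: (measurableT_comp (measurable_radial e _) measurable_dist_pi_lattice).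
  rewrite integral_mkcond le_eqVlt; apply/orP; left; apply/eqP.
  apply: eq_integral => t _; rewrite patchE /F indicE.
  case: (t \in _); last by rewrite mul0r.
  by rewrite mul1r -EFinM; congr (_%:E); ring.
split=> [n|].
  apply: le_lt_trans (farF n) _.
  have iF : leb.-integrable setT (EFin \o F n).
    by apply: (le_integrable _ _ _ ig) => //; [exact/measurable_EFinP|
      move=> t _; rewrite /= lee_fin (le_trans (Fg n t))// ler_norm].
  by have := integrable_fin_num measurableT iF; rewrite fin_numElt => /andP[].
apply: (@squeeze_cvge _ _ _ _ (fun=> 0%E) _ (fun n => \int[leb]_t (F n t)%:E)%E).
- near=> n; rewrite farF andbT; apply: integral_ge0 => t _.
  rewrite lee_fin; apply: mulr_ge0; first by rewrite exprn_ge0// ltW// rt_gt0.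
  by rewrite mulr_ge0 ?corr_ge0// sqr_ge0.
- exact: cvg_cst.
- by rewrite integral0 in FC.
Unshelve. all: by end_near. Qed.

End far_cells.

(** * Sufficiency: L^2 convergence of the transforms and of the densities *)

Section sufficiency.
Context d0 (T : measurableType d0) {R : realType} (P : probability T R) (e : nat).
Local Notation d := e.+1.
Local Notation leb := (@leb R d).
Variables (X : T -> 'rV[R]_d) (Xs : nat -> T -> 'rV[R]_d).
Hypothesis mX : measurable_fun setT X.
Hypothesis mXs : forall k, measurable_fun setT (Xs k).
Hypothesis Xs_indep : independent_seq P Xs.
Hypothesis Xs_unif : forall k, uniform_on_cube P (Xs k).
Hypothesis X_indep : independent_of_seq P X Xs.
Hypothesis EX : ('E_P[fun w => enorm (X w)] < +oo)%E.
Hypothesis X_slope : (\int[leb]_t (slope P X t / dist_pi_lattice t ^+ e)%:E < +oo)%E.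
Hypothesis X_lattice : forall k : 'rV[int]_d, k != 0 -> corr P X X (pi_lattice R k) = 0.
(** Indices are shifted by one so that the normalisation never divides by 0. *)
Let Z n := normalized_sum X Xs n.+1.
Let u n (t : 'rV[R]_d) := (Num.sqrt n.+1%:R)^-1 *: t.
(** The zero vector: its smoothing at variance 1 is the standard normal density, which makes that
    density accessible to [exists_density]. *)
Let O : T -> 'rV[R]_d := fun=> 0.

Let mZ n : measurable_fun setT (Z n).
Proof. exact: (@measurable_normalized_sum _ _ R d X Xs mX mXs n.+1). Qed.

Let mO : measurable_fun setT O.
Proof. exact: measurable_cst. Qed.

Let mu n : measurable_fun setT (u n).
Proof. by apply: measurable_rVZ. Qed.

Let V n t : R := \1_(@far_cells R e) (u n t).

Let V01 n t : V n t = 0 \/ V n t = 1.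
Proof. by rewrite /V indicE; case: (_ \in _); [right|left]. Qed.

Let mV n : measurable_fun setT (V n).
Proof.
apply: (@measurableT_comp _ _ _ _ _ _ (\1_(@far_cells R e) : _ -> R) _ (u n)) => //.
by apply: measurable_indic; exact: measurable_far_cells.
Qed.

Lemma Ecos_Z n t : Ecos P (Z n) t = Ecos P X (u n t) * cosprod n.+1 (u n t).
Proof. exact: (Ecos_normalized_sum mX mXs Xs_indep Xs_unif X_indep). Qed.

Lemma Esin_Z n t : Esin P (Z n) t = Esin P X (u n t) * cosprod n.+1 (u n t).
Proof. exact: (Esin_normalized_sum mX mXs Xs_indep Xs_unif X_indep). Qed.

Lemma corr_Z n t : corr P (Z n) (Z n) t = corr P X X (u n t) * cosprod n.+1 (u n t) ^+ 2.
Proof.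
rewrite /corr Ecos_Z Esin_Z; move: (Ecos P X _) (Esin P X _) (cosprod _ _) => x y z.
by ring.
Qed.

Lemma corr_le2 t : corr P X X t <= 2.
Proof.
have hC := Ecos_norm_le1 P t mX; have hS := Esin_norm_le1 P t mX.
rewrite /corr -!expr2 -(real_normK (num_real (Ecos P X t))) -(real_normK (num_real (Esin P X t))).
by rewrite (lerD (y := 1) (t := 1))// exprn_ile1.
Qed.

Lemma integral_far n :
  (\int[leb]_t (V n t * corr P (Z n) (Z n) t)%:E = far P X n)%E.
Proof.
pose F (x : 'rV[R]_d) := (\1_(@far_cells R e) x * (corr P X X x * cosprod n.+1 x ^+ 2))%:E.
have mF : measurable_fun setT F.
  apply/measurable_EFinP; apply: measurable_funM.
    by apply: measurable_indic; exact: measurable_far_cells.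
  apply: measurable_funM; first exact: measurable_corr.
  by apply: measurable_funX; exact: measurable_cosprod.
have F0 x : (0 <= F x)%E.
  by rewrite lee_fin; apply: mulr_ge0 => //; rewrite mulr_ge0 ?corr_ge0// sqr_ge0.
have r0 : 0 < (Num.sqrt n.+1%:R : R)^-1 by rewrite invr_gt0 sqrtr_gt0.
transitivity (\int[leb]_t F ((Num.sqrt n.+1%:R)^-1 *: t + 0)%R)%E.
  by apply: eq_integral => t _; rewrite addr0 corr_Z.
rewrite (ge0_integral_leb_affine _ r0 mF F0) exprVn invrK /far.
have s0 : 0 <= Num.sqrt n.+1%:R ^+ d :> R by rewrite exprn_ge0// sqrtr_ge0.
under [in RHS]eq_integral do rewrite EFinM.
rewrite ge0_integralZl_EFin//; last 3 first.
- exact: measurable_far_cells.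
- by move=> t _; rewrite lee_fin mulr_ge0 ?corr_ge0// sqr_ge0.
- apply/measurable_EFinP; apply: measurable_funTS.
  apply: measurable_funM; first exact: measurable_corr.
  by apply: measurable_funX; exact: measurable_cosprod.
congr (_ * _)%E; rewrite [in RHS]integral_mkcond; apply: eq_integral => t _.
by rewrite patchE /F indicE; case: (_ \in _); rewrite ?mul1r ?mul0r.
Qed.

Lemma V0_nearest n t : V n t = 0 -> nearest (u n t) = 0.
Proof.
rewrite /V indicE; case: (boolP (_ \in _)) => [_ /eqP|]; first by rewrite oner_eq0.
move=> h _; apply/eqP; apply: contraNT h => h; exact/mem_set.
Qed.

(** In the central cell the cosines are controlled by the Gaussian, and the crude bound 2 for |f|^2
    is enough. *)
Lemma corr_near n t : V n t = 0 -> corr P (Z n) (Z n) t <= 2 * Gam 2 t.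
Proof.
move=> /V0_nearest V0; rewrite corr_Z.
have := cosprod_le n.+1 (u n t); rewrite V0.
have -> : u n t - pi_lattice R 0 = u n t.
  by rewrite /pi_lattice map_mx0 scaler0 subr0.
rewrite /u GamZ exprVn sqr_sqrtr// mulVf//= => h.
rewrite ler_pM ?corr_ge0 ?sqr_ge0 ?corr_le2//.
rewrite -(ger0_norm (sqr_ge0 _)) normrX (_ : Gam 2 t = Gam 1 t ^+ 2); last by rewrite expr2 -GamD.
by rewrite lerXn2r ?nnegrE ?Gam_ge0.
Qed.

Lemma integrable_V_corr n : leb.-integrable setT (EFin \o (fun t => V n t * corr P (Z n) (Z n) t)).
Proof.
have mc := measurable_corr P (mZ n) (mZ n).
apply/integrableP; split; first by apply/measurable_EFinP; exact: measurable_funM.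
under eq_integral => t _.
  rewrite /= ger0_norm; last by rewrite mulr_ge0 ?corr_ge0//; have [->|->] := V01 n t.
  over.
by rewrite integral_far; have [h _] := far_cvg mX EX X_slope X_lattice; exact: h.
Qed.

Lemma integrable_corr_Z n : leb.-integrable setT (EFin \o corr P (Z n) (Z n)).
Proof.
have mc := measurable_corr P (mZ n) (mZ n).
have iG := integrableZl measurableT 2 (@integrable_Gam R d 2 (ltr0Sn _ _)).
have iS := integrableD measurableT (integrable_V_corr n) iG.
apply: (le_integrable _ _ _ iS) => //; first exact/measurable_EFinP.
move=> t _; rewrite /= lee_fin ger0_norm ?corr_ge0// (le_trans _ (ler_norm _))//.
have [V0|->] := V01 n t; last by rewrite mul1r lerDl mulr_ge0 ?Gam_ge0.
by rewrite V0 mul0r add0r corr_near.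
Qed.

Lemma Ecos_O t : Ecos P O t = 1.
Proof.
rewrite /Ecos (@eq_Rintegral _ _ _ P setT (fun=> 1)) => [|w _]; last by rewrite dotpC dotp0l cos0.
by rewrite /Rintegral integral_prob_cst.
Qed.

Lemma Esin_O t : Esin P O t = 0.
Proof.
rewrite /Esin (@eq_Rintegral _ _ _ P setT (fun=> 0)) => [|w _]; last by rewrite dotpC dotp0l sin0.
by rewrite /Rintegral integral_prob_cst.
Qed.

Lemma sm_O x : sm P 1 O x = std_normal_density x.
Proof.
rewrite std_normal_densityE /sm (@eq_Rintegral _ _ _ P setT (fun=> hk 1 x)) => [|w _]; last by rewrite subr0.
by rewrite /Rintegral integral_prob_cst.
Qed.

Let fd n t := fdiff P (Z n) (fun=> 1) O (Gam 1) t.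

Let mfd n : measurable_fun setT (fd n).
Proof. by apply: measurable_fdiff => //; exact: measurable_Gam. Qed.

Lemma fd_le n t : fd n t <= 2 * corr P (Z n) (Z n) t + 2 * Gam 2 t.
Proof.
rewrite (le_trans (fdiff_le _ _ _ _ _ _))// expr1n mulr1 lerD2l.
by rewrite {1}/corr Ecos_O Esin_O mulr1 mulr0 addr0 mul1r expr2 -GamD.
Qed.

Lemma fd_cvg t : fd n t @[n --> \oo] --> (0 : R).
Proof.
have rt0 : (Num.sqrt n.+1%:R : R)^-1 @[n --> \oo] --> (0 : R).
  by have := @cvg_sqrt_nat_inv R; rewrite -cvg_shiftS.
have i1 : P.-integrable setT (EFin \o (fun=> 1)) by exact: finite_measure_integrable_cst.
have [cc cs] := continuous_line_integral mX t 0 i1.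
have cE : Ecos P X (u n t) @[n --> \oo] --> (1 : R).
  apply: (@cvg_to_eq R _ (\int[P]_w (1 * cos (dotp (0 *: t + 0) (X w))))).
    rewrite (@eq_Rintegral _ _ _ P setT (fun=> 1)) => [|w _].
      by rewrite /Rintegral integral_prob_cst.
    by rewrite scale0r addr0 dotp0l cos0 mul1r.
  pose h (v : R) := \int[P]_w (1 * cos (dotp (v *: t + 0) (X w))).
  rewrite (_ : (fun n => _) = (fun n => h ((Num.sqrt n.+1%:R)^-1))).
    exact: (@continuous_cvg _ _ _ _ _ _ h _ (cc 0) rt0).
  apply/funext => n.
  by apply: eq_Rintegral => w _; rewrite mul1r addr0.
have sE : Esin P X (u n t) @[n --> \oo] --> (0 : R).
  apply: (@cvg_to_eq R _ (\int[P]_w (1 * sin (dotp (0 *: t + 0) (X w))))).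
    rewrite (@eq_Rintegral _ _ _ P setT (fun=> 0)) => [|w _].
      by rewrite /Rintegral integral_prob_cst.
    by rewrite scale0r addr0 dotp0l sin0 mul1r.
  pose h (v : R) := \int[P]_w (1 * sin (dotp (v *: t + 0) (X w))).
  rewrite (_ : (fun n => _) = (fun n => h ((Num.sqrt n.+1%:R)^-1))).
    exact: (@continuous_cvg _ _ _ _ _ _ h _ (cs 0) rt0).
  apply/funext => n.
  by apply: eq_Rintegral => w _; rewrite mul1r addr0.
have wE : cosprod n.+1 (u n t) @[n --> \oo] --> Gam 1 t.
  rewrite Gam_prod.
  rewrite (_ : (fun n => _) = (fun n => \prod_j cos ((Num.sqrt n.+1%:R)^-1 * t 0 j) ^+ n.+1)).
    by apply: cvg_prod_seq => j; exact: cvg_cos_gam.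
  apply/funext => n; rewrite /cosprod -prodrXl; apply: eq_bigr => j _.
  by rewrite mxE.
apply: (@cvg_to_eq R _ ((1 * Gam 1 t * 1 - 1 * Gam 1 t) ^+ 2 + (0 * Gam 1 t * 1 - 0 * Gam 1 t) ^+ 2)).
  by rewrite !mul0r mulr1 !subrr expr0n addr0.
rewrite (_ : (fun n => fd n t) = (fun n =>
    (Ecos P X (u n t) * cosprod n.+1 (u n t) * 1 - 1 * Gam 1 t) ^+ 2 +
    (Esin P X (u n t) * cosprod n.+1 (u n t) * 1 - 0 * Gam 1 t) ^+ 2)); last first.
  by apply/funext => n; rewrite /fd /fdiff Ecos_Z Esin_Z Ecos_O Esin_O.
have c1 (a : R) : a @[_ --> \oo] --> a by exact: cvg_cst.
by apply: cvgD; apply: cvg_sqr; apply: cvgB => //; apply: cvgM => //; apply: cvgM.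
Qed.

Lemma V_cvg t : \forall n \near \oo, V n t = 0.
Proof.
have p2 : 0 < pi / 2 :> R by rewrite divr_gt0 ?pi_gt0.
have h : \sum_j `|t 0 j| * (Num.sqrt n.+1%:R)^-1 @[n --> \oo] --> (0 : R).
  apply: (@cvg_to_eq R _ ((\sum_j `|t 0 j|) * 0)); first by rewrite mulr0.
  rewrite (_ : (fun n => _) = (fun n => (\sum_j `|t 0 j|) * (Num.sqrt n.+1%:R)^-1)).
    apply: cvgM; first exact: cvg_cst.
    by have := @cvg_sqrt_nat_inv R; rewrite -cvg_shiftS.
  by apply/funext => n; rewrite mulr_suml.
have /cvgrPdist_lt/(_ _ p2) H := h; near=> n.
have : `|0 - \sum_j `|t 0 j| * (Num.sqrt n.+1%:R)^-1| < pi / 2 by near: n.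
rewrite sub0r normrN ger0_norm => [sn|]; last first.
  by apply: sumr_ge0 => j _; rewrite mulr_ge0// invr_ge0 sqrtr_ge0.
rewrite /V indicE memNset// /far_cells /= => /negP; apply.
apply/eqP/nearestP => j.
rewrite /pi_lattice map_mx0 scaler0 subr0 /u mxE.
have : `|(Num.sqrt n.+1%:R)^-1 * t 0 j| < pi / 2.
  apply: le_lt_trans sn; rewrite (bigD1 j)//= normrM ger0_norm ?invr_ge0 ?sqrtr_ge0//.
  rewrite mulrC lerDl; apply: sumr_ge0 => i _.
  by rewrite mulr_ge0// invr_ge0 sqrtr_ge0.
by rewrite ltr_norml => /andP[/ltW -> ->].
Unshelve. all: by end_near. Qed.

(** Split [fd] into a far part, controlled by [far_cvg], and a rest [H] with a fixed Gaussian
    majorant. For fixed t the point t / sqrt(n+1) eventually lies in the central cell, so [H] tends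
    to 0 together with [fd]. *)
Lemma fd_int_cvg : (forall n, leb.-integrable setT (EFin \o fd n)) /\
  \int[leb]_t fd n t @[n --> \oo] --> (0 : R).
Proof.
(* On the far cells [H] keeps only the Gaussian half of the bound [fd_le]; elsewhere it is [fd]
   itself. *)
pose H n t := V n t * (2 * Gam 2 t) + (1 - V n t) * fd n t.
have fd0 n t : 0 <= fd n t by exact: fdiff_ge0.
have mH n : measurable_fun setT (H n).
  apply: measurable_funD.
    by apply: measurable_funM => //; apply: measurable_funM => //; exact: measurable_Gam.
  by apply: measurable_funM => //; exact: measurable_funB.
have iG : leb.-integrable setT (EFin \o (fun t => 6 * @Gam R d 2 t)).
  exact: (integrableZl measurableT 6 (@integrable_Gam R d 2 (ltr0Sn _ _))).
have H0 n t : 0 <= H n t.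
  rewrite /H; have [->|->] := V01 n t.
    by rewrite mul0r add0r subr0 mul1r.
  by rewrite subrr mul0r addr0 mul1r mulr_ge0 ?Gam_ge0.
(* The 6 is 2 times 2 plus 2, from [fd_le] and [corr_near]. *)
have HG n t : `|H n t| <= 6 * Gam 2 t.
  rewrite ger0_norm// /H; have := Gam_ge0 2 t; have [V0|->] := V01 n t.
    rewrite V0 mul0r add0r subr0 mul1r.
    have := corr_near V0; have := fd_le n t.
    by move: (corr _ _ _ _) (fd _ _) (Gam _ _) => x y z; lra.
  by rewrite subrr mul0r addr0 mul1r; move: (Gam _ _) => z; lra.
have Hc t : H n t @[n --> \oo] --> (0 : R).
  apply/cvgrPdist_le => eps eps0.
  have /cvgrPdist_le/(_ _ eps0) h1 := fd_cvg t; have h2 := V_cvg t; near=> n.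
  have -> : H n t = fd n t.
    by rewrite /H (_ : V n t = 0); [rewrite mul0r add0r subr0 mul1r|near: n].
  by near: n.
have iH n : leb.-integrable setT (EFin \o H n).
  apply: (le_integrable _ _ _ iG) => //; first exact/measurable_EFinP.
  by move=> t _; rewrite /= lee_fin (le_trans (HG n t))// ler_norm.
have iVc n : leb.-integrable setT (EFin \o (fun t => 2 * (V n t * corr P (Z n) (Z n) t))).
  exact: (integrableZl measurableT 2 (integrable_V_corr n)).
have iS n := integrableD measurableT (iVc n) (iH n).
have fdS n t : fd n t <= 2 * (V n t * corr P (Z n) (Z n) t) + H n t.
  rewrite /H; have [->|->] := V01 n t.
    by rewrite !(mul0r, mulr0, add0r) subr0 mul1r.
  by rewrite subrr !mul1r mul0r addr0 fd_le.
have ifd n : leb.-integrable setT (EFin \o fd n).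
  apply: (le_integrable _ _ _ (iS n)) => //; first exact/measurable_EFinP.
  by move=> t _; rewrite /= lee_fin ger0_norm// (le_trans (fdS n t))// ler_norm.
split=> //.
have HC := Rintegral_dominated_cvg mH Hc iG HG.
have [_ farC] := far_cvg mX EX X_slope X_lattice.
have VC : \int[leb]_t (V n t * corr P (Z n) (Z n) t) @[n --> \oo] --> (0 : R).
  rewrite (_ : (fun n => _) = fine \o far P X); first by have /fine_cvgP[] := farC.
  by apply/funext => n; rewrite /= /Rintegral integral_far.
apply: (@squeeze_cvgr _ _ _ _ (fun=> 0) (fun n =>
    2 * \int[leb]_t (V n t * corr P (Z n) (Z n) t) + \int[leb]_t H n t)).
- near=> n; apply/andP; split; first by apply: Rintegral_ge0 => t _.
  rewrite -(RintegralZl 2 measurableT (integrable_V_corr n)) -(RintegralD measurableT (iVc n) (iH n)).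
  by apply: le_Rintegral => //; exact: (iS n).
- exact: cvg_cst.
- apply: (@cvg_to_eq R _ (2 * 0 + \int[leb]_t (0 : R))).
    rewrite mulr0 add0r /Rintegral; under eq_integral do rewrite /=.
    by rewrite integral0.
  by apply: cvgD => //; apply: cvgM => //; exact: cvg_cst.
Unshelve. all: by end_near. Qed.

Lemma exists_densities : exists2 p : nat -> 'rV[R]_d -> R,
  forall n, (0 < n)%N -> is_density P (normalized_sum X Xs n) (p n) &
  ('N[lebesgue_rV R d]_2%:E[(fun x => (p n x - std_normal_density x)%:E)])%E
      @[n --> \oo] --> 0%E.
Proof.
have [ifd fdc] := fd_int_cvg.
pose c : R := ((2 * pi) ^+ d)^-1.
have c0 : 0 <= c by rewrite invr_ge0 exprn_ge0// mulr_ge0 ?pi_ge0.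
have dens n : exists p : 'rV[R]_d -> R, is_density P (Z n) p /\
    (\int[leb]_x ((p x - std_normal_density x) ^+ 2)%:E <= (c * \int[leb]_t fd n t)%:E)%E.
  have [p [mp p0 pZ pL]] := exists_density (mZ n) (integrable_corr_Z n).
  exists p; split; first by split.
  rewrite (eq_integral (fun x => ((p x - sm P 1 O x) ^+ 2)%:E)) => [|x _]; last by rewrite sm_O.
  exact: (pL 1 O ltr01 mO).
have [p pP] := choice dens.
(* The predecessor undoes the shift of indices; the value at 0 is arbitrary. *)
exists (fun n => p n.-1) => [n n0|].
  by rewrite -(prednK n0); have [] := pP n.-1.
pose L n : \bar R := ('N[leb]_2%:E[(fun x => (p n x - std_normal_density x)%:E)])%E.
suff L0 : L n @[n --> \oo] --> 0%E by rewrite -cvg_shiftS; exact: L0.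
apply: (@squeeze_cvge _ _ _ _ (fun=> 0%E) _ (fun n => (Num.sqrt (c * \int[leb]_t fd n t))%:E)).
- near=> n; rewrite /L Lnorm2E.
  have fd0 : 0 <= c * \int[leb]_t fd n t.
    by rewrite mulr_ge0// Rintegral_ge0// => t _; exact: fdiff_ge0.
  rewrite poweR_ge0 andTb -powR12_sqrt// -poweR_EFin.
  have [_ h] := pP n.
  apply: gt0_ler_poweR => //; rewrite ?in_itv/= ?leey ?andbT ?lee_fin//.
  by apply: integral_ge0 => x _; rewrite lee_fin sqr_ge0.
- exact: cvg_cst.
- apply: cvg_EFin; first by near=> n.
  apply: (@cvg_to_eq R _ (Num.sqrt (c * 0))); first by rewrite mulr0 sqrtr0.
  apply: (@continuous_cvg _ _ _ _ _ _ (@Num.sqrt R)); first exact: sqrt_continuous.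
  by apply: cvgM => //; exact: cvg_cst.
Unshelve. all: by end_near. Qed.

End sufficiency.

Theorem theorem2p1 (R : realType) (d : nat) (d_gt0 : (0 < d)%N)
    (disp : measure_display) (T : measurableType disp) (P : probability T R)
    (X : {RV P >-> 'rV[R]_d}) (Xs : nat -> {RV P >-> 'rV[R]_d})
    (Xs_indep : independent_seq P Xs)
    (Xs_unif : forall n : nat, uniform_on_cube P (Xs n))
    (X_indep : independent_of_seq P X Xs) :
  let f := charfun P X in
  let Z := normalized_sum X Xs in
  let have_densities (p : nat -> 'rV[R]_d -> R) :=
    forall n : nat, (0 < n)%N -> is_density P (Z n) (p n) in
  let L2_convergence (p : nat -> 'rV[R]_d -> R) :=
    'N[lebesgue_rV R d]_2%:E[(fun x => (p n x - std_normal_density x)%:E)]%E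
      @[n --> \oo] --> 0%E in
  let f_vanishes := forall k : 'rV[int]_d, k != 0 -> f (pi_lattice R k) = 0 in
  (forall p : nat -> 'rV[R]_d -> R,
    have_densities p -> L2_convergence p -> f_vanishes)
  /\
  (('E_P[fun w => enorm (X w)] < +oo)%E ->
   (\int[lebesgue_rV R d]_t
      (Normc.normc (f t) * enormC (grad f t) / dist_pi_lattice t ^+ d.-1)%:E < +oo)%E ->
   f_vanishes ->
   exists2 p : nat -> 'rV[R]_d -> R, have_densities p & L2_convergence p).
Proof.
(* Positivity of the dimension lets one write it as [e.+1], so that [d.-1] reduces to [e]. *)
case: d d_gt0 X Xs Xs_indep Xs_unif X_indep => // e _ X Xs Xs_indep Xs_unif X_indep.
have mX : measurable_fun setT X by exact: measurable_funP.
have mXs k : measurable_fun setT (Xs k) by exact: measurable_funP.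
split=> [p Zp pL2 k k0|EX X_slope X_lattice].
  exact: (charfun_pi_lattice_eq0 mX mXs Xs_indep Xs_unif X_indep Zp pL2 k0).
apply: (exists_densities mX mXs Xs_indep Xs_unif X_indep EX).
- rewrite (eq_integral (fun t => (Normc.normc (charfun P X t) * enormC (grad (charfun P X) t) /
    dist_pi_lattice t ^+ e)%:E)) => [|t _]; first exact: X_slope.
  by rewrite normc_charfun (enormC_grad mX EX).
- by move=> k /X_lattice[C0 S0]; rewrite /corr /Ecos /Esin C0 S0 mulr0 addr0.
Qed.
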